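(* For every integer $r\geq 4$ and every integer $\ell\geq 2$ there exist $K_0\in\mathbb{N}$ and a constant $c=c(\ell,r)>0$ such that for all sufficiently large $n\in\mathbb{N}$ and every $K\geq K_0(\log n)^{2r^2}$ there exists a collection $\mathcal{G}_{\ell,r}(n,K)$ of at most $$\exp\left(n^{1+\frac{1}{2\ell-1}}(\log n)^{c}\right)$$ $r$-graphs on vertex set $[n]$ such that $e(G)\leq Kn^{r-1}$ for each $G\in\mathcal{G}_{\ell,r}(n,K)$, and every $C_{2\ell}^{(r)}$-free $r$-graph on $[n]$ is a subgraph of some $G\in\mathcal{G}_{\ell,r}(n,K)$.
   Context: An $r$-graph is an $r$-uniform hypergraph; $e(G)$ denotes its number of edges and $[n]=\{1,\dots,n\}$. The linear cycle $C_k^{(r)}$ is the $r$-graph obtained from the graph cycle $C_k$ by adding, to each of its $k$ edges, $r-2$ new vertices of degree one. A hypergraph is $H$-free if it contains no (not necessarily induced) subgraph isomorphic to $H$. (In the paper the factor $(\log n)^c$ is written ${\rm plog}_{\ell,r}(n)$, denoting a function of order $\Theta((\log n)^{f(\ell,r)})$ with $f(\ell,r)>0$ depending only on $\ell,r$.) *)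

(* Defs.v *)
From HB Require Import structures.
From mathcomp Require Import all_boot all_order all_algebra.
From mathcomp Require Import all_classical all_reals all_analysis.

Set Implicit Arguments.
Unset Strict Implicit.
Unset Printing Implicit Defensive.

(* A hypergraph with vertex type T is identified with its edge set, of type
   {set {set T}}; so [n] is 'I_n, e(G) is #|G|, and "G1 is a subgraph of G2"
   (on the same vertex type) is G1 \subset G2. *)

Definition uniform (T : finType) (r : nat) (G : {set {set T}}) : bool :=
  [forall e in G, #|e| == r].

Definition contains_copy (U V : finType) (H : {set {set U}})
    (G : {set {set V}}) : Prop :=
  exists f : U -> V, injective f /\ forall e, e \in H -> f @: e \in G.

Definition hfree (U V : finType) (H : {set {set U}})
    (G : {set {set V}}) : Prop :=
  ~ contains_copy H G.

(* inl i is the i-th vertex of the graph cycle C_k, and inr (i, j) is the j-th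
   new vertex added to the edge {i, i+1 mod k} of C_k (ordS is the cyclic
   successor). This is the linear cycle for k >= 3 and r >= 2. *)
Definition lin_cycle_edge (k r : nat) (i : 'I_k) :
    {set 'I_k + 'I_k * 'I_(r - 2)} :=
  [set inl i; inl (ordS i)] :|: [set inr (i, j) | j : 'I_(r - 2)].

Definition lin_cycle (k r : nat) : {set {set 'I_k + 'I_k * 'I_(r - 2)}} :=
  [set lin_cycle_edge r i | i : 'I_k].

(* Main.v *)
(* Give every edge x of an r-graph two of its vertices a x and b x as ends. Closed
   walks of length 2l in the resulting multigraph that visit distinct vertices,
   and whose edges meet only in consecutive ends, are copies of the linear cycle.
   A dyadic pigeonhole over all pairs of positions in an edge finds ends, and a
   subgraph losing only a power of log n, for which all degrees are nearly
   regular and no pair of ends is shared by a proportion more than n^(-2/3) of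
   the expected degree; the last point comes from the trivial bound
   |link(u)| <= product of the sizes of its projections. Passing to a subgraph
   maximising |E|^p / prod_h alpha_h(E), where alpha_h(E) is the largest number of
   closed walks of length 2h from a point, makes these numbers robust under
   deleting edges. Then log-convexity of h |-> tr(A^(2h)) shows that most closed
   walks are good and that a subfamily of them is balanced: the number of its
   members containing a set of j edges decays like (n^(1+1/(2l-1)) / |E|)^(j-1).
   This is the hypothesis of the container theorem, which covers the
   C_{2l}-free subgraphs of any r-graph G with |G| >= (log n)^(2r^2) n^(r-1) by
   exp(n^(1+1/(2l-1)) polylog n) subgraphs of size (1 - 1/polylog n)|G|; iterating
   polylog n times from the complete r-graph brings the sizes below K n^(r-1). *)

Require Import Defs.
From HB Require Import structures.
From mathcomp Require Import all_boot all_order all_algebra.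
From mathcomp Require Import all_classical all_reals all_analysis.
From mathcomp Require Import ring lra zify.
Import Order.TTheory GRing.Theory Num.Theory.
Import mathcomp.boot.fintype mathcomp.boot.finset.
Local Open Scope ring_scope.

Set Implicit Arguments.
Unset Strict Implicit.
Unset Printing Implicit Defensive.

(** * Walk counts of symmetric nonnegative matrices *)

Lemma le_of_eq d (T : porderType d) (x y : T) : x = y -> (x <= y)%O.
Proof. by move->. Qed.

Section Interpolation.
Variable R : realFieldType.
Implicit Types (t u : nat -> R) (x : R).

Lemma log_convex_le_end (l : nat) u : (0 < l)%N ->
  (forall h, (0 < h <= l)%N -> 0 < u h) ->
  (forall h, (0 < h)%N -> (h.+1 < l)%N -> u h.+1 ^+ 2 <= u h * u h.+2) ->
  u 1%N <= u l -> forall h, (0 < h <= l)%N -> u h <= u l.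
Proof.
move=> l0 u0 uc u1.
have down k : (k.+1 < l)%N -> u k.+2 < u k.+1 -> forall i, (i <= k)%N -> u k.+1 <= u i.+1.
  elim: k => [|k IHk] kl dec i; first by rewrite leqn0 => /eqP ->.
  have dec' : u k.+2 < u k.+1.
    have := uc k.+1 isT kl; rewrite expr2 leNgt => /negP h.
    rewrite ltNge; apply/negP => le; apply: h.
    have p1 : 0 < u k.+2 by apply: u0; lia.
    have p2 : 0 < u k.+1 by apply: u0; lia.
    apply: (@le_lt_trans _ _ (u k.+2 * u k.+3)).
      by rewrite ler_wpM2r // ltW //; apply: u0; lia.
    by rewrite ltr_pM2l.
  rewrite leq_eqVlt => /orP[/eqP ->//|]; rewrite ltnS => ik.
  by apply: le_trans (ltW dec') _; apply: IHk => //; lia.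
move=> h /andP[h0 hl].
have [k le_k] : exists k, l = (h + k)%N by exists (l - h)%N; lia.
elim: k h h0 hl le_k => [|k IHk] h h0 hl le_k; first by rewrite le_k addn0.
case: h h0 hl le_k => // h _ hl le_k.
have [le|dec] := leP (u h.+1) (u h.+2).
  by apply: le_trans le _; apply: IHk; lia.
by apply: le_trans u1; apply: (down h) => //; lia.
Qed.

Lemma log_convex_interp (l : nat) t x : (0 < l)%N -> 0 < x ->
  (forall h, (0 < h <= l)%N -> 0 < t h) ->
  (forall h, (0 < h)%N -> (h.+1 < l)%N -> t h.+1 ^+ 2 <= t h * t h.+2) ->
  t 1%N <= x ^+ (l - 1) * t l -> 
  forall h, (0 < h <= l)%N -> t h <= x ^+ (l - h) * t l.
Proof.
move=> l0 x0 tp tc t1 h hl.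
pose u k := t k * x ^+ k.
have := @log_convex_le_end l u l0 _ _ _ h hl; rewrite /u.
have -> : x ^+ l = x ^+ (l - h) * x ^+ h by rewrite -exprD subnK //; case/andP: hl.
rewrite mulrA ler_pM2r ?exprn_gt0 // [_ * t l]mulrC; apply.
- by move=> k hk; rewrite mulr_gt0 ?exprn_gt0 // tp.
- move=> k k0 kl; have := tc k k0 kl.
  rewrite -(ler_pM2r (_ : 0 < x ^+ (k.+1 + k.+1))) ?exprn_gt0 // exprMn -exprM muln2 -addnn.
  move/le_trans; apply; apply: le_of_eq.
  by rewrite addSnnS exprD; ring.
- rewrite expr1; move: t1; rewrite -(ler_pM2r x0) => /le_trans; apply.
  rewrite mulrAC -exprSr -mulrA -exprD subnK; last by case/andP: hl.
  by rewrite mulrC subn1 prednK.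
Qed.

End Interpolation.

Section SumCauchySchwarz.
Variable R : realFieldType.

Lemma sum_Cauchy_Schwarz (I : finType) (f g : I -> R) :
  (\sum_i f i * g i) ^+ 2 <= (\sum_i f i ^+ 2) * (\sum_i g i ^+ 2).
Proof.
set A := \sum_i f i ^+ 2; set B := \sum_i g i ^+ 2; set C := \sum_i f i * g i.
have B0 : 0 <= B by apply: sumr_ge0 => i _; exact: sqr_ge0.
have key : 0 <= B * (A * B - C ^+ 2).
  have -> : B * (A * B - C ^+ 2) = \sum_i (B * f i - C * g i) ^+ 2.
    have -> : \sum_i (B * f i - C * g i) ^+ 2
       = \sum_i (B ^+ 2 * f i ^+ 2 + (- (2 * B * C)) * (f i * g i) + C ^+ 2 * g i ^+ 2).
      by apply: eq_bigr => i _; ring.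
    by rewrite !big_split /= -!mulr_sumr -/A -/B -/C; ring.
  by apply: sumr_ge0 => i _; exact: sqr_ge0.
move: B0; rewrite le_eqVlt => /orP[/eqP B0|Bp]; last first.
  by move: key; rewrite pmulr_rge0 // subr_ge0.
suff -> : C = 0 by rewrite expr0n mulr_ge0 // ?sumr_ge0 // -?B0 // => i _; exact: sqr_ge0.
rewrite /C big1 // => i _; suff -> : g i = 0 by rewrite mulr0.
have /psumr_eq0P h := esym B0.
by have /eqP := h (fun j _ => sqr_ge0 _) i isT; rewrite sqrf_eq0 => /eqP.
Qed.
End SumCauchySchwarz.

Section Spectral.
Variables (R : realFieldType) (n : nat).
Implicit Types (S : 'M[R]_n).

Definition mxpow S k : 'M[R]_n := iter k (mulmx S) 1%:M.
Arguments mxpow : simpl never.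

Lemma mxpow0 S : mxpow S 0 = 1%:M. Proof. by []. Qed.
Lemma mxpowS S k : mxpow S k.+1 = S *m mxpow S k. Proof. by []. Qed.

Lemma mxpowD S k m : mxpow S (k + m) = mxpow S k *m mxpow S m.
Proof. by elim: k => [|k IHk]; rewrite ?mul1mx // addSn !mxpowS IHk mulmxA. Qed.

Lemma mxpow1 S : mxpow S 1 = S. Proof. by rewrite mxpowS mulmx1. Qed.

Lemma mxpow_ge0 S k : (forall u v, 0 <= S u v) -> forall u v, 0 <= mxpow S k u v.
Proof.
move=> S0; elim: k => [|k IHk] u v; first by rewrite mxE ler0n.
by rewrite mxpowS mxE sumr_ge0 // => w _; rewrite mulr_ge0.
Qed.

Lemma mulmx_le (A B C D : 'M[R]_n) : (forall u v, 0 <= A u v <= B u v) ->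
  (forall u v, 0 <= C u v <= D u v) -> forall u v, 0 <= (A *m C) u v <= (B *m D) u v.
Proof.
move=> AB CD u v; rewrite !mxE; apply/andP; split.
  apply: sumr_ge0 => w _; apply: mulr_ge0; by [case/andP: (AB u w) | case/andP: (CD w v)].
apply: ler_sum => w _; case/andP: (AB u w) => ? ?; case/andP: (CD w v) => ? ?.
exact: ler_pM.
Qed.

Lemma mxpow_le S S' k : (forall u v, 0 <= S u v <= S' u v) ->
  forall u v, mxpow S k u v <= mxpow S' k u v.
Proof.
move=> SS u v; suff: 0 <= mxpow S k u v <= mxpow S' k u v by case/andP.
elim: k u v => [|k IHk] u v; first by rewrite !mxpow0 lexx mxE ler0n.
by rewrite !mxpowS; apply: mulmx_le.
Qed.

Section Sym.
Variable S : 'M[R]_n.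
Hypothesis Ssym : S^T = S.

Lemma mxpow_sym k : (mxpow S k)^T = mxpow S k.
Proof.
elim: k => [|k IHk]; first by rewrite trmx1.
by rewrite -[in RHS]addn1 mxpowD mxpow1 mxpowS trmx_mul IHk Ssym.
Qed.

Lemma mxpow_symE k u v : mxpow S k u v = mxpow S k v u.
Proof. by rewrite -[in LHS]mxpow_sym mxE. Qed.

Lemma mxpow_diag h u : mxpow S (h + h) u u = \sum_w mxpow S h u w ^+ 2.
Proof.
rewrite mxpowD mxE; apply: eq_bigr => w _.
by rewrite [mxpow S h w u]mxpow_symE expr2.
Qed.

Lemma mxpow_CS h k u v :
  mxpow S (h + k) u v ^+ 2 <= mxpow S (h + h) u u * mxpow S (k + k) v v.
Proof.
rewrite !mxpow_diag mxpowD mxE.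
have -> : \sum_w mxpow S k v w ^+ 2 = \sum_w mxpow S k w v ^+ 2.
  by apply: eq_bigr => w _; rewrite mxpow_symE.
exact: sum_Cauchy_Schwarz.
Qed.

Lemma mxtrace_pow h k : \tr (mxpow S (h + k)) = \sum_(p : 'I_n * 'I_n) mxpow S h p.1 p.2 * mxpow S k p.1 p.2.
Proof.
rewrite /mxtrace -(pair_bigA _ (fun u v => mxpow S h u v * mxpow S k u v)) /=.
apply: eq_bigr => u _; rewrite mxpowD mxE; apply: eq_bigr => w _.
by rewrite [mxpow S k w u]mxpow_symE.
Qed.

Lemma mxtrace_CS h k :
  \tr (mxpow S (h + k)) ^+ 2 <= \tr (mxpow S (h + h)) * \tr (mxpow S (k + k)).
Proof.
rewrite !mxtrace_pow; apply: le_trans (sum_Cauchy_Schwarz _ _) _.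
by apply: le_of_eq; congr (_ * _);
   apply: eq_bigr => p _; rewrite expr2.
Qed.

Lemma mxtrace_pow_ge0 h : 0 <= \tr (mxpow S (h + h)).
Proof. by rewrite mxtrace_pow sumr_ge0 // => p _; rewrite -expr2 sqr_ge0. Qed.

(* The moments <y, S^(2k) y> are log-convex in k, hence grow at least
   geometrically, and the trace of S^(2l) dominates the l-th one. *)
Lemma mxtrace_lower (y : 'cV[R]_n) (l : nat) (Y c : R) :
  0 < Y -> \sum_u y u 0 ^+ 2 <= Y -> c = \sum_u y u 0 * (S *m y) u 0 -> 0 < c ->
  c ^+ (2 * l) <= Y ^+ (2 * l) * \tr (mxpow S (l + l)).
Proof.
move=> Y0 yY cE c0.
pose m k := \sum_u (mxpow S k *m y) u 0 ^+ 2.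
have mE h k : \sum_u (mxpow S h *m y) u 0 * (mxpow S k *m y) u 0
    = \sum_u y u 0 * (mxpow S (h + k) *m y) u 0.
  have dot (a b : 'cV[R]_n) : \sum_u a u 0 * b u 0 = (a^T *m b) 0 0.
    by rewrite mxE; apply: eq_bigr => u _; rewrite mxE.
  by rewrite !dot trmx_mul mxpow_sym mxpowD -!mulmxA.
have m0 : m 0%N <= Y by rewrite /m mxpow0 mul1mx.
have mge k : 0 <= m k by apply: sumr_ge0 => u _; exact: sqr_ge0.
have c1 : c ^+ 2 <= Y * m 1%N.
  apply: (@le_trans _ _ (m 0%N * m 1%N)); last by rewrite ler_wpM2r.
  rewrite cE /m mxpow0 mul1mx mxpow1; exact: sum_Cauchy_Schwarz.
have mc k : m k.+1 ^+ 2 <= m k * m k.+2.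
  have -> : m k.+1 = \sum_u (mxpow S k *m y) u 0 * (mxpow S k.+2 *m y) u 0.
    rewrite mE (_ : (k + k.+2 = k.+1 + k.+1)%N); last by lia.
    by rewrite -mE; apply: eq_bigr => u _; rewrite expr2.
  exact: sum_Cauchy_Schwarz.
have m1p : 0 < m 1%N.
  by rewrite -(pmulr_rgt0 _ Y0); apply: lt_le_trans c1; rewrite exprn_gt0.
have ratio k : 0 < m k.+1 /\ c ^+ 2 * m k <= Y ^+ 2 * m k.+1.
  elim: k => [|k [p IHk]].
    split=> //; apply: (@le_trans _ _ (c ^+ 2 * Y)); first by rewrite ler_wpM2l ?sqr_ge0.
    by rewrite expr2 mulrC -mulrA ler_pM2l.
  have c2 : 0 < c ^+ 2 by rewrite exprn_gt0.
  have Y2 : 0 < Y ^+ 2 by rewrite exprn_gt0.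
  have h := mc k.
  have p0 : 0 < m k.
    rewrite lt_neqAle mge andbT eq_sym; apply/eqP => e; move: h; rewrite e mul0r.
    by rewrite leNgt exprn_gt0.
  have p2 : 0 < m k.+2.
    rewrite lt_neqAle mge andbT eq_sym; apply/eqP => e; move: h; rewrite e mulr0.
    by rewrite leNgt exprn_gt0.
  split=> //; rewrite -(ler_pM2l p0).
  apply: (@le_trans _ _ (Y ^+ 2 * m k.+1 * m k.+1)).
    have -> : m k * (c ^+ 2 * m k.+1) = c ^+ 2 * m k * m k.+1 by ring.
    by rewrite ler_pM2r.
  have -> : m k * (Y ^+ 2 * m k.+2) = Y ^+ 2 * (m k * m k.+2) by ring.
  by rewrite -mulrA -expr2 ler_pM2l.
have geo : c ^+ (2 * l) * m 0%N <= Y ^+ (2 * l) * m l.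
  rewrite !exprM; elim: l => [|k IHk]; first by rewrite !expr0.
  rewrite ![_ ^+ 2 ^+ k.+1]exprSr; case: (ratio k) => _ r.
  apply: (@le_trans _ _ (c ^+ 2 * ((Y ^+ 2) ^+ k * m k))).
    by rewrite [X in X * _]mulrC -[leLHS]mulrA ler_wpM2l ?sqr_ge0.
  rewrite mulrCA -[leRHS]mulrA; apply: ler_wpM2l; last exact: r.
  by apply: exprn_ge0; exact: sqr_ge0.
have top : m l <= \tr (mxpow S (l + l)) * m 0%N.
  have -> : \tr (mxpow S (l + l)) = \sum_u \sum_v mxpow S l u v ^+ 2.
    by apply: eq_bigr => u _; rewrite mxpow_diag.
  rewrite /m mxpow0 mul1mx mulr_suml; apply: ler_sum => u _.
  rewrite [in leLHS]mxE; exact: sum_Cauchy_Schwarz.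
have m0p : 0 < m 0%N.
  rewrite lt_neqAle mge andbT eq_sym; apply/eqP => e; have := mc 0%N.
  by rewrite e mul0r leNgt exprn_gt0.
rewrite -(ler_pM2r m0p); apply: le_trans geo _; rewrite -mulrA.
by rewrite ler_wpM2l // exprn_ge0 // ltW.
Qed.

Lemma mxpow_supersol (phi : 'I_n -> R) (g D rho : R) :
  (forall u v, 0 <= S u v <= D) -> 0 < g -> (forall u, 0 < phi u) ->
  (forall u, \sum_v S u v * phi v <= g * phi u) ->
  (forall u w, phi u <= rho * phi w) ->
  forall k u v, mxpow S k.+1 u v <= g ^+ k * D * rho.
Proof.
move=> S0 g0 phi0 sup prho k u v.
have P0 j x w : 0 <= mxpow S j x w.
  by apply: mxpow_ge0 => a b; case/andP: (S0 a b).
have it j x : \sum_w mxpow S j x w * phi w <= g ^+ j * phi x.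
  elim: j x => [|j IHj] x.
    rewrite (bigD1 x) //= big1 ?mxE ?eqxx ?addr0 ?expr0 // => w wx.
    by rewrite mxE eq_sym (negPf wx) mul0r.
  under eq_bigr do rewrite mxpowS mxE mulr_suml.
  rewrite exchange_big /=; apply: (@le_trans _ _ (\sum_w S x w * (g ^+ j * phi w))).
    apply: ler_sum => w _; under eq_bigr do rewrite -mulrA.
    by rewrite -mulr_sumr ler_wpM2l //; case/andP: (S0 x w).
  under eq_bigr do rewrite mulrCA.
  by rewrite -mulr_sumr exprSr -mulrA ler_wpM2l // exprn_ge0 // ltW.
rewrite -addn1 mxpowD mxpow1 mxE -(ler_pM2r (phi0 u)).
have D0 : 0 <= D by case/andP: (S0 u u) => a /(le_trans a).
apply: (@le_trans _ _ (\sum_w D * rho * (mxpow S k u w * phi w))).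
  rewrite mulr_suml; apply: ler_sum => w _.
  rewrite -[leLHS]mulrA [leRHS]mulrCA ler_wpM2l // -mulrA.
  by apply: ler_pM => //; [case/andP: (S0 w v) | exact: ltW | case/andP: (S0 w v)].
rewrite -mulr_sumr; have rho0 : 0 <= rho.
  by rewrite -(pmulr_lge0 _ (phi0 u)); apply: le_trans (prho u u); exact: ltW.
rewrite -[g ^+ k * D * rho]mulrA [leRHS]mulrAC [leRHS]mulrC ler_wpM2l ?mulr_ge0 //.
Qed.
End Sym.

End Spectral.
Arguments mxpow : simpl never.

(** * Closed walks with prescribed edges *)

Lemma sum_tupleS (R : nmodType) (Q : finType) k (F : seq Q -> R) :
  \sum_(t : k.+1.-tuple Q) F t = \sum_(d : Q) \sum_(t : k.-tuple Q) F (d :: t).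
Proof.
rewrite pair_bigA /= (reindex (fun p : Q * k.-tuple Q => cons_tuple p.1 p.2)) //=.
exists (fun t : k.+1.-tuple Q => (thead t, behead_tuple t)) => [[d t]|t] _ /=.
  by congr pair; rewrite ?theadE //; apply: val_inj.
by rewrite [RHS]tuple_eta; apply: val_inj.
Qed.

Section Walks.
Variables (R : realFieldType) (n : nat) (X : finType) (a b : X -> 'I_n).

(* A dart (o, x) is the edge x traversed from a x to b x if o = false, and
   backwards if o = true. *)
Notation dart := (bool * X)%type.
Implicit Types (d : dart) (t : seq dart) (D : {set dart}) (W : seq {set dart}).

Definition src d := if d.1 then b d.2 else a d.2.
Definition tgt d := if d.1 then a d.2 else b d.2.

Fixpoint conn (u : 'I_n) t (v : 'I_n) : bool :=
  if t is d :: t' then (src d == u) && conn (tgt d) t' v else u == v.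

Definition closedw t := if t is d :: _ then conn (src d) t (src d) else false.

Definition fits t W := all2 (fun d D => d \in D) t W.

Definition arcmx D : 'M[R]_n :=
  \matrix_(u, v) #|[set d in D | (src d == u) && (tgt d == v)]|%:R.

Definition wordmx W : 'M[R]_n := foldr (fun D M => arcmx D *m M) 1%:M W.

Definition darts (E : {set X}) : {set dart} := [set d | d.2 \in E].

Lemma arcmxE D u v :
  arcmx D u v = \sum_(d in D) ((src d == u) && (tgt d == v))%:R.
Proof.
rewrite mxE -sum1dep_card natr_sum big_mkcondr.
by apply: eq_bigr => d _; case: (_ && _).
Qed.

Lemma arcmx_ge0 D u v : 0 <= arcmx D u v.
Proof. by rewrite mxE. Qed.

Lemma sum_conn W u v :
  \sum_(t : (size W).-tuple dart) (conn u t v && fits t W)%:R = wordmx W u v.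
Proof.
elim: W u v => [|D W IHW] u v /=.
  rewrite (big_pred1 [tuple]) => [|t]; last by apply/esym/eqP; exact: tuple0.
  by rewrite andbT mxE.
rewrite (@sum_tupleS R dart (size W) (fun t => (conn u t v && fits t (D :: W))%:R)) mxE.
under [RHS]eq_bigr do rewrite arcmxE mulr_suml.
rewrite [RHS]exchange_big /= [RHS]big_mkcond; apply: eq_bigr => d _.
rewrite (bigD1 (tgt d)) //= [X in _ = if _ then _ + X else _]big1 ?addr0 => [|w wd]; last first.
  by rewrite [tgt d == w]eq_sym (negPf wd) andbF mul0r.
rewrite eqxx andbT -IHW; case: (d \in D); last first.
  by rewrite big1 // => t _; rewrite andbF.
by rewrite mulr_sumr; apply: eq_bigr => t _; case: (src d == u); rewrite ?mul1r ?mul0r.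
Qed.

Lemma sum_closed W : (0 < size W)%N ->
  \sum_(t : (size W).-tuple dart) (closedw t && fits t W)%:R = \tr (wordmx W).
Proof.
move=> W0; rewrite /mxtrace; under [RHS]eq_bigr do rewrite -sum_conn.
rewrite exchange_big /=; apply: eq_bigr => t _.
case: t => -[|d t] /= /eqP st; first by move: W0; rewrite -st.
rewrite (bigD1 (src d)) //= eqxx /= big1 ?addr0 // => u ud.
by rewrite eq_sym (negPf ud).
Qed.

Lemma wordmx_cat W1 W2 : wordmx (W1 ++ W2) = wordmx W1 *m wordmx W2.
Proof. by elim: W1 => [|D W1 IH] /=; rewrite ?mul1mx // IH mulmxA. Qed.

Lemma tr_wordmx_catC W1 W2 : \tr (wordmx (W1 ++ W2)) = \tr (wordmx (W2 ++ W1)).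
Proof. by rewrite !wordmx_cat mxtrace_mulC. Qed.

Lemma wordmx_ge0 W u v : 0 <= wordmx W u v.
Proof.
elim: W u => [|D W IH] u /=; first by rewrite mxE.
by rewrite mxE sumr_ge0 // => w _; rewrite mulr_ge0 ?arcmx_ge0.
Qed.

Lemma wordmx_nseq k D : wordmx (nseq k D) = mxpow (arcmx D) k.
Proof. by elim: k => //= k ->. Qed.

Lemma wordmx_le_at W W' i (c : R) : size W = size W' -> (i < size W)%N -> 0 <= c ->
  (forall m, m != i -> nth set0 W m = nth set0 W' m) ->
  (forall u v, arcmx (nth set0 W i) u v <= c * arcmx (nth set0 W' i) u v) ->
  forall u v, wordmx W u v <= c * wordmx W' u v.
Proof.
move=> + + c0; elim: W W' i => [|D W IH] [|D' W'] // i [sW] iW eqW le u v /=.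
rewrite !mxE mulr_sumr; apply: ler_sum => w _.
case: i iW eqW le => [|i] iW eqW le.
  have -> : W = W' by apply: (@eq_from_nth _ set0) => // m _; apply: (eqW m.+1).
  by rewrite mulrA ler_wpM2r ?wordmx_ge0.
have -> : D = D' by apply: (eqW 0%N).
rewrite mulrCA ler_wpM2l ?arcmx_ge0 //; apply: (IH W' i) => //.
by move=> m mi; apply: (eqW m.+1).
Qed.

Lemma arcmx_mono D D' u v : D \subset D' -> arcmx D u v <= arcmx D' u v.
Proof.
move=> /subsetP DD; rewrite !mxE ler_nat subset_leq_card //; apply/subsetP => d.
by rewrite !inE => /andP[/DD ->].
Qed.

Lemma dartsS (E E' : {set X}) : E \subset E' -> darts E \subset darts E'.
Proof. by move=> /subsetP EE; apply/subsetP => d; rewrite !inE => /EE. Qed.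

Lemma arcmx_darts_sym (E : {set X}) : (arcmx (darts E))^T = arcmx (darts E).
Proof.
apply/matrixP => u v; rewrite !mxE; congr _%:R.
pose f d : dart := (~~ d.1, d.2).
have ff : involutive f by case=> o x; rewrite /f /= negbK.
rewrite -(card_imset _ (inv_inj ff)); apply: eq_card => d.
rewrite -{1}[d]ff (mem_imset _ _ (inv_inj ff)) !inE.
by rewrite /src /tgt /f /=; case: (d.1); rewrite /= [X in _ && X = _]andbC.
Qed.

Lemma arcmx1 x u v : arcmx (darts [set x]) u v =
  ((a x == u) && (b x == v))%:R + ((b x == u) && (a x == v))%:R.
Proof.
rewrite arcmxE (eq_bigl (fun d => (d == (false, x)) || (d == (true, x)))); last first.
  by case=> -[] y; rewrite !inE !xpair_eqE /= ?orbF.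
rewrite (bigD1 (false, x)) ?eqxx //= (big_pred1 (true, x)) // => -[[] y] /=;
  by rewrite !xpair_eqE /= ?andbF ?andbT ?orbF //; case: (y == x).
Qed.

Lemma mul_arcmx1 (M N : 'M[R]_n) x u v : (M *m (arcmx (darts [set x]) *m N)) u v
  = M u (a x) * N (b x) v + M u (b x) * N (a x) v.
Proof.
have row w : (arcmx (darts [set x]) *m N) w v
    = (a x == w)%:R * N (b x) v + (b x == w)%:R * N (a x) v.
  rewrite mxE; under eq_bigr do rewrite arcmx1 mulrDl -!mulnb !natrM.
  rewrite big_split /=; congr (_ + _).
    rewrite (bigD1 (b x)) //= eqxx mulr1 big1 ?addr0 // => w' ww.
    by rewrite [b x == w']eq_sym (negPf ww) mulr0 mul0r.
  rewrite (bigD1 (a x)) //= eqxx mulr1 big1 ?addr0 // => w' ww.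
  by rewrite [a x == w']eq_sym (negPf ww) mulr0 mul0r.
rewrite mxE; under eq_bigr do rewrite row mulrDr.
rewrite big_split /=; congr (_ + _).
  rewrite (bigD1 (a x)) //= eqxx mul1r big1 ?addr0 // => w ww.
  by rewrite eq_sym (negPf ww) mul0r mulr0.
rewrite (bigD1 (b x)) //= eqxx mul1r big1 ?addr0 // => w ww.
by rewrite eq_sym (negPf ww) mul0r mulr0.
Qed.

Section FixedPositions.
Variable E : {set X}.
Variables (beta G1 : R).
Let S := arcmx (darts E).
Hypothesis beta0 : 0 <= beta.
Hypothesis beta1 : 2 * beta <= 1.
Hypothesis G10 : 0 < G1.
Hypothesis powS : forall k u v, mxpow S k.+1 u v <= beta * G1 ^+ k.+1.

Implicit Types o : seq (option X).

Definition optdarts (x : option X) := if x is Some x then darts [set x] else darts E.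
Definition optword o := map optdarts o.
Definition optloopless o := all (fun x => if x is Some x then a x != b x else true) o.
Definition nfree o := count (fun x => ~~ isSome x) o.

(* runs false o is the number of maximal runs of free positions in o; with
   true, o is preceded by a free position. *)
Fixpoint runs (c : bool) o : nat :=
  if o is x :: o' then (if x is Some _ then (c + runs false o')%N else runs true o')
  else c.

Lemma optword_entry o s : optloopless o -> forall u v,
  (mxpow S s *m wordmx (optword o)) u v
    <= (2 * beta) ^+ runs (s != 0%N) o * G1 ^+ (s + nfree o).
Proof.
have b20 : 0 <= 2 * beta by rewrite mulr_ge0.
elim: o s => [|[x|] o IH] s /=.
- move=> _ u v; rewrite mulmx1 addn0; case: s => [|s] /=.
    by rewrite !expr0 mul1r mxE lern1 leq_b1.
  apply: le_trans (powS s u v) _; rewrite ler_wpM2r ?exprn_ge0 ?(ltW G10) //.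
  by rewrite expr1; lra.
- move=> /andP[ab oo] u v; rewrite mul_arcmx1 add0n.
  have W0 w w' : wordmx (optword o) w w' <= (2 * beta) ^+ runs false o * G1 ^+ nfree o.
    by have := IH 0%N oo w w'; rewrite mxpow0 mul1mx add0n.
  set B := _ * G1 ^+ nfree o in W0.
  have B0 : 0 <= B by rewrite mulr_ge0 ?exprn_ge0 // ltW.
  case: s => [|s] /=.
    rewrite !add0n !mxE; have [->|ua] := eqVneq u (a x).
      by rewrite (negPf ab) mul0r addr0 mul1r.
    by rewrite mul0r add0r; case: (u == b x); rewrite ?mul1r ?mul0r.
  rewrite exprD expr1 exprD mulrACA -/B.
  have P1 w : mxpow S s.+1 u w * B <= beta * G1 ^+ s.+1 * B by rewrite ler_wpM2r.
  have P2 w w' : mxpow S s.+1 u w * wordmx (optword o) w' v <= mxpow S s.+1 u w * B.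
    rewrite ler_wpM2l //; apply: mxpow_ge0 => *; exact: arcmx_ge0.
  have -> : 2 * beta * G1 ^+ s.+1 * B = beta * G1 ^+ s.+1 * B + beta * G1 ^+ s.+1 * B by ring.
  by apply: lerD; [apply: le_trans (P1 (a x)) | apply: le_trans (P1 (b x))].
- move=> oo u v; have := IH s.+1 oo u v.
  rewrite mulmxA -[S in _ *m S *m _]mxpow1 -mxpowD addn1 add1n addnS addSn => h.
  by apply: le_trans h _; rewrite ler_wpM2r ?exprn_ge0 ?(ltW G10).
Qed.

Lemma runs_le o : (runs false o <= runs true o)%N.
Proof. by case: o => [|[x|] o] //=; rewrite leq_addl. Qed.

Lemma runs_gt0 c p m : (0 < runs c (p ++ nseq m.+1 None))%N.
Proof.
elim: p c => [|[x|] p IH] c //=; last by rewrite addn_gt0 IH orbT.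
by elim: m.
Qed.

Lemma runs_ge2 p m :
  (exists xs k, p = map Some xs ++ nseq k None) \/ (2 <= runs false (p ++ nseq m.+1 None))%N.
Proof.
elim: p => [|[x|] p [[xs [k ->]]|IH]] /=.
- by left; exists [::], 0%N.
- by left; exists (x :: xs), k.
- by right.
- case: xs => [|x xs]; first by left; exists [::], k.+1.
  by right; rewrite /= ltnS runs_gt0.
- by right; apply: leq_trans (runs_le _).
Qed.

Lemma optword_Some xs o (B : R) : optloopless (map Some xs) ->
  (forall u v, 0 <= wordmx (optword o) u v <= B) ->
  forall u v, wordmx (optword (map Some xs ++ o)) u v <= B.
Proof.
move=> /= ll oB; elim: xs ll => [|x xs IH] /=; first by move=> _ u v; case/andP: (oB u v).
move=> /andP[ab /IH le] u v; rewrite -[arcmx _ *m _]mul1mx mul_arcmx1 !mxE.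
have [->|ua] := eqVneq u (a x).
  by rewrite (negPf ab) mul0r addr0 mul1r le.
rewrite mul0r add0r; case: (u == b x); rewrite ?mul1r ?le // mul0r.
by case/andP: (oB u u) => /le_trans; apply.
Qed.

Lemma tr_optword o : optloopless o -> has isSome o ->
  \tr (wordmx (optword o)) <= 2 * (2 * beta) ^+ 2 * G1 ^+ nfree o \/
  (forall B, (forall u v, mxpow S (nfree o) u v <= B) -> \tr (wordmx (optword o)) <= 2 * B).
Proof.
move=> oo hS.
have tr_cons x p : \tr (wordmx (optword (Some x :: p)))
    = wordmx (optword p) (b x) (a x) + wordmx (optword p) (a x) (b x).
  rewrite -[X in \tr X]mul1mx /= /mxtrace; under eq_bigr do rewrite mul_arcmx1 !mxE.
  rewrite big_split /=; congr (_ + _).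
    rewrite (bigD1 (a x)) //= eqxx mul1r big1 ?addr0 // => w ww; by rewrite (negPf ww) mul0r.
  rewrite (bigD1 (b x)) //= eqxx mul1r big1 ?addr0 // => w ww; by rewrite (negPf ww) mul0r.
have [hN|/negPf nN] := boolP (None \in o); last first.
  right => B leB; case: o oo hS nN leB => [|[x|] o] //= /andP[ab oo] _ nN leB.
  have oE : o = map Some (pmap id o).
    elim: o oo nN {leB} => [|[y|] o IH] //= /andP[_ oo] nN; congr (_ :: _); exact: IH.
  have n0 : nfree o = 0%N.
    by apply/eqP; rewrite oE /nfree count_map -leqn0 leqNgt -has_count; apply/hasPn.
  have le1 u v : wordmx (optword o) u v <= B.
    rewrite oE -[map _ _]cats0; apply: optword_Some; first by rewrite -oE.
    move=> w w'; rewrite wordmx_ge0 /=.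
    by have := leB w w'; rewrite n0.
  rewrite (tr_cons x o) mulr_natl mulr2n; exact: lerD.
have [p [pE pS]] : exists p, \tr (wordmx (optword o)) = \tr (wordmx (optword (None :: p))) /\
    perm_eq o (None :: p).
  case/splitPr: hN => o1 o2; exists (o2 ++ o1); rewrite -cat_cons; split.
    by rewrite /optword !map_cat tr_wordmx_catC.
  by rewrite perm_catC.
have hSp : has isSome p by move: hS; rewrite (perm_has _ pS).
have [x [m [p' pE']]] : exists x m p', p = nseq m None ++ Some x :: p'.
  elim: p hSp {pE pS} => [|[x|] p IH] //= h; first by exists x, 0%N, p.
  by have [x [m [p' ->]]] := IH h; exists x, m.+1, p'.
set q := p' ++ nseq m.+1 None.
have qE : \tr (wordmx (optword o)) = \tr (wordmx (optword (Some x :: q))).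
  by rewrite pE pE' -cat_cons -[None :: nseq m None]/(nseq m.+1 None) /optword map_cat tr_wordmx_catC -map_cat.
have qS : perm_eq o (Some x :: q).
  by apply: perm_trans pS _; rewrite pE' -cat_cons -[None :: nseq m None]/(nseq m.+1 None) perm_catC.
have nq : nfree o = nfree q by rewrite /nfree (permP qS).
have qq : optloopless q.
  by move: oo; rewrite /optloopless (perm_all _ qS) => /andP[].
rewrite qE tr_cons nq; case: (runs_ge2 p' m) => [[xs [k kE]]|r2].
  right => B leB; rewrite mulr_natl mulr2n.
  have qE' : q = map Some xs ++ nseq (k + m.+1) None by rewrite /q kE -catA -nseqD.
  have nE : nfree q = (k + m.+1)%N.
    rewrite qE' /nfree count_cat count_nseq /= mul1n count_map -[RHS]add0n; congr (_ + _)%N.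
    by apply/eqP; rewrite -leqn0 leqNgt -has_count; apply/hasPn.
  have le1 u v : wordmx (optword q) u v <= B.
    rewrite qE'; apply: optword_Some; first by move: qq; rewrite qE' /optloopless all_cat => /andP[].
    move=> w w'; rewrite wordmx_ge0 /= /optword map_nseq wordmx_nseq -nE; exact: leB.
  exact: lerD.
left.
have le1 u v : wordmx (optword q) u v <= (2 * beta) ^+ 2 * G1 ^+ nfree q.
  have := optword_entry 0 qq u v; rewrite mxpow0 mul1mx add0n => /le_trans; apply.
  rewrite ler_wpM2r ?exprn_ge0 ?(ltW G10) //.
  by apply: ler_wiXn2l => //; rewrite mulr_ge0.
by rewrite -mulrA mulr_natl mulr2n lerD.
Qed.

End FixedPositions.

End Walks.

Lemma leq_card_bigcup (I T : finType) (P : pred I) (f : I -> {set T}) :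
  (#|\bigcup_(i | P i) f i| <= \sum_(i | P i) #|f i|)%N.
Proof.
elim/big_rec2: _ => [|i m A _ le]; first by rewrite cards0.
by apply: leq_trans (leq_card_setU _ _) _; rewrite leq_add2l.
Qed.

Section ClosedWalks.
Variables (R : realFieldType) (n : nat) (X : finType) (a b : X -> 'I_n).
Notation dart := (bool * X)%type.
Notation src := (src a b).
Notation tgt := (tgt a b).
Notation arcmx := (arcmx R a b).
Notation wordmx := (wordmx R a b).
Notation closedw := (closedw a b).
Implicit Types (E T : {set X}) (W : seq {set dart}).

Definition cwalks E k : {set k.-tuple dart} :=
  [set t : k.-tuple dart | closedw t && all (fun d => d.2 \in E) t].

Lemma card_fits W k : size W = k -> (0 < k)%N ->
  #|[set t : k.-tuple dart | closedw t && fits t W]|%:R = \tr (wordmx W).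
Proof.
move=> sW k0; subst k; rewrite -sum_closed // -sum1dep_card natr_sum big_mkcond.
by apply: eq_bigr => t _; case: ifP.
Qed.

Lemma fits_nthP d0 (t : seq dart) W : size t = size W ->
  reflect (forall m, (m < size W)%N -> nth d0 t m \in nth set0 W m) (fits t W).
Proof.
move=> st; apply: (iffP idP) => [|h].
  elim: t W st => [|d t IH] [|D W] //= [st] /andP[dD tW] [|m] ml //=; exact: IH.
elim: t W st h => [|d t IH] [|D W] //= [st] h.
rewrite (h 0%N) //=; apply: IH => // m; exact: (h m.+1).
Qed.

Lemma fits_tuple k (t : k.-tuple dart) (D : 'I_k -> {set dart}) :
  fits t [seq D m | m <- enum 'I_k] = [forall m, tnth t m \in D m].
Proof.
have [k0|k0] := posnP k.
  by subst k; rewrite enum_ord0 tuple0 /=; apply/esym/forallP => -[[]].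
have d0 : dart by case: k t D k0 => // k t _ _; exact: tnth t ord0.
have sz : size t = size [seq D m | m <- enum 'I_k] by rewrite size_tuple size_map size_enum_ord.
apply/(fits_nthP d0 sz)/forallP => [h m|h m].
  have := h m; rewrite size_map size_enum_ord ltn_ord => /(_ isT).
  by rewrite (nth_map m) ?size_enum_ord // nth_ord_enum (tnth_nth d0).
rewrite size_map size_enum_ord => mk.
have := h (Ordinal mk); rewrite (nth_map (Ordinal mk)) ?size_enum_ord //.
have -> : nth (Ordinal mk) (enum 'I_k) m = Ordinal mk.
  by apply: val_inj; rewrite /= nth_enum_ord.
by rewrite (tnth_nth d0).
Qed.

Lemma card_positions k (D : 'I_k -> {set dart}) : (0 < k)%N ->
  #|[set t : k.-tuple dart | closedw t && [forall m, tnth t m \in D m]]|%:R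
    = \tr (wordmx [seq D m | m <- enum 'I_k]).
Proof.
move=> k0; rewrite -(@card_fits _ k) //; last by rewrite size_map size_enum_ord.
by congr (_%:R); apply: eq_card => t; rewrite !inE fits_tuple.
Qed.

Lemma cwalksE E k (t : k.-tuple dart) :
  (t \in cwalks E k) = closedw t && [forall m, tnth t m \in darts E].
Proof.
rewrite inE; congr (_ && _); apply/all_tnthP/forallP => h m; have := h m; by rewrite inE.
Qed.

Lemma card_cwalks E k : (0 < k)%N -> #|cwalks E k|%:R = \tr (mxpow (arcmx (darts E)) k).
Proof.
move=> k0; rewrite -wordmx_nseq.
have -> : nseq k (darts E) = [seq darts E | m <- enum 'I_k].
  by rewrite -[in LHS](size_enum_ord k); elim: (enum 'I_k) => //= m s ->.
by rewrite -card_positions //; congr (_%:R); apply: eq_card => t; rewrite cwalksE inE.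
Qed.

Lemma card_coincide E k (i i' : 'I_k) : (i < i')%N ->
  #|[set t in cwalks E k | src (tnth t i) == src (tnth t i')]|%:R <=
  \sum_x mxpow (arcmx (darts E)) (i' - i) x x * mxpow (arcmx (darts E)) (k - (i' - i)) x x.
Proof.
move=> ii; have k0 : (0 < k)%N by apply: leq_ltn_trans (ltn_ord i).
set S := arcmx (darts E).
pose Dx x := darts E :&: [set d | src d == x].
pose D x (m : 'I_k) := if (m == i) || (m == i') then Dx x else darts E.
have rowE x (A : 'M[R]_n) u v : (delta_mx x x *m A) u v = (u == x)%:R * A x v.
  rewrite mxE (bigD1 x) //= mxE eqxx andbT big1 ?addr0 // => w wx.
  by rewrite mxE (negPf wx) andbF mul0r.
have Dxm x : arcmx (Dx x) = delta_mx x x *m S.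
  apply/matrixP => u v; rewrite rowE !arcmxE; have [->|ux] := eqVneq u x.
    rewrite mul1r [LHS]big_mkcond [RHS]big_mkcond; apply: eq_bigr => d _.
    by rewrite !inE; case: (d.2 \in E); case: (src d == x).
  rewrite mul0r big1 // => d; rewrite in_setI inE inE => /andP[_ /eqP ->].
  by rewrite eq_sym (negPf ux).
have sum_le : #|[set t in cwalks E k | src (tnth t i) == src (tnth t i')]|%:R
    <= \sum_x \tr (wordmx [seq D x m | m <- enum 'I_k]).
  under eq_bigr do rewrite -card_positions //.
  rewrite -natr_sum ler_nat.
  apply: (@leq_trans #|\bigcup_x [set t : k.-tuple dart | closedw t && [forall m, tnth t m \in D x m]]|).
    apply/subset_leq_card/subsetP => t; rewrite inE cwalksE => /andP[/andP[ct /forallP tE] /eqP e].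
    apply/bigcupP; exists (src (tnth t i)) => //; rewrite inE ct /=; apply/forallP => m.
    rewrite /D; case: ifP => [/orP[]/eqP ->|_]; rewrite ?tE //= in_setI tE inE /= ?eqxx // e eqxx //.
  exact: leq_card_bigcup.
apply: le_trans sum_le _; apply: ler_sum => x _; apply: le_of_eq.
have -> : [seq D x m | m <- enum 'I_k] = nseq i (darts E) ++ Dx x :: nseq (i' - i).-1 (darts E)
     ++ Dx x :: nseq (k - i'.+1) (darts E).
  have i'k := ltn_ord i'.
  apply: (@eq_from_nth _ set0) => [|m].
    by rewrite size_map size_enum_ord !(size_cat, size_nseq, size_cat) /= size_cat size_nseq /= size_nseq; lia.
  rewrite size_map size_enum_ord => mk; rewrite (nth_map (Ordinal mk)) ?size_enum_ord //.
  have -> : nth (Ordinal mk) (enum 'I_k) m = Ordinal mk.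
    by apply: val_inj; rewrite /= nth_enum_ord.
  rewrite /D -!val_eqE /= nth_cat size_nseq nth_nseq.
  case: (ltngtP m i) => [mi|im|->] /=; last by rewrite subnn.
    by rewrite ltn_eqF //; apply: leq_trans mi _; exact: ltnW.
  have [q qE] : exists q, (m - i = q.+1)%N by exists (m - i).-1; lia.
  rewrite qE /= nth_cat size_nseq nth_nseq.
  case: (ltngtP m i') => [mi|im'|me] /=.
  - by have -> : (q < (i' - i).-1)%N by lia.
  - have -> : (q < (i' - i).-1)%N = false by lia.
    have [q' qE'] : exists q', (q - (i' - i).-1 = q'.+1)%N by exists (q - (i' - i).-1).-1; lia.
    rewrite qE' /= nth_nseq; by have -> : (q' < k - i'.+1)%N by lia.
  - have -> : (q < (i' - i).-1)%N = false by lia.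
    by have -> : (q - (i' - i).-1 = 0)%N by lia.
have consE D0 W0 : wordmx (D0 :: W0) = arcmx D0 *m wordmx W0 by [].
rewrite tr_wordmx_catC !(consE, wordmx_cat) !wordmx_nseq Dxm -/S.
have trE (M N : 'M[R]_n) : \tr (delta_mx x x *m M *m (delta_mx x x *m N)) = M x x * N x x.
  rewrite /mxtrace (bigD1 x) //= big1 ?addr0 => [|u ux]; last first.
    by rewrite -mulmxA rowE (negPf ux) mul0r.
  rewrite -mulmxA rowE eqxx mul1r mxE (bigD1 x) //= big1 ?addr0 => [|u ux]; last first.
    by rewrite rowE (negPf ux) mul0r mulr0.
  by rewrite rowE eqxx mul1r.
have i'k := ltn_ord i'.
rewrite -[in LHS]mulmxA -[in LHS]mulmxA.
set M := mxpow S _; set M2 := mxpow S (k - _); set M3 := mxpow S i.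
have -> : delta_mx x x *m (S *m (M *m (delta_mx x x *m S *m M2) *m M3))
   = delta_mx x x *m (S *m M) *m (delta_mx x x *m (S *m M2 *m M3)) by rewrite !mulmxA.
rewrite trE -mulmxA -mxpowS -[M2 *m M3]mxpowD -mxpowS.
by congr (mxpow S _ x x * mxpow S _ x x); lia.
Qed.

Lemma card_restrict E E2 k (i i' : 'I_k) (f : X) (c : R) : i != i' -> f \in E -> E2 \subset E ->
  0 <= c -> (forall u v, arcmx (darts E2) u v <= c * arcmx (darts E) u v) ->
  #|[set t in cwalks E k | ((tnth t i).2 == f) && ((tnth t i').2 \in E2)]|%:R <=
  c * #|[set t in cwalks E k | (tnth t i).2 == f]|%:R.
Proof.
move=> ii fE E2E c0 le; have k0 : (0 < k)%N by apply: leq_ltn_trans (ltn_ord i).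
pose D (A : {set X}) (m : 'I_k) := if m == i then darts [set f] else if m == i' then darts A else darts E.
have cardE (A : {set X}) : A \subset E ->
  #|[set t in cwalks E k | ((tnth t i).2 == f) && ((tnth t i').2 \in A)]|%:R
   = \tr (wordmx [seq D A m | m <- enum 'I_k]).
  move=> AE; rewrite -card_positions //; congr (_%:R); apply: eq_card => t.
  rewrite !inE -andbA; congr (_ && _); apply/andP/forallP => [[/all_tnthP tE /andP[ti ti']] m|h].
    rewrite /D; case: eqP => [->|_]; first by rewrite !inE.
    by case: eqP => [->|_]; rewrite inE ?tE.
  split; last first.
    have := h i; have := h i'; rewrite /D eqxx eq_sym (negPf ii) eqxx !inE.
    by move=> -> ->.
  apply/all_tnthP => m; have := h m; rewrite /D; case: eqP => [->|_]; first by rewrite !inE => /eqP ->.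
  by case: eqP => [->|_]; rewrite inE // => /(subsetP AE).
have -> : #|[set t in cwalks E k | (tnth t i).2 == f]|%:R = \tr (wordmx [seq D E m | m <- enum 'I_k]).
  rewrite -cardE //; congr (_%:R); apply: eq_card => t; rewrite !inE; case: (closedw t) => //=.
  by case: (boolP (all _ t)) => //= /all_tnthP h; rewrite h andbT.
have szD (A : {set X}) : size [seq D A m | m <- enum 'I_k] = k by rewrite size_map size_enum_ord.
rewrite cardE // /mxtrace mulr_sumr; apply: ler_sum => u _.
have nthD (A : {set X}) (m : 'I_k) : nth set0 [seq D A m | m <- enum 'I_k] m = D A m.
  by rewrite (nth_map m) ?size_enum_ord // nth_ord_enum.
apply: (@wordmx_le_at _ _ _ _ _ _ _ i') => //; rewrite ?szD //.
  move=> m mi; have [mk|mk] := ltnP m k; last first.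
    by rewrite !nth_default ?szD.
  by rewrite (nthD E2 (Ordinal mk)) (nthD E (Ordinal mk)) /D -[Ordinal mk == i']val_eqE /= (negPf mi).
by move=> v w; rewrite !nthD /D eq_sym (negPf ii) eqxx.
Qed.

Lemma card_contains E T k (B : R) : (0 < k)%N -> T \subset E ->
  (forall o : seq (option X), size o = k ->
     all (fun x => if x is Some y then y \in T else true) o ->
     (nfree o + #|T| = k)%N -> \tr (wordmx (optword E o)) <= B) ->
  0 <= B ->
  #|[set t in cwalks E k | T \subset [set d.2 | d in t]]|%:R <= (#|T|.+1)%:R ^+ k * B.
Proof.
move=> k0 TE oB B0.
set A := [set t in _ | _].
pose fst (t : k.-tuple dart) (m : 'I_k) := [forall m' : 'I_k, (m' < m)%N ==> ((tnth t m').2 != (tnth t m).2)].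
pose pat (t : k.-tuple dart) : {ffun 'I_k -> option X} :=
  [ffun m => if ((tnth t m).2 \in T) && fst t m then Some (tnth t m).2 else None].
pose O := [set f : {ffun 'I_k -> option X} | f \in ffun_on (mem (None |: [set Some y | y in T]))].
have patO t : pat t \in O.
  rewrite inE; apply/ffun_onP => m; rewrite ffunE; case: ifP => [/andP[h _]|_]; rewrite !inE //.
  by rewrite imset_f // orbT.
have cardO : #|O| = (#|T|.+1 ^ k)%N.
  rewrite cardsE card_ffun_on card_ord cardsU1 card_imset; last by move=> ? ? [].
  suff -> : None \notin [set Some y | y in T] by rewrite add1n.
  by apply/negP => /imsetP[].
pose fib f := [set t in A | pat t == f].
have Acov : (#|A| <= \sum_(f in O) #|fib f|)%N.
  apply: leq_trans (leq_card_bigcup _ _); apply/subset_leq_card/subsetP => t tA.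
  by apply/bigcupP; exists (pat t) => //; rewrite inE tA eqxx.
apply: (@le_trans _ _ (\sum_(f in O) B)); last by rewrite sumr_const cardO -natrX mulr_natl.
apply: le_trans (_ : (\sum_(f in O) #|fib f|)%:R <= _); first by rewrite ler_nat.
rewrite natr_sum; apply: ler_sum => f fO.
have [->|] := eqVneq (fib f) set0; first by rewrite cards0.
case/set0Pn => t0; rewrite inE => /andP[t0A /eqP pf].
pose D (m : 'I_k) := optdarts E (f m).
have sub : fib f \subset [set t : k.-tuple dart | closedw t && [forall m, tnth t m \in D m]].
  apply/subsetP => t; rewrite inE inE cwalksE => /andP[/andP[/andP[ct /forallP tE] _] /eqP pt].
  rewrite inE ct /=; apply/forallP => m; rewrite /D -pt ffunE; case: ifP => _ /=; last exact: tE.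
  by rewrite !inE.
apply: (@le_trans _ _ #|[set t : k.-tuple dart | closedw t && [forall m, tnth t m \in D m]]|%:R).
  by rewrite ler_nat subset_leq_card.
rewrite card_positions //.
have -> : [seq D m | m <- enum 'I_k] = optword E [seq f m | m <- enum 'I_k].
  by rewrite /optword; elim: (enum 'I_k) => //= m s ->.
apply: oB.
- by rewrite size_map size_enum_ord.
- apply/allP => x /mapP[m _ ->]; move: fO; rewrite inE => /ffun_onP/(_ m).
  rewrite !inE => /orP[/eqP ->//|/imsetP[y yT ->]//].
- have -> : nfree [seq f m | m <- enum 'I_k] = #|[set m | ~~ isSome (f m)]|.
    by rewrite /nfree count_map -sum1_count big_enum_cond -sum1dep_card; apply: eq_bigl => m.
  pose C := [set m : 'I_k | isSome (f m)].
  have -> : [set m | ~~ isSome (f m)] = ~: C by apply/setP => m; rewrite !inE.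
  suff -> : #|T| = #|C| by rewrite addnC cardsC card_ord.
  have CE : C = [set m | ((tnth t0 m).2 \in T) && fst t0 m].
    by apply/setP => m; rewrite !inE -pf ffunE; case: ifP.
  have injC : {in C &, injective (fun m => (tnth t0 m).2)}.
    move=> m m'; rewrite CE !inE => /andP[_ /forallP h1] /andP[_ /forallP h2] e.
    apply: val_inj; case: (ltngtP m m') => // lt; [have := h2 m | have := h1 m'];
      by rewrite lt e eqxx.
  rewrite -(card_in_imset injC); apply: eq_card => x; apply/idP/imsetP => [xT|[m]]; last first.
    by rewrite CE inE => /andP[h _] ->.
  move: t0A; rewrite inE => /andP[_ /subsetP/(_ x xT)/imsetP[d dt xd]].
  have [m0 m0E] : exists m0, d = tnth t0 m0 by apply/tnthP.
  have Pm0 : (tnth t0 m0).2 == x by rewrite -m0E xd.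
  case: (@arg_minnP 'I_k m0 (fun m => (tnth t0 m).2 == x) (fun m => m : nat) Pm0) => m /eqP mx mmin.
  exists m => //; rewrite CE inE mx xT /=; apply/forallP => m'; apply/implyP => lt.
  by apply/negP => e; have := mmin m'; rewrite -mx => /(_ e); rewrite leqNgt lt.
Qed.

End ClosedWalks.

(** * Supersaturation of linear cycles *)

Section Extremal.
Variables (R : realFieldType) (n : nat) (X : finType) (a b : X -> 'I_n).
Implicit Types (E F : {set X}).

Definition adj E : 'M[R]_n := arcmx R a b (darts E).
Definition alpha E h : R := \big[Num.max/0]_x mxpow (adj E) (h + h) x x.
Definition clw E h : R := \tr (mxpow (adj E) (h + h)).

Lemma adj_sym E : (adj E)^T = adj E.
Proof. exact: arcmx_darts_sym. Qed.

Lemma adj_mono E F : E \subset F -> forall u v, 0 <= adj E u v <= adj F u v.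
Proof. by move=> EF u v; rewrite arcmx_ge0 arcmx_mono // dartsS. Qed.

Lemma adjpow_ge0 E k u v : 0 <= mxpow (adj E) k u v.
Proof. by apply: mxpow_ge0 => *; exact: arcmx_ge0. Qed.

Lemma adjpow_mono E F k u v : E \subset F -> mxpow (adj E) k u v <= mxpow (adj F) k u v.
Proof. by move=> EF; apply: mxpow_le => *; exact: adj_mono. Qed.

Lemma clw_mono E F h : E \subset F -> clw E h <= clw F h.
Proof. by move=> EF; apply: ler_sum => x _; exact: adjpow_mono. Qed.

Lemma alpha_ge E h x : mxpow (adj E) (h + h) x x <= alpha E h.
Proof. exact: (le_bigmax _ (fun x => mxpow (adj E) (h + h) x x)). Qed.

Lemma alpha_le E h (B : R) : 0 <= B ->
  (forall x, mxpow (adj E) (h + h) x x <= B) -> alpha E h <= B.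
Proof. by move=> B0 le; apply/bigmax_leP; split. Qed.

Lemma alpha_mono E F h : E \subset F -> alpha E h <= alpha F h.
Proof.
move=> EF; apply: alpha_le => [|x].
  by apply/bigmax_geP; left.
by apply: le_trans (alpha_ge F h x); exact: adjpow_mono.
Qed.

Lemma adj_end_ge1 E x : x \in E -> 1 <= adj E (a x) (b x).
Proof.
move=> xE; rewrite mxE ler1n card_gt0; apply/set0Pn; exists (false, x).
by rewrite !inE xE /src /tgt /= !eqxx.
Qed.

Lemma diag_ge1 E x h : x \in E -> 1 <= mxpow (adj E) (h + h) (a x) (a x).
Proof.
move=> xE; elim: h => [|h IH]; first by rewrite mxpow0 mxE eqxx.
have -> : (h.+1 + h.+1 = 2 + (h + h))%N by lia.
rewrite mxpowD mxE (bigD1 (a x)) //.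
have h2 : 1 <= mxpow (adj E) 2 (a x) (a x).
  rewrite -[2%N]/(1 + 1)%N (mxpow_diag (adj_sym E)) mxpow1 (bigD1 (b x)) //.
  have e1 := adj_end_ge1 xE.
  by apply: ler_wpDr; [apply: sumr_ge0 => *; exact: sqr_ge0 | rewrite exprn_ege1].
apply: ler_wpDr; last exact: mulr_ege1.
by apply: sumr_ge0 => w _; rewrite mulr_ge0 ?adjpow_ge0.
Qed.

Lemma alpha_ge1 E h : E != set0 -> 1 <= alpha E h.
Proof. by case/set0Pn => x xE; apply: le_trans (alpha_ge E h (a x)); exact: diag_ge1. Qed.

Lemma clw_ge1 E h : E != set0 -> 1 <= clw E h.
Proof.
case/set0Pn => x xE; rewrite /clw /mxtrace (bigD1 (a x)) //=.
by apply: ler_wpDr; [apply: sumr_ge0 => *; exact: adjpow_ge0 | exact: diag_ge1].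
Qed.

(* Maximising |E|^p / prod_h alpha E h gives a subgraph in which, up to the
   factor 2^p, no alpha drops when at most half of the edges are deleted. *)
Lemma extremal_subgraph E1 (l p : nat) (kappa : R) : (0 < p)%N -> 0 < kappa -> E1 != set0 ->
  \prod_(h < l) alpha E1 h.+1 <= kappa ^+ p ->
  exists E : {set X}, [/\ E \subset E1, E != set0, #|E1|%:R <= kappa * #|E|%:R &
    forall F, F \subset E -> (#|E| <= 2 * #|F|)%N ->
      forall h, (h < l)%N -> alpha E h.+1 <= 2 ^+ p * alpha F h.+1].
Proof.
move=> p0 k0 E10 hk.
pose Phi E := \prod_(h < l) alpha E h.+1.
have Phi1 E : E != set0 -> 1 <= Phi E.
  move=> E0; rewrite /Phi; elim/big_ind: _ => // [x y x1 y1|h _]; first exact: mulr_ege1.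
  exact: alpha_ge1.
have Phi0 E : E != set0 -> 0 < Phi E by move=> /Phi1; exact: lt_le_trans.
pose f E : R := #|E|%:R ^+ p / Phi E.
pose P := [pred E : {set X} | (E \subset E1) && (E != set0)].
have P1 : P E1 by rewrite inE subxx.
case: (@Order.TotalTheory.arg_maxP _ _ _ E1 P f P1) => E; rewrite inE => /andP[EE1 E0] Emax.
have Epos : 0 < (#|E|%:R : R) by rewrite ltr0n card_gt0.
exists E; split=> //.
  have /= := Emax E1 P1; rewrite /f ler_pdivrMr ?Phi0 // mulrAC ler_pdivlMr ?Phi0 // => h.
  rewrite -(@ler_pXn2r _ p) ?nnegrE ?mulr_ge0 ?(ltW k0) //.
  rewrite exprMn [leRHS]mulrC.
  apply: le_trans (_ : _ <= #|E|%:R ^+ p * Phi E1) _; last by rewrite ler_wpM2l ?exprn_ge0.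
  by apply: le_trans h; rewrite ler_peMr ?exprn_ge0 ?Phi1.
move=> F FE EF h hl.
have F0 : F != set0.
  apply/eqP => F0; move: EF; rewrite F0 cards0 muln0 leqn0 cards_eq0; exact/negP.
have PF : P F by rewrite inE F0 (subset_trans FE).
have /= := Emax F PF; rewrite /f ler_pdivrMr ?Phi0 // mulrAC ler_pdivlMr ?Phi0 // => hF.
have PhiEF : Phi E <= 2 ^+ p * Phi F.
  have Fpos : 0 < (#|F|%:R : R) ^+ p by rewrite exprn_gt0 // ltr0n card_gt0.
  rewrite -(ler_pM2l Fpos); apply: le_trans hF _; rewrite mulrA ler_wpM2r ?(ltW (Phi0 _ F0)) //.
  rewrite mulrC -exprMn ler_pXn2r ?nnegrE ?mulr_ge0 //.
  by rewrite -natrM ler_nat.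
pose rest G := \prod_(i < l | i != Ordinal hl) alpha G i.+1.
have rE G : Phi G = alpha G h.+1 * rest G by rewrite /Phi (bigD1 (Ordinal hl)).
have restE0 : 0 < rest E.
  by apply: prodr_gt0 => i _; apply: lt_le_trans (alpha_ge1 _ E0).
have restFE : rest F <= rest E.
  apply: ler_prod => i _; rewrite (le_trans ler01 (alpha_ge1 _ F0)) /=; exact: alpha_mono.
move: PhiEF; rewrite !rE -(ler_pM2r restE0) => h1.
have aF0 : 0 <= 2 ^+ p * alpha F h.+1 by rewrite mulr_ge0 ?exprn_ge0 ?(le_trans ler01 (alpha_ge1 _ F0)).
rewrite -(ler_pM2r restE0); apply: le_trans (_ : _ <= 2 ^+ p * (alpha F h.+1 * rest F)) _.
  by move: h1; rewrite ler_pM2r.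
by rewrite mulrA ler_wpM2l.
Qed.

Lemma adjpow_isolated E x h : (forall y, y \in E -> (a y != x) && (b y != x)) ->
  mxpow (adj E) (h.+1 + h.+1) x x = 0.
Proof.
move=> iso; rewrite addSn mxpowS mxE big1 // => w _.
suff -> : adj E x w = 0 by rewrite mul0r.
rewrite /adj arcmxE big1 // => -[c y]; rewrite inE => /iso /andP[ay byy]. move: ay byy => /= ay byy.
by rewrite /src /=; case: (c); rewrite ?(negPf ay) ?(negPf byy).
Qed.

Lemma alpha_le_clw E F (z Delta : R) h : 0 < z -> E != set0 -> F \subset E ->
  (3 * #|E| <= 4 * #|F|)%N ->
  (forall u, #|[set x in E | (a x == u) || (b x == u)]|%:R <= Delta) ->
  (forall F', F' \subset E -> (#|E| <= 2 * #|F'|)%N -> alpha E h.+1 <= z * alpha F' h.+1) ->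
  alpha E h.+1 * #|E|%:R <= 4 * z * Delta * clw F h.+1.
Proof.
move=> z0 E0 FE EF deg reg.
have Delta0 : 0 <= Delta.
  by case/set0Pn: E0 => x _; apply: le_trans (deg (a x)); rewrite ler0n.
have aE := alpha_ge1 h.+1 E0.
pose K x := mxpow (adj F) (h.+1 + h.+1) x x.
pose T := [set x | alpha E h.+1 <= z * K x].
pose F' := [set x in F | (a x \notin T) && (b x \notin T)].
have F'F : F' \subset F by apply/subsetP => x; rewrite inE => /andP[].
have small : (2 * #|F'| < #|E|)%N.
  rewrite ltnNge; apply/negP => big; have := reg F' (subset_trans F'F FE) big.
  apply/negP; rewrite -ltNge -ltr_pdivlMl //.
  have lt0 : 0 < z^-1 * alpha E h.+1 by rewrite mulr_gt0 ?invr_gt0 // (lt_le_trans ltr01).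
  apply/bigmax_ltP; split=> // x _; have [xT|xT] := boolP (x \in T).
    rewrite adjpow_isolated => [//|y]; rewrite inE => /and3P[_ aT bTT].
    by apply/andP; split; apply/eqP => e; [move: aT | move: bTT]; rewrite e xT.
  apply: le_lt_trans (adjpow_mono _ _ _ F'F) _.
  by rewrite ltr_pdivlMl //; move: xT; rewrite inE -ltNge.
have cover : (#|E|%:R : R) <= 4 * (#|T|%:R * Delta).
  have : (#|F :\: F'|%:R : R) <= #|T|%:R * Delta.
    apply: (@le_trans _ _ (\sum_(u in T) #|[set x in E | (a x == u) || (b x == u)]|%:R)).
      rewrite -natr_sum ler_nat; apply: leq_trans (leq_card_bigcup _ _).
      apply/subset_leq_card/subsetP => x; rewrite !inE => /andP[+ xF].
      have xE := subsetP FE _ xF.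
      rewrite xF /= negb_and !negbK => /orP[] uT; apply/bigcupP.
        by exists (a x); rewrite inE // xE eqxx.
      by exists (b x); rewrite inE // xE eqxx orbT.
    by rewrite mulr_natl -sumr_const; apply: ler_sum => u _.
  move=> le; have : (#|E| <= 4 * #|F :\: F'|)%N.
    by have := cardsID F' F; rewrite (setIidPr F'F); lia.
  rewrite -(ler_nat R) natrM => /le_trans; apply; by rewrite ler_wpM2l.
have low : #|T|%:R * alpha E h.+1 <= z * clw F h.+1.
  rewrite /clw /mxtrace mulr_sumr [leRHS](bigID (mem T)) /= mulr_natl -sumr_const.
  apply: ler_wpDr; first by apply: sumr_ge0 => x _; apply: mulr_ge0 (ltW z0) _; exact: adjpow_ge0.
  by apply: ler_sum => x; rewrite inE.
apply: (@le_trans _ _ (alpha E h.+1 * (4 * (#|T|%:R * Delta)))).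
  by rewrite ler_wpM2l // (le_trans ler01).
have -> : alpha E h.+1 * (4 * (#|T|%:R * Delta)) = 4 * Delta * (#|T|%:R * alpha E h.+1) by ring.
have -> : 4 * z * Delta * clw F h.+1 = 4 * Delta * (z * clw F h.+1) by ring.
by rewrite ler_wpM2l // mulr_ge0.
Qed.

Lemma clw_interp E (l : nat) (x : R) : (0 < l)%N -> 0 < x -> E != set0 ->
  clw E 1 <= x ^+ (l - 1) * clw E l ->
  forall h, (0 < h <= l)%N -> clw E h <= x ^+ (l - h) * clw E l.
Proof.
move=> l0 x0 E0 h1; apply: log_convex_interp => // h.
  by move=> _; apply: lt_le_trans (clw_ge1 h E0).
move=> _ _; have := mxtrace_CS (adj_sym E) h h.+2.
by rewrite (_ : (h + h.+2 = h.+1 + h.+1)%N) //; lia.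
Qed.

End Extremal.

Lemma ffact_le_expn n m : (n ^_ m <= n ^ m)%N.
Proof.
elim: m n => [|m IH] n; first by rewrite ffactn0.
rewrite ffactnS expnS leq_mul2l; apply/orP; right.
apply: leq_trans (IH _) _; have [->|m0] := posnP m; first by rewrite !expn0.
by rewrite leq_exp2r // leq_pred.
Qed.

Lemma bin_le_expn n m : ('C(n, m) <= n ^ m)%N.
Proof.
apply: leq_trans (ffact_le_expn n m); rewrite -bin_ffact.
by rewrite leq_pmulr // fact_gt0.
Qed.

Lemma card_supersets (T : finType) (A : {set T}) r :
  (#|[set x : {set T} | (#|x| == r) && (A \subset x)]| <= #|T| ^ (r - #|A|))%N.
Proof.
apply: leq_trans (bin_le_expn _ _); rewrite -card_draws.
pose f (x : {set T}) := x :\: A.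
rewrite -(card_in_imset (f := f)).
  apply/subset_leq_card/subsetP => y /imsetP[x]; rewrite inE => /andP[/eqP cx Ax] ->.
  by rewrite inE cardsD (setIidPr Ax) cx.
move=> x y; rewrite !inE => /andP[_ Ax] /andP[_ Ay] e.
by rewrite -(setID x A) -(setID y A) (setIidPr Ax) (setIidPr Ay) -/(f x) -/(f y) e.
Qed.

Section GoodWalks.
Variables (R : realFieldType) (n : nat) (a b : {set 'I_n} -> 'I_n).
Notation X := {set 'I_n}.
Notation dart := (bool * X)%type.
Notation adj := (adj R a b).
Notation src := (src a b).
Notation tgt := (tgt a b).
Implicit Types (F : {set X}).

Definition coincide k (t : k.-tuple dart) (i i' : 'I_k) := src (tnth t i) == src (tnth t i').

Definition touches k (t : k.-tuple dart) (i i' : 'I_k) :=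
  [exists w, [&& w \in (tnth t i).2, w \in (tnth t i').2,
     w != a (tnth t i').2 & w != b (tnth t i').2]].

(* The ends of the edges of a good walk are distinct, and two of its edges meet
   only in their ends: its edges form a linear cycle. *)
Definition good k (t : k.-tuple dart) :=
  [forall i : 'I_k, forall i' : 'I_k, ((i < i')%N ==> ~~ coincide t i i') && ((i != i') ==> ~~ touches t i i')].

Lemma adj_third F w (r : nat) (theta : R) :
  (forall x, x \in F -> [/\ #|x| = r, a x \in x, b x \in x & a x != b x]) ->
  0 < theta -> (forall x, x \in F -> theta <= adj F (a x) (b x)) -> forall u v,
  adj [set x in F | [&& w \in x, w != a x & w != b x]] u v
    <= (n%:R ^+ (r - 3) / theta) * adj F u v.
Proof.
move=> hF th0 cod u v; set Ew := [set x in F | _].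
have c0 : 0 <= n%:R ^+ (r - 3) / theta by rewrite divr_ge0 ?exprn_ge0 // ltW.
pose A := [set d in darts Ew | (src d == u) && (tgt d == v)].
have [A0|] := eqVneq A set0.
  by rewrite {1}/adj mxE -/A A0 cards0 mulr_ge0 ?arcmx_ge0.
case/set0Pn => -[c x]; rewrite !inE => /andP[/and4P[xF wx wa wb] /andP[/eqP su /eqP tv]].
have [cx ax bx ab] := hF x xF.
have thle : theta <= adj F u v.
  have symF p q : adj F p q = adj F q p by rewrite -[in LHS](adj_sym R a b F) mxE.
  have codx := cod x xF; move: su tv; rewrite /src /tgt /=; case: (c) => <- <- //.
  by rewrite symF.
have uv : u != v by move: su tv; rewrite /src /tgt /=; case: (c) => <- <- //; rewrite eq_sym.
have wuv : (w != u) && (w != v).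
  by move: su tv; rewrite /src /tgt /=; case: (c) => <- <-; rewrite wa wb.
have A3 : #|[set u; v; w]| = 3%N.
  rewrite setUC cardsU1 cards2 !inE uv; case/andP: wuv => /negPf -> /negPf ->; by [].
have le3 : (#|A| <= n ^ (r - 3))%N.
  have := card_supersets [set u; v; w] r; rewrite card_ord A3; apply: leq_trans.
  pose f (d : dart) := d.2.
  rewrite -(card_in_imset (f := f)).
    apply/subset_leq_card/subsetP => y /imsetP[[c' x'] ].
    rewrite !inE => /andP[/and4P[xF' wx' _ _] /andP[/eqP su' /eqP tv']] -> /=.
    have [cx' ax' bx' _] := hF x' xF'.
    rewrite cx' eqxx /= /f /=; apply/subsetP => y'; rewrite !inE.
    by move: su' tv'; rewrite /src /tgt /=; case: (c') => <- <- /orP[/orP[]|] /eqP ->.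
  move=> [c1 x1] [c2 x2]; rewrite !inE => /andP[/and4P[x1F _ _ _] /andP[/eqP s1 /eqP t1]].
  move=> /andP[_ /andP[/eqP s2 /eqP t2]]; rewrite /f /= => e; rewrite -e in s2 t2 *.
  have [_ _ _ n1] := hF x1 x1F.
  move: s1 t1 s2 t2 n1; rewrite /src /tgt /=; case: (c1); case: (c2) => // -> -> e1 e2;
    by rewrite e1 eqxx.
rewrite {1}/adj mxE -/A; apply: (@le_trans _ _ (n%:R ^+ (r - 3))).
  by rewrite -natrX ler_nat.
by rewrite -mulrA ler_peMr ?exprn_ge0 // mulrC ler_pdivlMr ?mul1r.
Qed.

Lemma card_touches F k (i i' : 'I_k) (r : nat) (theta : R) :
  (forall x, x \in F -> [/\ #|x| = r, a x \in x, b x \in x & a x != b x]) ->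
  0 < theta -> (forall x, x \in F -> theta <= adj F (a x) (b x)) -> i != i' ->
  #|[set t in cwalks a b F k | touches t i i']|%:R <=
  r%:R * (n%:R ^+ (r - 3) / theta) * #|cwalks a b F k|%:R.
Proof.
move=> hF th0 cod ii; set c := _ / theta.
have c0 : 0 <= c by rewrite divr_ge0 ?exprn_ge0 // ltW.
pose Ew w := [set x in F | [&& w \in x, w != a x & w != b x]].
pose N f w := [set t in cwalks a b F k | ((tnth t i).2 == f) && ((tnth t i').2 \in Ew w)].
pose M f := [set t in cwalks a b F k | (tnth t i).2 == f].
have le1 : (#|[set t in cwalks a b F k | touches t i i']| <= \sum_(f in F) \sum_(w in f) #|N f w|)%N.
  apply: (@leq_trans (\sum_(f in F) #|\bigcup_(w in f) N f w|)); last first.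
    by apply: leq_sum => f _; exact: leq_card_bigcup.
  apply: leq_trans (leq_card_bigcup _ _); apply/subset_leq_card/subsetP => t.
  rewrite inE => /andP[tc /existsP[w /and4P[wi wi' wa wb]]].
  have tF m : (tnth t m).2 \in F by move: tc; rewrite inE => /andP[_ /all_tnthP].
  apply/bigcupP; exists (tnth t i).2 => //; apply/bigcupP; exists w => //.
  by rewrite inE tc eqxx inE tF wi' wa wb.
rewrite -(ler_nat R) in le1; apply: le_trans le1 _; rewrite natr_sum.
have cwE : #|cwalks a b F k| = (\sum_(f in F) #|M f|)%N.
  rewrite -sum1_card (partition_big (fun t => (tnth t i).2) (mem F)) /=.
    by apply: eq_bigr => f _; rewrite -sum1_card; apply: eq_bigl => t; rewrite !inE.
  by move=> t; rewrite inE => /andP[_ /all_tnthP].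
rewrite cwE natr_sum mulr_sumr; apply: ler_sum => f fF; rewrite natr_sum.
apply: (@le_trans _ _ (\sum_(w in f) c * #|M f|%:R)).
  apply: ler_sum => w _; apply: card_restrict => //.
    by apply/subsetP => x; rewrite inE => /andP[].
  move=> u v; exact: adj_third.
have [cf _ _ _] := hF f fF; rewrite sumr_const cf -[leLHS]mulr_natl mulrA; exact: lexx.
Qed.

Lemma card_good F k (r : nat) (theta B : R) :
  (forall x, x \in F -> [/\ #|x| = r, a x \in x, b x \in x & a x != b x]) ->
  0 < theta -> (forall x, x \in F -> theta <= adj F (a x) (b x)) ->
  4 * k%:R ^+ 2 * (r%:R * (n%:R ^+ (r - 3) / theta)) <= 1 -> 0 <= B ->
  (forall s, (0 < s < k)%N ->
     \sum_x mxpow (adj F) s x x * mxpow (adj F) (k - s) x x <= B) ->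
  4 * k%:R ^+ 2 * B <= #|cwalks a b F k|%:R ->
  #|cwalks a b F k|%:R <= 2 * (#|[set t in cwalks a b F k | good t]|%:R : R).
Proof.
move=> hF th0 cod small B0 hB hB4.
set c := _ * (_ / theta) in small; set Om := cwalks a b F k.
have [k0|k0] := posnP k.
  have -> : Om = set0.
    by apply/setP => t; rewrite !inE; subst k; rewrite tuple0.
  by rewrite cards0 mulr_ge0.
pose N1 (p : 'I_k * 'I_k) := if (p.1 < p.2)%N then [set t in Om | coincide t p.1 p.2] else set0.
pose N2 (p : 'I_k * 'I_k) := if p.1 != p.2 then [set t in Om | touches t p.1 p.2] else set0.
have cover : (#|Om| <= #|[set t in Om | good t]| + \sum_p #|N1 p| + \sum_p #|N2 p|)%N.
  apply: (@leq_trans #|[set t in Om | good t] :|: \bigcup_p N1 p :|: \bigcup_p N2 p|).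
    apply/subset_leq_card/subsetP => t tO; rewrite !in_setU -orbA.
    have [gt|] := boolP (good t); first by rewrite inE tO gt.
    rewrite negb_forall => /existsP[i]; rewrite negb_forall => /existsP[i'].
    move=> /nandP[]; rewrite negb_imply negbK => /andP[ii h].
      apply/orP; right; apply/orP; left; apply/bigcupP; exists (i, i') => //.
      by rewrite /N1 /= ii inE tO.
    apply/orP; right; apply/orP; right; apply/bigcupP; exists (i, i') => //.
    by rewrite /N2 /= ii inE tO.
  apply: leq_trans (leq_card_setU _ _) _; apply: leq_add; last exact: leq_card_bigcup.
  by apply: leq_trans (leq_card_setU _ _) _; apply: leq_add => //; exact: leq_card_bigcup.
have kk : (#|{: 'I_k * 'I_k}|%:R : R) = k%:R ^+ 2 by rewrite card_prod card_ord expr2 natrM.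
have s1 : (\sum_p #|N1 p|)%:R <= k%:R ^+ 2 * B.
  rewrite natr_sum -kk mulr_natl -sumr_const; apply: ler_sum => -[i i'] _.
  rewrite /N1 /=; case: ifP => ii; last by rewrite cards0.
  apply: le_trans (card_coincide R a b F ii) _; apply: hB.
  by rewrite subn_gt0 ii /=; apply: leq_ltn_trans (leq_subr _ _) (ltn_ord i').
have s2 : (\sum_p #|N2 p|)%:R <= k%:R ^+ 2 * (c * #|Om|%:R).
  rewrite natr_sum -kk mulr_natl -sumr_const; apply: ler_sum => -[i i'] _.
  rewrite /N2 /=; case: ifP => ii; first exact: card_touches.
  by rewrite cards0 !mulr_ge0 ?exprn_ge0 // invr_ge0 ltW.
have : (#|Om|%:R : R) <= #|[set t in Om | good t]|%:R + k%:R ^+ 2 * B + k%:R ^+ 2 * (c * #|Om|%:R).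
  move: cover; rewrite -(ler_nat R) !natrD => /le_trans; apply.
  by apply: lerD => //; apply: lerD.
have : k%:R ^+ 2 * (c * #|Om|%:R) <= #|Om|%:R / 4.
  rewrite ler_pdivlMr //; have -> : k%:R ^+ 2 * (c * #|Om|%:R) * 4 = (4 * k%:R ^+ 2 * c) * #|Om|%:R by ring.
  by rewrite ler_piMl.
rewrite -/Om in hB4; lra.
Qed.

End GoodWalks.

Definition cexp l := (4 * l ^ 2 + 6 * l + 10)%N.

Lemma cexp_generic l : (2 + 2 * l + 2 * l <= cexp l)%N.
Proof. by rewrite /cexp; lia. Qed.

Lemma cexp_spectral l : (4 + (2 * l + 1) * (2 * l) <= cexp l)%N.
Proof. by rewrite /cexp expnS expn1; nia. Qed.

Lemma exp_two_runs k : (3 * k <= 2 * k * 2)%N.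
Proof. by lia. Qed.

Lemma exp_one_run l j : (2 <= l)%N -> (2 * l - 1 <= 3 * (j - 1))%N ->
  (3 * (2 * (2 * l - 1) * (l - 1)) <= 6 * (l - 1) * (j - 1) + 2 * (2 * (2 * l - 1) * (l - 1)))%N.
Proof.
move=> l2 h; case: l l2 h => [|[|l]] // _ h; rewrite !subn1 /= in h *.
nia.
Qed.

Lemma exp_full l : (2 <= l)%N -> (3 * (2 * (2 * l - 1) * (l - 1)) <= 6 * (l - 1) * (2 * l - 1))%N.
Proof. by move=> l2; rewrite leq_eqVlt; apply/orP; left; apply/eqP; nia. Qed.

Lemma spectral_le l j : (3 * (j - 1) < 2 * l - 1)%N -> (j <= 2 * l)%N.
Proof. by lia. Qed.

Lemma exp_spectral l j : (2 <= j)%N -> (3 * (j - 1) < 2 * l - 1)%N ->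
  (((2 * l - 1) * j).+1 <= 6 * (l - 1) * (j - 1))%N.
Proof.
move=> j2 h; have [i ij] : exists i, j = (i + 2)%N by exists (j - 2)%N; lia.
have [m lm] : exists m, l = (m + 3)%N by exists (l - 3)%N; lia.
have -> : (2 * l - 1 = 2 * m + 5)%N by lia.
have -> : (l - 1 = m + 2)%N by lia.
have -> : (j - 1 = i + 1)%N by lia.
by rewrite ij; lia.
Qed.

Section WalkNumerics.
Variables (R : realFieldType) (l : nat).
Variables (L g z Theta e tau nn : R).
Hypothesis l2 : (2 <= l)%N.
Let E3 := (2 * (2 * l - 1) * (l - 1))%N.
Hypothesis g0 : 0 < g.
Hypothesis z1 : 1 <= z.
Hypothesis nz : nn = z ^+ (3 * E3).
Hypothesis L0 : 0 <= L.
Hypothesis LT : L <= Theta.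
Hypothesis T4 : 4 <= Theta.
Hypothesis e0 : 0 < e.
Hypothesis eg : e <= nn * g.
Hypothesis gtau : g ^+ (2 * l) <= Theta ^+ (2 * l) * tau.

Let z0 : 0 < z := lt_le_trans ltr01 z1.
Let T0 : 0 < Theta. Proof. by apply: lt_le_trans T4. Qed.
Let T1 : 1 <= Theta. Proof. by apply: le_trans T4; rewrite ler1n. Qed.
Let n0 : 0 < nn. Proof. by rewrite nz exprn_gt0. Qed.
Let tau0 : 0 < tau.
Proof.
rewrite -(pmulr_rgt0 _ (exprn_gt0 (2 * l) T0)); apply: lt_le_trans gtau.
by rewrite exprn_gt0.
Qed.
(* Powers of z keep all exponents integral: n = z^(3 E3) makes n^(1/3) = z^E3
   and n^(1/(2l-1)) = z^(6(l-1)). *)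
Definition growth : R := nn * z ^+ (6 * (l - 1)).

Let nM : nn <= growth.
Proof. by rewrite /growth ler_peMr ?exprn_ege1 // ltW. Qed.

Let TX k m : (k <= m)%N -> Theta ^+ k <= Theta ^+ m.
Proof. by move=> km; rewrite ler_weXn2l. Qed.

Let nMX j : nn ^+ j <= growth ^+ j.
Proof. by rewrite lerXn2r // nnegrE ltW // (lt_le_trans n0 nM). Qed.

Lemma walk_generic j (c x : R) : (j <= 2 * l)%N -> 0 <= c -> c <= Theta ^+ 2 ->
  (0 < j)%N -> 0 <= x -> nn * x * nn ^+ (j - 1) <= growth ^+ (j - 1) ->
  c * x * (L * g) ^+ (2 * l - j) * e ^+ j <= Theta ^+ cexp l * tau * growth ^+ (j - 1).
Proof.
move=> jl c0 cT j0 x0 hx.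
have ej : e ^+ j <= nn ^+ j * g ^+ j.
  by rewrite -exprMn lerXn2r // nnegrE ltW // mulr_gt0.
have Lj : L ^+ (2 * l - j) <= Theta ^+ (2 * l).
  apply: (@le_trans _ _ (Theta ^+ (2 * l - j))); last by apply: TX; exact: leq_subr.
  by rewrite lerXn2r // nnegrE // ltW.
have gj : 0 <= g ^+ (2 * l - j) by rewrite exprn_ge0 // ltW.
rewrite exprMn.
apply: (@le_trans _ _ (c * x * (Theta ^+ (2 * l) * g ^+ (2 * l - j)) * (nn ^+ j * g ^+ j))).
  apply: ler_pM; rewrite ?mulr_ge0 ?exprn_ge0 ?(ltW e0) ?(ltW g0) //.
  by rewrite ler_wpM2l ?mulr_ge0 // ler_wpM2r.
have -> : c * x * (Theta ^+ (2 * l) * g ^+ (2 * l - j)) * (nn ^+ j * g ^+ j)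
   = c * Theta ^+ (2 * l) * (g ^+ (2 * l - j) * g ^+ j) * (x * nn ^+ j) by ring.
rewrite -exprD subnK //.
have -> : x * nn ^+ j = nn * x * nn ^+ (j - 1).
  by rewrite -{1}(subnK j0) exprD expr1; ring.
have xn0 : 0 <= nn * x * nn ^+ (j - 1) by rewrite !mulr_ge0 ?exprn_ge0 ?(ltW n0).
apply: (@le_trans _ _ (Theta ^+ 2 * Theta ^+ (2 * l) * (Theta ^+ (2 * l) * tau) * growth ^+ (j - 1))).
  apply: ler_pM => //.
    by rewrite !mulr_ge0 ?exprn_ge0 ?(ltW g0) ?(ltW T0).
  apply: ler_pM => //; rewrite ?mulr_ge0 ?exprn_ge0 ?(ltW g0) ?(ltW T0) //.
  by rewrite ler_wpM2r ?exprn_ge0 // ltW.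
rewrite ler_wpM2r ?exprn_ge0 ?(le_trans (ltW n0) nM) // mulrA -!exprD.
by rewrite ler_wpM2r ?(ltW tau0) //; apply: TX; exact: cexp_generic.
Qed.

Lemma walk_two_runs j : (2 <= j <= 2 * l)%N ->
  2 * (2 * z ^- (2 * E3)) ^+ 2 * (L * g) ^+ (2 * l - j) * e ^+ j
    <= Theta ^+ cexp l * tau * growth ^+ (j - 1).
Proof.
move=> /andP[j2 jl].
have -> : 2 * (2 * z ^- (2 * E3)) ^+ 2 = 8 * (z ^- (2 * E3)) ^+ 2 by ring.
apply: (@walk_generic j 8) => //; rewrite ?exprn_ge0 ?invr_ge0 ?exprn_ge0 ?(ltW z0) //.
- by apply: le_trans (_ : 4 ^+ 2 <= _); rewrite ?lerXn2r ?nnegrE ?(ltW T0) // -natrX ler_nat.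
- by case: j j2 jl => [|j].
- apply: le_trans (nMX _); rewrite ler_piMl ?exprn_ge0 ?(ltW n0) //.
  rewrite nz exprVn -exprM ler_pdivrMr ?exprn_gt0 // mul1r.
  by apply: ler_weXn2l => //; exact: exp_two_runs.
Qed.

Let growthX j : growth ^+ j = nn ^+ j * z ^+ (6 * (l - 1) * j).
Proof. by rewrite /growth exprMn -exprM. Qed.

Lemma walk_one_run j : (2 * l - 1 <= 3 * (j - 1))%N -> (j <= 2 * l)%N ->
  2 * z ^- (2 * E3) * (L * g) ^+ (2 * l - j) * e ^+ j
    <= Theta ^+ cexp l * tau * growth ^+ (j - 1).
Proof.
move=> j2 jl; apply: walk_generic => //; rewrite ?invr_ge0 ?exprn_ge0 ?(ltW z0) //.
- apply: le_trans (_ : 4 ^+ 2 <= _); last by rewrite lerXn2r ?nnegrE ?(ltW T0).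
  by rewrite -natrX ler_nat.
- by move: j2; case: (j) => //; rewrite muln0 leqn0 subn_eq0; case: (l) l2 => [|[|]].
- rewrite growthX mulrC ler_wpM2l ?exprn_ge0 ?(ltW n0) //.
  rewrite nz ler_pdivrMr ?exprn_gt0 // -exprD; apply: ler_weXn2l => //.
  exact: exp_one_run.
Qed.

Lemma walk_full : 2 * e ^+ (2 * l) <= Theta ^+ cexp l * tau * growth ^+ (2 * l - 1).
Proof.
have := @walk_generic (2 * l) 2 1; rewrite subnn expr0 !mulr1; apply => //.
- apply: le_trans (_ : 4 ^+ 2 <= _); last by rewrite lerXn2r ?nnegrE ?(ltW T0).
  by rewrite -natrX ler_nat.
- by rewrite muln_gt0; case: (l) l2.
- rewrite growthX mulrC ler_wpM2l ?exprn_ge0 ?(ltW n0) //.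
  by rewrite nz; apply: ler_weXn2l => //; exact: exp_full.
Qed.

Definition Ydef : R := Theta ^+ (2 * l + 1) * z ^+ (2 * l - 1).

Lemma walk_spectral j : (2 <= j)%N -> (3 * (j - 1) < 2 * l - 1)%N ->
  2 * (z * Theta ^+ 3 * nn * (g / e) ^+ 2 * tau * (Ydef / g) ^+ j) * e ^+ j
    <= Theta ^+ cexp l * tau * growth ^+ (j - 1).
Proof.
move=> j2 jl.
have [i ij] : exists i, j = (i + 2)%N by exists (j - 2)%N; rewrite subnK.
have -> : 2 * (z * Theta ^+ 3 * nn * (g / e) ^+ 2 * tau * (Ydef / g) ^+ j) * e ^+ j
   = 2 * Theta ^+ 3 * tau * (nn * (e / g) ^+ i) * (z * Ydef ^+ j).
  rewrite ij !exprD; have : e / g != 0 by rewrite mulf_neq0 ?invr_eq0 ?gt_eqF.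
  by rewrite !expr_div_n => _; field; rewrite !gt_eqF ?exprn_gt0.
have egi : (e / g) ^+ i <= nn ^+ i.
  by rewrite lerXn2r ?nnegrE ?divr_ge0 ?(ltW e0) ?(ltW g0) ?(ltW n0) // ler_pdivrMr.
rewrite growthX.
have hz : z * Ydef ^+ j <= Theta ^+ ((2 * l + 1) * (2 * l)) * z ^+ (6 * (l - 1) * (j - 1)).
  rewrite /Ydef exprMn -!exprM mulrCA -exprS.
  apply: ler_pM; rewrite ?exprn_ge0 ?(ltW z0) ?(ltW T0) //.
    by apply: TX; rewrite leq_mul2l; apply/orP; right; apply: spectral_le.
  by apply: ler_weXn2l => //; exact: exp_spectral.
have hn : nn * (e / g) ^+ i <= nn ^+ (j - 1).
  have -> : (j - 1 = i.+1)%N by rewrite ij addn2 subn1.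
  by rewrite exprS ler_wpM2l // ltW.
have eg0 : 0 <= e / g by rewrite divr_ge0 ?ltW.
have Y0 : 0 <= Ydef by rewrite mulr_ge0 ?exprn_ge0 ?ltW.
apply: (@le_trans _ _ (Theta * Theta ^+ 3 * tau * nn ^+ (j - 1)
   * (Theta ^+ ((2 * l + 1) * (2 * l)) * z ^+ (6 * (l - 1) * (j - 1))))).
  apply: ler_pM => //; first by rewrite !mulr_ge0 ?exprn_ge0 ?(ltW T0) ?(ltW n0) ?(ltW tau0).
    by rewrite mulr_ge0 ?exprn_ge0 // ltW.
  apply: ler_pM => //; first by rewrite !mulr_ge0 ?exprn_ge0 ?(ltW T0) ?(ltW tau0).
    by rewrite mulr_ge0 ?exprn_ge0 // ltW.
  rewrite ler_wpM2r ?(ltW tau0) // ler_wpM2r ?exprn_ge0 ?(ltW T0) //.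
  by apply: le_trans T4; rewrite ler_nat.
have -> : Theta * Theta ^+ 3 * tau * nn ^+ (j - 1)
   * (Theta ^+ ((2 * l + 1) * (2 * l)) * z ^+ (6 * (l - 1) * (j - 1)))
   = Theta ^+ (4 + (2 * l + 1) * (2 * l)) * tau * (nn ^+ (j - 1) * z ^+ (6 * (l - 1) * (j - 1))).
  by rewrite (exprD Theta 4); ring.
rewrite ler_wpM2r ?mulr_ge0 ?exprn_ge0 ?(ltW n0) ?(ltW z0) // ler_wpM2r ?(ltW tau0) //.
by apply: TX; exact: cexp_spectral.
Qed.

End WalkNumerics.

Lemma saturated_family (R : realFieldType) (I X : finType) (es : I -> {set X}) (Om : {set I}) (D : R) :
  0 <= D -> exists S : {set I}, [/\ S \subset Om,
    forall x, #|[set t in S | x \in es t]|%:R <= D &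
    forall t, t \in Om -> (forall x, x \in es t -> #|[set t in S | x \in es t]|%:R + 1 <= D) -> t \in S].
Proof.
move=> D0; pose deg (S : {set I}) x := #|[set t in S | x \in es t]|.
pose P := [pred S : {set I} | (S \subset Om) && [forall x, (deg S x)%:R <= D]].
have P0 : P set0.
  rewrite inE sub0set /=; apply/forallP => x; rewrite /deg.
  suff -> : [set t in set0 | x \in es t] = set0 by rewrite cards0.
  by apply/setP => t; rewrite !inE.
case: (@arg_maxnP _ set0 P (fun S => #|S|) P0) => S; rewrite inE => /andP[SO /forallP dS] Smax.
exists S; split=> // t tO ht; apply/negPn/negP => tS.
have PS : P (t |: S).
  rewrite inE subUset sub1set tO SO /=; apply/forallP => x; rewrite /deg.
  have [xt|xt] := boolP (x \in es t).
    apply: le_trans (ht x xt); rewrite natr1 ler_nat.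
    have -> : [set t0 in t |: S | x \in es t0] = t |: [set t0 in S | x \in es t0].
      by apply/setP => t'; rewrite !inE; have [->|] := eqVneq t' t; rewrite ?xt.
    by rewrite cardsU1; case: (_ \notin _); rewrite ?add1n // add0n.
  apply: le_trans (dS x); rewrite ler_nat; apply/subset_leq_card/subsetP => t'.
  rewrite !inE; have [->|] := eqVneq t' t; last by [].
  by rewrite (negPf xt) andbF.
by have /= := Smax _ PS; rewrite cardsU1 tS add1n ltnn.
Qed.

Lemma sum_degree (I X : finType) (es : I -> {set X}) (S : {set I}) :
  (\sum_x #|[set t in S | x \in es t]| = \sum_(t in S) #|es t|)%N.
Proof.
have -> : (\sum_(t in S) #|es t| = \sum_(t in S) \sum_x (x \in es t))%N.
  by apply: eq_bigr => t _; rewrite -sum1_card big_mkcond.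
rewrite exchange_big /=; apply: eq_bigr => x _.
rewrite -sum1_card big_mkcond [RHS]big_mkcond; apply: eq_bigr => t _.
by rewrite !inE; case: (t \in S); case: (x \in es t).
Qed.

Lemma exp_decay l : (2 <= l)%N -> (2 * (l - 1) + 2 + 2 <= (2 * l + 1) * (2 * (l - 1)))%N.
Proof.
move=> l2; have [m ->] : exists m, l = (m + 2)%N by exists (l - 2)%N; lia.
have -> : (m + 2 - 1 = m + 1)%N by lia.
nia.
Qed.

Lemma exp_beta l : (2 <= l)%N -> (1 <= 2 * (2 * (2 * l - 1) * (l - 1)))%N.
Proof. by move=> l2; rewrite !muln_gt0; lia. Qed.

Lemma exp_coincide l : (2 <= l)%N -> ((2 * l - 1) * l + 1 <= 2 * (2 * (2 * l - 1) * (l - 1)))%N.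
Proof.
move=> l2; have [m ->] : exists m, l = (m + 2)%N by exists (l - 2)%N; lia.
have -> : (m + 2 - 1 = m + 1)%N by lia.
have -> : (2 * (m + 2) - 1 = 2 * m + 3)%N by lia.
nia.
Qed.

Lemma spectral_range l j : (2 <= j)%N -> (3 * (j - 1) < 2 * l - 1)%N ->
  (2 <= 2 * l - j <= 2 * l - 2)%N.
Proof. by lia. Qed.

Lemma half_split m : m = (m./2 + (m - m./2))%N.
Proof. by lia. Qed.

Lemma half_bounds l s : (2 <= l)%N -> (0 < s)%N -> (s <= l)%N ->
  (0 < (2 * l - s)./2 <= l)%N /\ (0 < 2 * l - s - (2 * l - s)./2 <= l)%N.
Proof. by move=> l2 s0 sl; split; lia. Qed.

Lemma half_exponent l s h : (s <= 2 * l)%N -> (0 < h <= l)%N -> (0 < 2 * l - s - h <= l)%N ->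
  (2 * (l - h) + 2 * (l - (2 * l - s - h)) = s * 2)%N.
Proof. by lia. Qed.

Ltac nlia := repeat match goal with
  | H : is_true (@Order.le _ _ _ _) |- _ => clear H
  | H : is_true (@Order.lt _ _ _ _) |- _ => clear H
  | H : forall _, _ |- _ => clear H
  | H : _ = _ ^+ _ |- _ => clear H
  end; lia.

Section Supersaturation.
Variables (R : realFieldType) (n : nat) (a b : {set 'I_n} -> 'I_n) (r l p : nat).
Notation X := {set 'I_n}.
Notation adj := (adj R a b).
Notation alpha := (alpha R a b).
Notation clw := (clw R a b).
Implicit Types (E F : {set X}).
Variables (E1 : {set X}) (L g z kappa Theta Delta : R).
Hypothesis l2 : (2 <= l)%N.
Let E3 := (2 * (2 * l - 1) * (l - 1))%N.
Hypothesis hE1 : forall x, x \in E1 -> [/\ #|x| = r, a x \in x, b x \in x & a x != b x].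
Hypothesis E10 : E1 != set0.
Hypothesis g0 : 0 < g.
Hypothesis z1 : 1 <= z.
Hypothesis nz : n%:R = z ^+ (3 * E3).
Hypothesis L1 : 1 <= L.
Hypothesis walkW : forall k u v, mxpow (adj E1) k.+1 u v <= z ^- (2 * E3) * (L * g) ^+ k.+1.
Hypothesis walkLB : forall F : {set X}, F \subset E1 ->
  (#|F|%:R * g) ^+ (2 * l) <= #|E1|%:R ^+ (2 * l) * clw F l.
Hypothesis walk1 : clw E1 1 <= 2 * L * z ^+ E3 * g ^+ 2.
Hypothesis degE1 : forall u, #|[set x in E1 | (a x == u) || (b x == u)]|%:R <= Delta.
Hypothesis DeltaE : Delta * #|E1|%:R <= L * n%:R * g ^+ 2.
Hypothesis E1n : #|E1|%:R <= n%:R * g.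
Hypothesis p0 : (0 < p)%N.
Hypothesis pz : 2 ^+ p <= z.
Hypothesis kappa1 : 1 <= kappa.
Hypothesis kappap : \prod_(h < l.-1) alpha E1 h.+1 <= kappa ^+ p.
Hypothesis LT : L <= Theta.
Hypothesis kT : 4 * kappa <= Theta.
Hypothesis lrT : (128 * l ^ 2 * r)%:R <= Theta.
Hypothesis r4 : (4 <= r)%N.
Hypothesis zT : Theta ^+ ((2 * l + 2) * l + 5) <= z.
Hypothesis E1big : kappa * (128 * l ^ 2 * r)%:R * n%:R ^+ (r - 1) <= #|E1|%:R.

Let z0 : 0 < z := lt_le_trans ltr01 z1.
Let T4 : 4 <= Theta.
Proof. by apply: le_trans kT; rewrite ler_pMr. Qed.
Let T0 : 0 < Theta. Proof. by apply: lt_le_trans T4. Qed.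
Let T1 : 1 <= Theta. Proof. by apply: le_trans T4; rewrite ler1n. Qed.
Let L0 : 0 < L := lt_le_trans ltr01 L1.
Let k0 : 0 < kappa := lt_le_trans ltr01 kappa1.
Let n0 : 0 < (n%:R : R). Proof. by rewrite nz exprn_gt0. Qed.
Let e0 : 0 < (#|E1|%:R : R). Proof. by rewrite ltr0n card_gt0. Qed.
Let Y := Ydef l z Theta.
Let Y0 : 0 < Y. Proof. by rewrite /Y /Ydef mulr_gt0 ?exprn_gt0. Qed.

Lemma clw_lower F : F \subset E1 -> #|E1|%:R <= Theta * #|F|%:R ->
  g ^+ (2 * l) <= Theta ^+ (2 * l) * clw F l.
Proof.
move=> FE hF; have F0 : 0 < (#|F|%:R : R).
  by rewrite -(pmulr_rgt0 _ T0); apply: lt_le_trans hF.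
rewrite -(ler_pM2l (exprn_gt0 (2 * l) F0)) -exprMn; apply: le_trans (walkLB FE) _.
have c0 : 0 <= clw F l.
  by apply: sumr_ge0 => x _; exact: adjpow_ge0.
by rewrite mulrA ler_wpM2r // -exprMn [_ * Theta]mulrC lerXn2r ?nnegrE ?mulr_ge0 ?(ltW T0) ?(ltW e0).
Qed.

Lemma clw_decay F h : F \subset E1 -> #|E1|%:R <= Theta * #|F|%:R -> (0 < h <= l)%N ->
  clw F h <= (Y / g) ^+ (2 * (l - h)) * clw F l.
Proof.
move=> FE hF hl; have F0 : F != set0.
  by apply/eqP => F0; move: hF; rewrite F0 cards0 mulr0 leNgt e0.
have x0 : 0 < (Y / g) ^+ 2 by rewrite exprn_gt0 // divr_gt0.
rewrite exprM; apply: clw_interp => //; first by nlia.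
apply: le_trans (clw_mono R a b 1 FE) _; apply: le_trans walk1 _.
have lower := clw_lower FE hF.
rewrite -exprM -(ler_pM2l (exprn_gt0 (2 * l) T0)) [leRHS]mulrCA.
apply: (@le_trans _ _ ((Y / g) ^+ (2 * (l - 1)) * g ^+ (2 * l))); last first.
  by rewrite ler_wpM2l // exprn_ge0 // divr_ge0 ?ltW.
have -> : (2 * l = 2 * (l - 1) + 2)%N by nlia.
rewrite [g ^+ (2 * (l - 1) + 2)]exprD mulrA -exprMn divfK ?gt_eqF // mulrA ler_wpM2r ?sqr_ge0 //.
rewrite /Y /Ydef exprMn -!exprM mulrA.
have -> : ((2 * l - 1) * (2 * (l - 1)) = E3)%N by rewrite /E3; nlia.
rewrite ler_wpM2r ?exprn_ge0 ?(ltW z0) //.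
apply: (@le_trans _ _ (Theta ^+ (2 * (l - 1) + 2) * Theta ^+ 2)).
  rewrite ler_wpM2l ?exprn_ge0 ?(ltW T0) // expr2 ler_pM ?(ltW L0) //.
  by apply: le_trans T4; rewrite ler_nat.
by rewrite -exprD; apply: ler_weXn2l => //; exact: exp_decay.
Qed.

Definition robust E :=
  [/\ E \subset E1, E != set0, #|E1|%:R <= kappa * #|E|%:R &
    forall F : {set X}, F \subset E -> (#|E| <= 2 * #|F|)%N ->
      forall h, (h < l.-1)%N -> alpha E h.+1 <= 2 ^+ p * alpha F h.+1].

Lemma robust_exists : exists E, robust E.
Proof. exact: (extremal_subgraph p0 k0 E10 kappap). Qed.

Definition dense (E F : {set X}) := (F \subset E) && (3 * #|E| <= 4 * #|F|)%N.

Section Robust.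
Variable E : {set X}.
Hypothesis rE : robust E.

Let EE1 : E \subset E1. Proof. by case: rE. Qed.
Let E0 : E != set0. Proof. by case: rE. Qed.
Let Ee : #|E1|%:R <= kappa * #|E|%:R. Proof. by case: rE. Qed.
Let cE0 : 0 < (#|E|%:R : R). Proof. by rewrite ltr0n card_gt0. Qed.

Lemma denseT F : dense E F -> F \subset E1 /\ #|E1|%:R <= Theta * #|F|%:R.
Proof.
move=> /andP[FE hF]; split; first exact: subset_trans EE1.
apply: le_trans Ee _.
have le : (3 * #|E|%:R : R) <= 4 * #|F|%:R by rewrite -!natrM ler_nat.
apply: (@le_trans _ _ (kappa * (4 * #|F|%:R))).
  by rewrite ler_wpM2l ?(ltW k0) //; apply: le_trans le; rewrite ler_peMl ?ler1n.
by rewrite mulrA [kappa * 4]mulrC ler_wpM2r.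
Qed.

Variable F0 : {set X}.
Hypothesis dF0 : dense E F0.
Let tau := clw F0 l.
Hypothesis tau_min : forall F, dense E F -> tau <= clw F l.

Let gtau : g ^+ (2 * l) <= Theta ^+ (2 * l) * tau.
Proof. by case: (denseT dF0) => h1 h2; exact: clw_lower. Qed.
Let tau0 : 0 < tau.
Proof.
rewrite -(pmulr_rgt0 _ (exprn_gt0 (2 * l) T0)); apply: lt_le_trans gtau.
by rewrite exprn_gt0.
Qed.

Let Q : R := z * Theta ^+ 3 * n%:R * (g / #|E1|%:R) ^+ 2.

Lemma alpha_bound h : (0 < h < l)%N -> alpha E h <= Q * tau * (Y / g) ^+ (2 * (l - h)).
Proof.
case: h => // h /andP[_ hl]; have [F0E1 F0T] := denseT dF0; case/andP: dF0 => F0E F034.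
have [_ _ _ reg] := rE.
have degE u : #|[set x in E | (a x == u) || (b x == u)]|%:R <= Delta.
  apply: le_trans (degE1 u); rewrite ler_nat subset_leq_card //; apply/subsetP => x.
  by rewrite !inE => /andP[/(subsetP EE1) -> ->].
have regh F' : F' \subset E -> (#|E| <= 2 * #|F'|)%N -> alpha E h.+1 <= z * alpha F' h.+1.
  move=> h1 h2; apply: le_trans (reg F' h1 h2 h _) _; first by rewrite -ltnS prednK // ltnW.
  by rewrite ler_wpM2r // /alpha; apply/bigmax_geP; left.
have Delta0 : 0 <= Delta by case/set0Pn: E0 => x _; apply: le_trans (degE (a x)).
have := alpha_le_clw z0 E0 F0E F034 degE regh.
have := @clw_decay F0 h.+1 F0E1 F0T _; rewrite -/tau => /(_ _)/wrap[]; first by nlia.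
move=> dec hA; rewrite -(ler_pM2r cE0); apply: le_trans hA _.
apply: (@le_trans _ _ (4 * z * Delta * ((Y / g) ^+ (2 * (l - h.+1)) * tau))).
  by rewrite ler_wpM2l // !mulr_ge0 // ltW.
have -> : Q * tau * (Y / g) ^+ (2 * (l - h.+1)) * #|E|%:R
  = (Q * #|E|%:R) * ((Y / g) ^+ (2 * (l - h.+1)) * tau) by ring.
rewrite ler_wpM2r ?mulr_ge0 ?exprn_ge0 ?divr_ge0 ?(ltW tau0) ?(ltW Y0) ?(ltW g0) //.
have -> : 4 * z * Delta = z * (4 * Delta) by ring.
have -> : Q * #|E|%:R = z * (Theta ^+ 3 * (n%:R * (g ^+ 2 / #|E1|%:R ^+ 2 * #|E|%:R))).
  by rewrite /Q expr_div_n; ring.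
rewrite ler_wpM2l ?(ltW z0) //.
rewrite -(ler_pM2r (exprn_gt0 2 e0)) -(ler_pM2l k0).
apply: (@le_trans _ _ (4 * kappa * (L * n%:R * g ^+ 2) * #|E1|%:R)).
  have -> : kappa * (4 * Delta * #|E1|%:R ^+ 2) = 4 * kappa * (Delta * #|E1|%:R) * #|E1|%:R by ring.
  by rewrite ler_wpM2r ?(ltW e0) // ler_wpM2l // mulr_ge0 // ltW.
have -> : kappa * (Theta ^+ 3 * (n%:R * (g ^+ 2 / #|E1|%:R ^+ 2 * #|E|%:R)) * #|E1|%:R ^+ 2)
  = Theta ^+ 3 * n%:R * g ^+ 2 * (kappa * #|E|%:R).
  by field; rewrite gt_eqF.
apply: ler_pM => //; rewrite ?mulr_ge0 ?exprn_ge0 ?(ltW L0) ?(ltW k0) ?(ltW n0) ?(ltW e0) ?(ltW g0) //.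
have -> : 4 * kappa * (L * n%:R * g ^+ 2) = (4 * kappa * L) * (n%:R * g ^+ 2) by ring.
have -> : Theta ^+ 3 * n%:R * g ^+ 2 = Theta ^+ 3 * (n%:R * g ^+ 2) by ring.
rewrite ler_wpM2r ?mulr_ge0 ?exprn_ge0 ?(ltW g0) ?(ltW n0) //.
apply: (@le_trans _ _ (Theta ^+ 2)); last by apply: ler_weXn2l.
by rewrite expr2 ler_pM ?mulr_ge0 ?(ltW k0) ?(ltW L0).
Qed.

Lemma pow_bound s u v : (2 <= s <= 2 * l - 2)%N ->
  mxpow (adj E) s u v <= Q * tau * (Y / g) ^+ (2 * l - s).
Proof.
move=> hs; pose h := s./2; pose h' := (s - h)%N.
have sE : s = (h + h')%N by rewrite /h'; nlia.
have Q0 : 0 <= Q * tau.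
  by rewrite /Q !mulr_ge0 ?exprn_ge0 ?divr_ge0 ?(ltW z0) ?(ltW T0) ?(ltW n0) ?(ltW g0) ?(ltW e0) ?(ltW tau0).
have Yg0 : 0 <= Y / g by rewrite divr_ge0 ?ltW.
rewrite -(@ler_pXn2r _ 2) ?nnegrE ?adjpow_ge0 ?(mulr_ge0 Q0 (exprn_ge0 _ Yg0)) //.
rewrite {1}sE; apply: le_trans (mxpow_CS (adj_sym R a b E) h h' u v) _.
have bd k x : (0 < k < l)%N -> mxpow (adj E) (k + k) x x <= Q * tau * (Y / g) ^+ (2 * (l - k)).
  by move=> hk; apply: le_trans (alpha_ge R a b E k x) (alpha_bound hk).
apply: (@le_trans _ _ ((Q * tau * (Y / g) ^+ (2 * (l - h))) * (Q * tau * (Y / g) ^+ (2 * (l - h'))))).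
  by apply: ler_pM; rewrite ?adjpow_ge0 ?bd // /h' /h; nlia.
rewrite mulrACA -exprD [leRHS]exprMn -exprM -expr2.
by have -> : (2 * (l - h) + 2 * (l - h') = (2 * l - s) * 2)%N by rewrite /h' /h; nlia.
Qed.

Lemma walks_containing (T : {set X}) : T \subset E -> (2 <= #|T| <= 2 * l)%N ->
  #|[set t in cwalks a b E (2 * l) | T \subset [set d.2 | d in t]]|%:R * #|E1|%:R ^+ #|T|
   <= (2 * l + 1)%:R ^+ (2 * l) * (Theta ^+ cexp l * tau * growth l z n%:R ^+ (#|T| - 1)).
Proof.
move=> TE /andP[T2 Tl]; set C := Theta ^+ _ * _ * _.
have C0 : 0 <= C.
  by rewrite /C /growth !mulr_ge0 ?exprn_ge0 ?mulr_ge0 ?exprn_ge0 ?(ltW T0) ?(ltW tau0) ?(ltW n0) ?(ltW z0).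
have ej0 : 0 < (#|E1|%:R : R) ^+ #|T| by rewrite exprn_gt0.
rewrite -ler_pdivlMr // -mulrA.
have l0 : (0 < 2 * l)%N by nlia.
apply: (@le_trans _ _ (#|T|.+1%:R ^+ (2 * l) * (C / #|E1|%:R ^+ #|T|))); last first.
  have TS : (#|T|.+1 <= 2 * l + 1)%N by nlia.
  by rewrite ler_wpM2r ?divr_ge0 ?(ltW ej0) // lerXn2r ?nnegrE // ler_nat.
apply: card_contains => //; last by rewrite divr_ge0 // ltW.
move=> o so oT no'; have {no'} no : (nfree o + #|T| = 2 * l)%N := no'.
rewrite ler_pdivlMr //.
have ll : optloopless a b o.
  apply/allP => -[x|] xo //; have := allP oT _ xo => /= xT.
  by have [_ _ _] := hE1 (subsetP EE1 _ (subsetP TE _ xT)).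
have hS : has isSome o.
  have e : (count isSome o + nfree o = 2 * l)%N := etrans (count_predC isSome o) so.
  rewrite has_count lt0n; apply/eqP => c0; move: no; rewrite -e c0; nlia.
have beta1 : 2 * z ^- (2 * E3) <= 1.
  rewrite ler_pdivrMr ?exprn_gt0 // mul1r; apply: le_trans (_ : z <= _).
    apply: le_trans zT; apply: le_trans (_ : Theta <= _).
      by apply: le_trans T4; rewrite ler_nat.
    by rewrite -[leLHS]expr1; apply: ler_weXn2l => //; nlia.
  by rewrite -[leLHS]expr1; apply: ler_weXn2l => //; exact: exp_beta.
have G0 : 0 < L * g by rewrite mulr_gt0.
have powE k u v : mxpow (adj E) k.+1 u v <= z ^- (2 * E3) * (L * g) ^+ k.+1.
  by apply: le_trans (walkW k u v); exact: adjpow_mono.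
have nf : nfree o = (2 * l - #|T|)%N by rewrite -no addnK.
have b0 : 0 <= z ^- (2 * E3) by rewrite invr_ge0 exprn_ge0 // ltW.
case: (tr_optword b0 beta1 G0 powE ll hS) => [le|le].
  apply: le_trans (_ : 2 * (2 * z ^- (2 * E3)) ^+ 2 * (L * g) ^+ nfree o * #|E1|%:R ^+ #|T| <= _).
    by rewrite ler_wpM2r ?(ltW ej0).
  rewrite nf; apply: walk_two_runs => //; rewrite ?(ltW L0) ?T2 //.
case: (ltngtP #|T| (2 * l)%N) => [lt|gt|eqT]; last 2 first.
- by move: gt; rewrite ltnNge Tl.
- apply: le_trans (_ : 2 * 1 * #|E1|%:R ^+ #|T| <= _).
    rewrite ler_wpM2r ?(ltW ej0) //; apply: le => u v.
    by rewrite nf eqT subnn mxpow0 mxE lern1 leq_b1.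
  rewrite mulr1 /C eqT; exact: (walk_full l2 g0 z1 nz (ltW L0) LT T4 e0 E1n gtau).
- have [j3|j3] := leqP (2 * l - 1) (3 * (#|T| - 1)).
    apply: le_trans (_ : 2 * z ^- (2 * E3) * (L * g) ^+ (2 * l - #|T|) * #|E1|%:R ^+ #|T| <= _).
      rewrite ler_wpM2r ?(ltW ej0) // -mulrA; apply: le => u v; rewrite nf.
      have [k kE] : exists k, (2 * l - #|T| = k.+1)%N by exists (2 * l - #|T|).-1; rewrite prednK // subn_gt0.
      by rewrite kE; exact: powE.
    exact: (walk_one_run l2 g0 z1 nz (ltW L0) LT T4 e0 E1n gtau).
  apply: le_trans (_ : 2 * (Q * tau * (Y / g) ^+ #|T|) * #|E1|%:R ^+ #|T| <= _).
    rewrite ler_wpM2r ?(ltW ej0) //; apply: le => u v; rewrite nf.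
    have := @pow_bound (2 * l - #|T|) u v; rewrite subKn ?(ltnW lt) //; apply.
    exact: spectral_range.
  exact: (walk_spectral g0 z1 nz T4 e0 E1n gtau).
Qed.

Let clean_level : R := (16 * l ^ 2 * r)%:R * n%:R ^+ (r - 3).

Let level0 : 0 < clean_level.
Proof.
rewrite mulr_gt0 ?exprn_gt0 // ltr0n !muln_gt0 ?expn_gt0 (ltnW l2) /=.
exact: leq_trans r4.
Qed.

Lemma adj_pair F x : #|[set y in F | (a y == a x) && (b y == b x)]|%:R <= adj F (a x) (b x).
Proof.
rewrite mxE ler_nat; pose f (y : X) : bool * X := (false, y).
rewrite -(card_imset _ (_ : injective f)); last by move=> ? ? [].
apply/subset_leq_card/subsetP => d /imsetP[y]; rewrite inE => /andP[yF e] ->.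
by rewrite !inE yF /src /tgt.
Qed.

Lemma clean_codegree (B1 : {set X}) : B1 \subset E -> (8 * #|B1| <= #|E|)%N ->
  exists F, [/\ dense E F, F \subset E :\: B1 & forall x, x \in F -> clean_level <= adj F (a x) (b x)].
Proof.
move=> BE hB; set E2 := E :\: B1; pose F := [set x in E2 | clean_level <= adj E2 (a x) (b x)].
have FE2 : F \subset E2 by apply/subsetP => x; rewrite inE => /andP[].
have symE u v : adj E2 u v = adj E2 v u by rewrite -[in LHS](adj_sym R a b E2) mxE.
exists F; split => //; last first.
  move=> x; rewrite inE => /andP[xE2 lev]; apply: (le_trans lev).
  rewrite !mxE ler_nat subset_leq_card //; apply/subsetP => -[c y].
  rewrite !in_set => /andP[yE2 /andP[/eqP su /eqP tv]]; rewrite su tv !eqxx !andbT yE2 /=.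
  by move: su tv lev; rewrite /src /tgt /=; case: (c) => <- <- //; rewrite symE.
rewrite /dense (subset_trans FE2) ?subsetDl //=.
have removed : (#|E2 :\: F|%:R : R) <= n%:R ^+ 2 * clean_level.
  pose G (q : 'I_n * 'I_n) := [set x in E2 :\: F | (a x == q.1) && (b x == q.2)].
  apply: (@le_trans _ _ (\sum_q #|G q|%:R)).
    rewrite -natr_sum ler_nat; apply: leq_trans (leq_card_bigcup _ _).
    apply/subset_leq_card/subsetP => x xF; apply/bigcupP; exists (a x, b x) => //.
    by rewrite inE xF !eqxx.
  have -> : n%:R ^+ 2 * clean_level = \sum_(q : 'I_n * 'I_n) clean_level.
    by rewrite sumr_const card_prod card_ord -[RHS]mulr_natl natrM expr2.
  apply: ler_sum => -[u v] _; have [->|] := eqVneq (G (u, v)) set0; first by rewrite cards0 ltW.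
  case/set0Pn => x; rewrite inE => /andP[/setDP[xE2 xF] /andP[/eqP au /eqP bv]].
  apply: ltW; apply: le_lt_trans (_ : _ <= adj E2 (a x) (b x)) _; last first.
    by move: xF; rewrite inE xE2 /= -ltNge.
  apply: le_trans (adj_pair E2 x); rewrite ler_nat subset_leq_card //.
  apply/subsetP => y; rewrite inE => /andP[/setDP[yE2 _] e].
  by rewrite inE yE2 au bv.
have level_small : 8 * (n%:R ^+ 2 * clean_level) <= (#|E|%:R : R).
  rewrite -(ler_pM2l k0); apply: le_trans Ee; apply: le_trans E1big.
  have -> : kappa * (8 * (n%:R ^+ 2 * clean_level))
     = (kappa * (128 * l ^ 2 * r)%:R) * (n%:R ^+ 2 * n%:R ^+ (r - 3)).
    by rewrite /clean_level -[(128 * _ * _)%N]mulnA -[(16 * _ * _)%N]mulnA (natrM _ 128) (natrM _ 16); ring.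
  by rewrite -exprD; have -> : (2 + (r - 3) = r - 1)%N by nlia.
have E2c : #|E2| = (#|E| - #|B1|)%N by rewrite cardsD (setIidPr BE).
have Fc : (#|E2 :\: F| + #|F| = #|E2|)%N by rewrite -(cardsID F E2) (setIidPr FE2) addnC.
have r8 : (8 * #|E2 :\: F| <= #|E|)%N.
  rewrite -(ler_nat R) natrM; apply: le_trans level_small; by rewrite ler_wpM2l.
move: E2c Fc r8 hB; clear; move: #|E| #|B1| #|E2| #|E2 :\: F| #|F| => x1 x2 x3 x4 x5; lia.
Qed.

Lemma coincide_bound F s : dense E F -> (0 < s < 2 * l)%N ->
  (16 * l ^ 2)%:R * \sum_x mxpow (adj F) s x x * mxpow (adj F) (2 * l - s) x x <= clw F l.
Proof.
move=> dF; wlog sl : s / (s <= l)%N => [hw|].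
  have [sl|sl] := leqP s l; first exact: hw.
  move=> hs; have := hw (2 * l - s)%N; rewrite subKn; last by case/andP: hs => _ /ltnW.
  under eq_bigr do rewrite mulrC; apply; clear -hs sl; lia.
move=> /andP[s0 s2l]; have [FE1 FT] := denseT dF.
have c0 : 0 <= clw F l by apply: sumr_ge0 => x _; exact: adjpow_ge0.
have Yg0 : 0 <= Y / g by rewrite divr_ge0 ?ltW.
set s1 := (2 * l - s)%N; pose h := s1./2; pose h' := (s1 - h)%N.
have s1E : s1 = (h + h')%N by exact: half_split.
have [hl hl'] : (0 < h <= l)%N /\ (0 < h' <= l)%N by exact: half_bounds.
have trb : \tr (mxpow (adj F) s1) <= (Y / g) ^+ s * clw F l.
  have tr0 : 0 <= \tr (mxpow (adj F) s1) by apply: sumr_ge0 => x _; exact: adjpow_ge0.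
  rewrite -(@ler_pXn2r _ 2) ?nnegrE ?(mulr_ge0 (exprn_ge0 _ Yg0)) //.
  rewrite {1}s1E; apply: le_trans (mxtrace_CS (adj_sym R a b F) h h') _.
  apply: (@le_trans _ _ (((Y / g) ^+ (2 * (l - h)) * clw F l) * ((Y / g) ^+ (2 * (l - h')) * clw F l))).
    apply: ler_pM; [exact: (mxtrace_pow_ge0 (adj_sym R a b F))|exact: (mxtrace_pow_ge0 (adj_sym R a b F))| |];
      exact: clw_decay.
  rewrite mulrACA -exprD -expr2 [leRHS]exprMn -exprM.
  suff -> : (2 * (l - h) + 2 * (l - h') = s * 2)%N by [].
  by apply: half_exponent => //; exact: ltnW.
have [k kE] : exists k, s = k.+1 by exists s.-1; rewrite prednK.
have diag x : mxpow (adj F) s x x <= z ^- (2 * E3) * (L * g) ^+ s.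
  by rewrite kE; apply: le_trans (walkW k x x); exact: adjpow_mono.
apply: (@le_trans _ _ ((16 * l ^ 2)%:R * (z ^- (2 * E3) * (L * g) ^+ s * ((Y / g) ^+ s * clw F l)))).
  rewrite ler_wpM2l //; apply: le_trans (_ : _ <= \sum_x z ^- (2 * E3) * (L * g) ^+ s * mxpow (adj F) s1 x x) _.
    by apply: ler_sum => x _; rewrite ler_wpM2r ?adjpow_ge0.
  by rewrite -mulr_sumr ler_wpM2l // mulr_ge0 ?invr_ge0 ?exprn_ge0 ?(ltW z0) // mulr_ge0 ?(ltW L0) ?(ltW g0).
have -> : (16 * l ^ 2)%:R * (z ^- (2 * E3) * (L * g) ^+ s * ((Y / g) ^+ s * clw F l))
   = ((16 * l ^ 2)%:R * (L * Y) ^+ s) / z ^+ (2 * E3) * clw F l.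
  have -> : (L * Y) ^+ s = (L * g) ^+ s * (Y / g) ^+ s.
    by rewrite -exprMn; congr (_ ^+ _); field; rewrite gt_eqF.
  by ring.
rewrite ler_piMl // ler_pdivrMr ?exprn_gt0 // mul1r.
have LY1 : 1 <= Theta ^+ (2 * l + 2) * z ^+ (2 * l - 1) by rewrite mulr_ege1 ?exprn_ege1.
have LY : (L * Y) ^+ s <= (Theta ^+ (2 * l + 2) * z ^+ (2 * l - 1)) ^+ l.
  apply: (@le_trans _ _ ((Theta ^+ (2 * l + 2) * z ^+ (2 * l - 1)) ^+ s)); last exact: ler_weXn2l.
  rewrite lerXn2r ?nnegrE ?mulr_ge0 ?exprn_ge0 ?(ltW L0) ?(ltW Y0) ?(ltW T0) ?(ltW z0) //.
  rewrite /Y /Ydef mulrA ler_wpM2r ?exprn_ge0 ?(ltW z0) //.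
  by rewrite (addnS (2 * l) 1) exprS ler_wpM2r ?exprn_ge0 ?(ltW T0).
apply: (@le_trans _ _ (Theta * (Theta ^+ (2 * l + 2) * z ^+ (2 * l - 1)) ^+ l)).
  apply: ler_pM => //; first by rewrite exprn_ge0 // mulr_ge0 ?(ltW L0) ?(ltW Y0).
  apply: le_trans lrT; rewrite ler_nat; clear -r4; nia.
rewrite exprMn -!exprM mulrA -exprS.
apply: (@le_trans _ _ (z * z ^+ ((2 * l - 1) * l))).
  rewrite ler_wpM2r ?exprn_ge0 ?(ltW z0) //; apply: le_trans zT; apply: ler_weXn2l => //.
  by rewrite -addn1 leq_add2l.
by rewrite -exprS -addn1; apply: ler_weXn2l => //; exact: exp_coincide.
Qed.

Notation dart := (bool * X)%type.
Definition edges k (t : k.-tuple dart) : {set X} := [set d.2 | d in t].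

Lemma card_edges k (t : k.-tuple dart) : (#|edges t| <= k)%N.
Proof. by apply: leq_trans (leq_imset_card _ _) _; apply: leq_trans (card_size _) _; rewrite size_tuple. Qed.

Lemma edges_sub F k (t : k.-tuple dart) : t \in cwalks a b F k -> edges t \subset F.
Proof.
rewrite inE => /andP[_ /allP tF]; apply/subsetP => x /imsetP[d dt ->]; exact: tF.
Qed.

Lemma cwalks_mono F F' k : F \subset F' -> cwalks a b F k \subset cwalks a b F' k.
Proof.
move=> /subsetP FF; apply/subsetP => t; rewrite !inE => /andP[-> /allP tF] /=.
by apply/allP => d /tF /FF.
Qed.

Lemma card_cwalks_clw F : #|cwalks a b F (2 * l)|%:R = clw F l.
Proof.
rewrite (card_cwalks R); last by rewrite muln_gt0 /= ltnW.
by rewrite mul2n -addnn.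
Qed.

Lemma saturated_walks : exists S : {set (2 * l).-tuple dart},
  [/\ S \subset [set t in cwalks a b E (2 * l) | good a b t],
      forall x, #|[set t in S | x \in edges t]|%:R <= tau / #|E|%:R + 1 &
      tau <= (16 * l)%:R * #|S|%:R].
Proof.
pose Om := [set t in cwalks a b E (2 * l) | good a b t].
have D0 : 0 <= tau / #|E|%:R + 1 by rewrite addr_ge0 // divr_ge0 // ltW.
have [S [SO dS Smax]] := saturated_family (@edges (2 * l)) Om D0.
exists S; split=> //.
pose B1 := [set x in E | tau / #|E|%:R + 1 < #|[set t in S | x \in edges t]|%:R + 1].
have B1E : B1 \subset E by apply/subsetP => x; rewrite inE => /andP[].
have S0 : 0 <= (#|S|%:R : R) by [].
have [big|small] := leqP #|E| (8 * #|B1|)%N.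
  have h1 : #|B1|%:R * (tau / #|E|%:R) <= (2 * l)%:R * (#|S|%:R : R).
    apply: (@le_trans _ _ (\sum_(x in B1) #|[set t in S | x \in edges t]|%:R)).
      rewrite mulr_natl -sumr_const; apply: ler_sum => x; rewrite inE => /andP[_].
      by rewrite ltrD2r => /ltW.
    rewrite -natr_sum -natrM ler_nat; apply: leq_trans (_ : \sum_x #|[set t in S | x \in edges t]| <= _)%N.
      by rewrite [leqRHS](bigID (mem B1)) /= leq_addr.
    rewrite sum_degree [leqRHS]mulnC -sum_nat_const; apply: leq_sum => t _; exact: card_edges.
  have h2 : tau <= 8 * (#|B1|%:R * (tau / #|E|%:R)).
    rewrite mulrA mulrA ler_pdivlMr // mulrC ler_wpM2r ?(ltW tau0) //.
    by rewrite -natrM ler_nat.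
  apply: le_trans h2 _; apply: le_trans (_ : 8 * ((2 * l)%:R * #|S|%:R) <= _).
    by rewrite ler_wpM2l.
  by rewrite mulrA -natrM mulnA.
have [F [dF FB Fcod]] := clean_codegree B1E (ltnW small).
have [FE1 _] := denseT dF; have FE : F \subset E by case/andP: dF.
have hF x : x \in F -> [/\ #|x| = r, a x \in x, b x \in x & a x != b x].
  by move=> xF; apply: hE1; exact: (subsetP FE1).
have l0 : 0 < (l%:R : R) by rewrite ltr0n ltnW.
have l2R : 4 * (2 * l)%:R ^+ 2 = (16 * l ^ 2)%:R :> R.
  by rewrite !natrM; ring.
have cw2 : #|cwalks a b F (2 * l)|%:R <= 2 * (#|[set t in cwalks a b F (2 * l) | good a b t]|%:R : R).
  apply: (@card_good R n a b F (2 * l) r clean_level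
     ((16 * l ^ 2)%:R^-1 * clw F l)) => //.
  - have A0 : (16 * l ^ 2)%:R != 0 :> R.
      by rewrite pnatr_eq0 -lt0n muln_gt0 expn_gt0 (ltnW l2).
    rewrite l2R /clean_level [(_ * r)%:R]natrM.
    have n3 : (n%:R : R) ^+ (r - 3) != 0 by rewrite expf_neq0 // gt_eqF.
    have r0 : (r%:R : R) != 0 by rewrite pnatr_eq0 -lt0n (leq_trans _ r4).
    move: A0 n3 r0; move: (16 * l ^ 2)%:R (n%:R ^+ (r - 3)) r%:R => A N r' A0 n3 r0.
    by apply: le_of_eq; field; rewrite r0 n3 A0.
  - by rewrite mulr_ge0 ?invr_ge0 //; apply: sumr_ge0 => x _; exact: adjpow_ge0.
  - move=> s hs; rewrite mulrC ler_pdivlMr; last by rewrite ltr0n muln_gt0 expn_gt0 (ltnW l2).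
    by rewrite mulrC coincide_bound.
  - rewrite l2R mulrA divff ?mul1r ?card_cwalks_clw //.
    by rewrite pnatr_eq0 -lt0n muln_gt0 expn_gt0 (ltnW l2).
have sub : [set t in cwalks a b F (2 * l) | good a b t] \subset S.
  apply/subsetP => t; rewrite inE => /andP[tF gt]; apply: Smax.
    by rewrite inE gt (subsetP (cwalks_mono _ FE)).
  move=> x xt; have := subsetP FB _ (subsetP (edges_sub tF) _ xt).
  by rewrite inE => /andP[+ xE]; rewrite inE xE /= -leNgt.
apply: (@le_trans _ _ (2 * #|S|%:R)).
  apply: le_trans (tau_min dF) _; rewrite -card_cwalks_clw; apply: le_trans cw2 _.
  by rewrite ler_wpM2l // ler_nat subset_leq_card.
rewrite ler_wpM2r // ler_nat; apply: leq_trans (_ : 16 * 1 <= _)%N => //.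
by rewrite leq_mul2l ltnW.
Qed.

Lemma E1_le_tau : #|E1|%:R <= tau.
Proof.
have Tn0 : 0 < Theta * n%:R by rewrite mulr_gt0.
rewrite -(ler_pM2r (exprn_gt0 (2 * l) Tn0)).
have [m lm] : exists m, l = m.+1 by exists l.-1; rewrite prednK // ltnW.
have n1 : 1 <= (n%:R : R) by rewrite nz exprn_ege1.
apply: (@le_trans _ _ (#|E1|%:R ^+ (2 * l))).
  have -> : (2 * l = (2 * m + 1).+1)%N by rewrite lm mulnS addn1.
  rewrite [leRHS]exprS ler_wpM2l ?(ltW e0) //.
  apply: (@le_trans _ _ ((Theta ^+ 2 * n%:R ^+ 2) ^+ (2 * m + 1))).
    rewrite -exprMn -exprM; apply: ler_weXn2l; first by rewrite mulr_ege1.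
    by rewrite mul2n -addnn -[X in (X <= _)%N]addn1 leq_add2l addn1.
  rewrite lerXn2r ?nnegrE ?mulr_ge0 ?exprn_ge0 ?(ltW T0) ?(ltW n0) ?(ltW e0) //.
  have Tn : Theta ^+ 2 <= n%:R.
    rewrite nz; apply: (@le_trans _ _ z).
      by apply: le_trans zT; apply: ler_weXn2l => //; rewrite addnS ltnS ltn_addl.
    rewrite -[leLHS]expr1; apply: ler_weXn2l => //.
    by rewrite !muln_gt0 /= !subn_gt0 l2 (leq_trans l2) // leq_pmull.
  apply: le_trans E1big; apply: (@le_trans _ _ (n%:R ^+ (r - 1))).
    apply: (@le_trans _ _ (n%:R ^+ 3)); first by rewrite [leRHS]exprS ler_wpM2r ?exprn_ge0.
    by apply: ler_weXn2l => //; rewrite leq_subRL // (leq_trans _ r4).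
  rewrite ler_peMl ?exprn_ge0 ?(ltW n0) // mulr_ege1 // ler1n !muln_gt0 /=.
  by rewrite (ltnW l2) (leq_trans _ r4).
apply: (@le_trans _ _ ((n%:R * g) ^+ (2 * l))).
  by rewrite lerXn2r ?nnegrE ?mulr_ge0 ?(ltW n0) ?(ltW g0) ?(ltW e0).
rewrite !exprMn.
have -> : tau * (Theta ^+ (2 * l) * n%:R ^+ (2 * l)) = (Theta ^+ (2 * l) * tau) * n%:R ^+ (2 * l) by ring.
by rewrite mulrC ler_wpM2r ?exprn_ge0 ?(ltW n0).
Qed.

Lemma balanced_walks : exists S : {set (2 * l).-tuple dart},
  [/\ S \subset [set t in cwalks a b E1 (2 * l) | good a b t], S != set0 &
    forall T : {set X}, T != set0 ->
      #|[set t in S | T \subset edges t]|%:R * #|E1|%:R <=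
      Theta ^+ (cexp l + 2 * l + 2) * #|S|%:R * (growth l z n%:R / #|E1|%:R) ^+ (#|T| - 1)].
Proof.
have [S [SO dS tS]] := saturated_walks; exists S.
have SE : S \subset cwalks a b E (2 * l).
  by apply: subset_trans SO _; apply/subsetP => t; rewrite inE => /andP[].
have gr0 : 0 < growth l z (n%:R : R) by rewrite /growth mulr_gt0 ?exprn_gt0.
have T16 : ((16 * l)%:R : R) <= Theta.
  apply: le_trans lrT; rewrite ler_nat -!mulnA; apply: leq_mul => //.
  by rewrite leq_pmulr ?expn_gt0 // muln_gt0 (ltnW l2) (leq_trans _ r4).
have tS' : tau <= Theta * #|S|%:R by apply: le_trans tS _; rewrite ler_wpM2r.
split.
- by apply: subset_trans SO _; apply/subsetP => t; rewrite !inE => /andP[/andP[-> h] ->];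
    rewrite andbT /=; apply/allP => d /(allP h) /(subsetP EE1).
- apply/eqP => S0; move: tS; rewrite S0 cards0 mulr0 leNgt tau0; by [].
move=> T T0c.
have rhs0 : 0 <= Theta ^+ (cexp l + 2 * l + 2) * #|S|%:R * (growth l z n%:R / #|E1|%:R) ^+ (#|T| - 1).
  by rewrite mulr_ge0 ?exprn_ge0 ?divr_ge0 ?(ltW gr0) ?(ltW e0) // mulr_ge0 ?exprn_ge0 ?(ltW T0).
have [TE|TE] := boolP ((T \subset E) && (#|T| <= 2 * l)%N); last first.
  suff -> : [set t in S | T \subset edges t] = set0 by rewrite cards0 mul0r.
  apply/setP => t; rewrite !inE; apply/negP => /andP[tinS Tt]; move/negP: TE; apply.
  rewrite (subset_trans Tt (edges_sub (subsetP SE _ tinS))) /=.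
  by apply: leq_trans (subset_leq_card Tt) (card_edges t).
case/andP: TE => TE Tl.
have [T1c|T2c] := leqP #|T| 1.
  have cT : #|T| = 1%N by apply/eqP; rewrite eqn_leq T1c card_gt0.
  have /cards1P[x Tx] : #|T| == 1%N by rewrite cT.
  rewrite cT subnn expr0 mulr1.
  have deg : #|[set t in S | T \subset edges t]|%:R <= tau / #|E|%:R + 1.
    apply: le_trans (dS x); rewrite ler_nat subset_leq_card //; apply/subsetP => t.
    by rewrite !inE Tx sub1set.
  apply: (@le_trans _ _ ((tau / #|E|%:R + 1) * #|E1|%:R)); first by rewrite ler_wpM2r ?(ltW e0).
  apply: (@le_trans _ _ (Theta * tau)).
    rewrite mulrDl mul1r; apply: (@le_trans _ _ (kappa * tau + kappa * tau)).
      apply: lerD.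
        rewrite mulrAC ler_pdivrMr //.
        have -> : kappa * tau * #|E|%:R = tau * (kappa * #|E|%:R) by ring.
        by rewrite ler_wpM2l ?(ltW tau0).
      by apply: le_trans E1_le_tau _; rewrite ler_peMl ?(ltW tau0).
    rewrite -mulrDl ler_wpM2r ?(ltW tau0) //; apply: le_trans kT.
    apply: (@le_trans _ _ (2 * kappa)); first by rewrite mulr_natl mulr2n.
    by rewrite ler_wpM2r ?(ltW k0) // ler_nat.
  apply: (@le_trans _ _ (Theta ^+ 2 * #|S|%:R)).
    by rewrite expr2 -mulrA ler_wpM2l ?(ltW T0).
  rewrite ler_wpM2r //; apply: ler_weXn2l => //; by rewrite leq_addl.
have hw := walks_containing TE (introT andP (conj T2c Tl)).
have ej0 : 0 < (#|E1|%:R : R) ^+ (#|T| - 1) by rewrite exprn_gt0.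
rewrite expr_div_n mulrA ler_pdivlMr // -[leLHS]mulrA -exprS.
have Tj : (#|T| - 1).+1 = #|T| by rewrite subn1 prednK // ltnW.
rewrite [in leLHS]Tj.
apply: le_trans (_ : #|[set t in cwalks a b E (2 * l) | T \subset edges t]|%:R * #|E1|%:R ^+ #|T| <= _).
  rewrite ler_wpM2r ?exprn_ge0 ?(ltW e0) // ler_nat subset_leq_card //.
  by apply/subsetP => t; rewrite !inE => /andP[/(subsetP SE)]; rewrite inE => -> ->.
apply: le_trans hw _; rewrite mulrA ler_wpM2r ?exprn_ge0 ?(ltW gr0) // mulrA.
have lT : ((2 * l + 1)%:R : R) <= Theta.
  apply: le_trans T16; rewrite ler_nat; clear -l2; lia.
apply: (@le_trans _ _ (Theta ^+ (2 * l) * Theta ^+ cexp l * (Theta * #|S|%:R))).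
  apply: ler_pM => //; rewrite ?mulr_ge0 ?exprn_ge0 ?(ltW tau0) ?(ltW T0) //.
  by rewrite ler_wpM2r ?exprn_ge0 ?(ltW T0) // lerXn2r ?nnegrE ?(ltW T0).
rewrite mulrA -exprD -exprSr ler_wpM2r //; apply: ler_weXn2l => //.
by rewrite -addn1 [(2 * l + cexp l)%N]addnC leq_add2l.
Qed.

End Robust.

Theorem supersaturation : exists S : {set (2 * l).-tuple (bool * X)},
  [/\ S \subset [set t in cwalks a b E1 (2 * l) | good a b t], S != set0 &
    forall T : {set X}, T != set0 ->
      #|[set t in S | T \subset edges t]|%:R * #|E1|%:R <=
      Theta ^+ (cexp l + 2 * l + 2) * #|S|%:R * (growth l z n%:R / #|E1|%:R) ^+ (#|T| - 1)].
Proof.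
have [E rE] := robust_exists.
have dEE : dense E E by rewrite /dense subxx leq_mul2r orbT.
case: (@Order.TotalTheory.arg_minP _ _ _ E (dense E) (fun F => clw F l) dEE) => F0 dF0 F0min.
exact: (balanced_walks rE dF0 F0min).
Qed.

End Supersaturation.

(** * Hypergraph containers *)

Section Containers.
Variables (R : realType) (V : finType).
Implicit Types (H X : {set V} -> R) (F T : {set V}).

Definition wdeg H T : R := \sum_(F : {set V} | T \subset F) H F.

Definition independent H (I : {set V}) : Prop :=
  forall F, H F != 0 -> ~~ (F \subset I).

Lemma wdeg_ge0 H T : (forall F, 0 <= H F) -> 0 <= wdeg H T.
Proof. by move=> H0; apply: sumr_ge0. Qed.

Lemma sum_wdeg H (P : pred {set V}) :
  \sum_(T | P T) wdeg H T
  = \sum_F H F * #|[set T : {set V} | P T && (T \subset F)]|%:R.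
Proof.
rewrite /wdeg (exchange_big_dep predT) //=; apply: eq_bigr => F _.
by rewrite sumr_const mulr_natr cardsE.
Qed.

Lemma sum_wdeg_all H s : (forall F, H F != 0 -> #|F| = s) ->
  \sum_T wdeg H T = 2 ^+ s * \sum_F H F.
Proof.
move=> Hs; rewrite (sum_wdeg H predT) mulr_sumr; apply: eq_bigr => F _.
have [->|H0] := eqVneq (H F) 0; first by rewrite mul0r mulr0.
rewrite -(Hs _ H0) mulrC -natrX -card_powerset; congr (_%:R * _).
Qed.

Lemma sum_wdeg1 H s : (forall F, H F != 0 -> #|F| = s) ->
  \sum_v wdeg H [set v] = s%:R * \sum_F H F.
Proof.
move=> Hs; rewrite /wdeg (exchange_big_dep predT) //= mulr_sumr.
apply: eq_bigr => F _; rewrite sumr_const.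
have [->|H0] := eqVneq (H F) 0; first by rewrite mul0rn mulr0.
rewrite -(Hs _ H0) mulrC mulr_natr; congr (_ *+ _).
by apply: eq_card => v; rewrite unfold_in sub1set.
Qed.

Lemma container_base H (G : {set V}) (L : R) :
  (forall F, 0 <= H F) -> (forall F, H F != 0 -> #|F| = 1%N /\ F \subset G) ->
  0 < \sum_F H F -> 0 < L ->
  (forall T, T != set0 -> wdeg H T * #|G|%:R <= L * (\sum_F H F)) ->
  exists C : {set V}, [/\ C \subset G, (#|C|%:R : R) <= (1 - L^-1) * #|G|%:R &
    forall I : {set V}, I \subset G -> independent H I -> I \subset C].
Proof.
move=> H0 Hs Hpos Lpos Hdeg.
pose S := [set v | H [set v] != 0].
have SG : S \subset G.
  apply/subsetP => v; rewrite inE => /Hs[_]; by rewrite sub1set.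
exists (G :\: S); split; first exact: subsetDl.
- have tot : \sum_F H F = \sum_(v in S) wdeg H [set v].
    have := @sum_wdeg1 H 1 (fun F h => (Hs F h).1); rewrite mul1r => <-.
    rewrite [RHS]big_mkcond; apply: eq_bigr => v _; case: ifP => // vS.
    rewrite /wdeg big1 // => F; rewrite sub1set => vF.
    apply/eqP; apply/negPn/negP => HF; move: vS; rewrite inE.
    have [/eqP/cards1P[w FE] _] := Hs _ HF.
    by move: vF HF; rewrite FE inE => /eqP -> ->.
  have le1 : (\sum_F H F) * #|G|%:R <= #|S|%:R * (L * \sum_F H F).
    rewrite {1}tot mulr_suml mulr_natl -[leRHS](sumr_const (mem S)).
    apply: ler_sum => v _; apply: Hdeg.
    by apply/set0Pn; exists v; rewrite inE.
  have GS : (#|G|%:R : R) <= #|S|%:R * L.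
    by rewrite -(ler_pM2l Hpos) (le_trans le1) // mulrA mulrC.
  have cG : (#|G :\: S|%:R : R) = #|G|%:R - #|S|%:R.
    have := cardsID S G; rewrite (setIidPr SG) => <-.
    by rewrite natrD addrC addKr.
  rewrite cG mulrBl mul1r lerB // mulrC ler_pdivrMr //.
- move=> I IG indI; apply/subsetP => v vI; rewrite inE (subsetP IG) // andbT.
  rewrite inE negbK; apply/negPn/negP => hv; have := indI _ hv.
  by rewrite sub1set vI.
Qed.


Section Link.
Variables (H : {set V} -> R) (G : {set V}) (L tau : R) (s : nat).
Let tot : R := \sum_F H F.
Hypothesis H0 : forall F, 0 <= H F.
Hypothesis Hs : forall F, H F != 0 -> #|F| = s.+1 /\ F \subset G.
Hypothesis s0 : (0 < s)%N.
Hypothesis tot0 : 0 < tot.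
Hypothesis L1 : 1 <= L.
Hypothesis tau0 : 0 < tau.
Hypothesis Hdeg : forall T, T != set0 ->
  wdeg H T * #|G|%:R <= L * tot * tau ^+ (#|T| - 1).

Let L0 : 0 < L. Proof. exact: lt_le_trans ltr01 L1. Qed.

Lemma link_G0 : 0 < (#|G|%:R : R).
Proof.
rewrite ltr0n card_gt0; apply/eqP => G0; move: tot0; rewrite /tot big1 ?ltxx //.
move=> F _; apply/eqP; apply/negPn/negP => /Hs[cF].
by rewrite G0 subset0 => /eqP F0; rewrite F0 cards0 in cF.
Qed.

Definition cap j : R := L * tot / #|G|%:R * tau ^+ j.
Definition sat X T := cap #|T| <= wdeg X T.
Definition clean X F := [forall T : {set V}, (T != set0) && (T \subset F) ==> ~~ sat X T].
(* X accumulates the links of the vertices absorbed so far, discarding every F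
   that contains a saturated set; this caps the degrees of X. *)
Definition inc X v F : R := if (v \notin F) && clean X F then H (v |: F) else 0.
Definition add X v F : R := X F + inc X v F.
Definition addmass X v : R := \sum_(F : {set V} | (v \in F) && clean X (F :\ v)) H F.

Definition link_inv X :=
  [/\ forall F, 0 <= X F, forall F, X F != 0 -> #|F| = s /\ F \subset G &
      forall T, T != set0 -> wdeg X T <= 2 * cap #|T|].

Lemma cap_gt0 j : 0 < cap j.
Proof. by rewrite /cap !mulr_gt0 ?invr_gt0 ?link_G0 ?exprn_gt0. Qed.

Lemma inc_ge0 X v F : 0 <= inc X v F.
Proof. by rewrite /inc; case: ifP. Qed.

Lemma wdeg_H T : T != set0 -> wdeg H T <= cap (#|T| - 1).
Proof.
by move=> T0; rewrite /cap mulrAC ler_pdivlMr ?link_G0 // Hdeg.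
Qed.

Lemma sum_inc X v : \sum_F inc X v F = addmass X v.
Proof.
rewrite /addmass [RHS](reindex_onto (fun F : {set V} => v |: F) (fun F => F :\ v)) /=; last first.
  by move=> F /andP[vF _]; rewrite setD1K.
rewrite [LHS](bigID (fun F : {set V} => v \notin F)) /= [X in _ + X]big1 ?addr0; last first.
  by move=> F /negPf vF; rewrite /inc vF.
rewrite [LHS](bigID (clean X)) /= [X in _ + X]big1 ?addr0; last first.
  by move=> F /andP[vF /negPf cF]; rewrite /inc cF andbF.
apply: eq_big => [F|F /andP[vF cF]]; last by rewrite /inc vF cF.
rewrite setU11 /=; case vF : (v \in F) => /=; last first.
  by rewrite setU1K ?vF // eqxx andbT.
symmetry; apply/negP => /andP[_ /eqP FE]; move: vF; rewrite -FE.
by rewrite in_setD1 eqxx.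
Qed.

Lemma wdeg_inc X v T : T != set0 -> wdeg (inc X v) T <= cap #|T|.
Proof.
move=> T0; case vT : (v \in T).
  rewrite /wdeg big1; first exact: ltW (cap_gt0 _).
  by move=> F /subsetP TF; rewrite /inc (TF _ vT).
have vT0 : v |: T != set0 by apply/set0Pn; exists v; rewrite setU11.
have := wdeg_H vT0; rewrite cardsU1 vT /= add1n subn1 /=; apply: le_trans.
rewrite [leRHS]/wdeg (reindex_onto (fun F : {set V} => v |: F) (fun F => F :\ v)) /=; last first.
  by move=> F; rewrite subUset sub1set => /andP[vF _]; rewrite setD1K.
rewrite /wdeg [leLHS]big_mkcond [leRHS]big_mkcond; apply: ler_sum => F _.
case: ifP => TF; last by case: ifP.
rewrite /inc; case: ifP => [/andP[vF _]|_]; last by case: ifP.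
by rewrite setUS // setU1K // eqxx.
Qed.

Lemma link_inv0 : link_inv (fun _ => 0).
Proof.
split=> [//|F|T _]; first by rewrite eqxx.
by rewrite /wdeg big1 // mulr_ge0 ?ltW ?cap_gt0.
Qed.

Lemma link_inv_add X v : link_inv X -> link_inv (add X v).
Proof.
move=> [X0 Xs Xd]; split.
- by move=> F; rewrite addr_ge0 ?inc_ge0.
- move=> F; rewrite /add; have [->|XF _] := eqVneq (X F) 0; last exact: Xs.
  rewrite add0r /inc; case: ifP => [/andP[vF _]|]; last by rewrite eqxx.
  move=> /Hs; rewrite cardsU1 vF add1n => -[[->] /subUsetP[_ ?]]; by split.
- move=> T T0; have -> : wdeg (add X v) T = wdeg X T + wdeg (inc X v) T.
    by rewrite /wdeg -big_split.
  have [sT|sT] := boolP (sat X T).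
    rewrite [X in _ + X]/wdeg big1 ?addr0 ?Xd // => F TF.
    rewrite /inc; case: ifP => // /andP[_ /forallP/(_ T)].
    by rewrite T0 TF sT.
  rewrite mulr_natl mulr2n lerD ?wdeg_inc //.
  by move: sT; rewrite /sat -ltNge => /ltW.
Qed.

Lemma link_total X : link_inv X -> \sum_F X F <= 2 * L * tot * tau.
Proof.
move=> [X0 Xs Xd].
have sumX : s%:R * \sum_F X F <= #|G|%:R * (2 * cap 1).
  rewrite -(@sum_wdeg1 X s) => [|F /Xs[]//].
  rewrite mulr_natl -(sumr_const (mem G)) [leRHS]big_mkcond; apply: ler_sum => v _.
  case: ifP => vG.
    by have := Xd [set v]; rewrite cards1; apply; apply/set0Pn; exists v; rewrite inE.
  rewrite /wdeg big1 // => F; rewrite sub1set => vF; apply/eqP/negPn/negP => /Xs[_].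
  by move/subsetP/(_ _ vF); rewrite vG.
have -> : 2 * L * tot * tau = #|G|%:R * (2 * cap 1).
  by rewrite /cap expr1; field; rewrite gt_eqF ?link_G0.
apply: le_trans sumX; rewrite ler_peMl ?sumr_ge0 //.
by rewrite ler1n.
Qed.

Lemma sum_add X v : \sum_F add X v F = \sum_F X F + addmass X v.
Proof. by rewrite -sum_inc -big_split. Qed.

Definition rest X := [set v in G | addmass X v < tot / (4 * #|G|%:R)].

Lemma rest_or_large X : link_inv X ->
  (#|rest X|%:R : R) <= (1 - (2 * L)^-1) * #|G|%:R \/
  (forall T, T != set0 ->
    wdeg X T * #|G|%:R <= (2 ^+ (s + 3) * L) * (\sum_F X F) * tau ^+ (#|T| - 1))
  /\ 0 < \sum_F X F.
Proof.
move=> [X0 Xs Xd]; have G0 := link_G0.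
have [?|big] := leP (#|rest X|%:R : R) ((1 - (2 * L)^-1) * #|G|%:R); [by left|right].
set C := rest X in big *.
have CG : C \subset G by apply/subsetP => v; rewrite inE => /andP[].
have cD : (#|G :\: C|%:R : R) = #|G|%:R - #|C|%:R.
  by have := cardsID C G; rewrite (setIidPr CG) => <-; rewrite natrD addrC addKr.
pose S1 : R := \sum_(v in G :\: C) wdeg H [set v].
pose S2 : R := \sum_(v in C) addmass X v.
pose S3 : R := \sum_(T | (T != set0) && sat X T) wdeg H T.
have split3 : tot <= S1 + S2 + S3.
  rewrite /S1 /S2 /S3 /wdeg /addmass.
  rewrite (exchange_big_dep predT) //= [X in _ + X + _](exchange_big_dep predT) //=.
  rewrite [X in _ + X](exchange_big_dep predT) //= -!big_split /=.
  apply: ler_sum => F _; have [->|HF] := eqVneq (H F) 0.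
    by rewrite !big1 // !addr0.
  have [cF FG] := Hs HF.
  have [FC|] := boolP (F \subset C); last first.
    case/subsetPn => v vF vC; rewrite -addrA.
    rewrite (bigD1 v) /=; last by rewrite in_setD vC (subsetP FG) //= sub1set.
    by rewrite -addrA lerDl !addr_ge0 ?sumr_ge0.
  have [v vF] : exists v, v \in F by apply/set0Pn; rewrite -card_gt0 cF.
  have vC := subsetP FC _ vF.
  have [cl|] := boolP (clean X (F :\ v)).
    rewrite addrAC [X in _ <= _ + X](bigD1 v) /=; last by rewrite vC vF.
    by rewrite addrCA lerDl !addr_ge0 ?sumr_ge0.
  rewrite negb_forall => /existsP[T]; rewrite negb_imply negbK => /andP[/andP[T0 TF] sT].
  rewrite [X in _ <= _ + X](bigD1 T) /=; last first.
    by rewrite T0 sT (subset_trans TF) // subD1set.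
  by rewrite addrCA lerDl !addr_ge0 ?sumr_ge0.
have leS1 : S1 <= tot / 2.
  apply: (@le_trans _ _ (\sum_(v in G :\: C) cap 0)).
    apply: ler_sum => v _; have := @wdeg_H [set v]; rewrite cards1; apply.
    by apply/set0Pn; exists v; rewrite inE.
  rewrite sumr_const -[leLHS]mulr_natl cD /cap expr0 mulr1.
  have : #|G|%:R - #|C|%:R <= (2 * L)^-1 * #|G|%:R by move: big; rewrite mulrBl mul1r; lra.
  rewrite -(ler_pM2r (_ : 0 < L * tot / #|G|%:R)) ?divr_gt0 ?mulr_gt0 // => /le_trans; apply.
  apply: le_of_eq; field.
  by rewrite !gt_eqF.
have leS2 : S2 <= tot / 4.
  apply: (@le_trans _ _ (\sum_(v in C) tot / (4 * #|G|%:R))).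
    by apply: ler_sum => v; rewrite inE => /andP[_ /ltW].
  rewrite sumr_const -[leLHS]mulr_natl.
  have : (#|C|%:R : R) <= #|G|%:R by rewrite ler_nat subset_leq_card.
  rewrite -(ler_pM2r (_ : 0 < tot / (4 * #|G|%:R))) ?divr_gt0 ?mulr_gt0 // => /le_trans; apply.
  apply: le_of_eq; field.
  by rewrite !gt_eqF.
have leS3 : S3 <= 2 ^+ s * (\sum_F X F) / tau.
  rewrite -(@sum_wdeg_all X s) => [|F /Xs[]//].
  rewrite mulr_suml [leRHS](bigID (fun T => (T != set0) && sat X T)) /=.
  rewrite -[leLHS]addr0 lerD //; last first.
    by apply: sumr_ge0 => T _; rewrite mulr_ge0 ?wdeg_ge0 ?invr_ge0 ?ltW.
  apply: ler_sum => T /andP[T0 sT]; apply: le_trans (wdeg_H T0) _.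
  rewrite ler_pdivlMr //; apply: le_trans sT.
  by rewrite /cap -[leLHS]mulrA -exprSr subn1 prednK // card_gt0.
have key : tau * tot <= 2 ^+ (s + 2) * \sum_F X F.
  have : tot / 4 <= 2 ^+ s * (\sum_F X F) / tau by lra.
  rewrite ler_pdivlMr // exprD; nra.
split; last first.
  have : 0 < 2 ^+ (s + 2) * \sum_F X F by apply: lt_le_trans key; rewrite mulr_gt0.
  by rewrite pmulr_rgt0 ?exprn_gt0.
move=> T T0; have := Xd _ T0; rewrite -(ler_pM2r G0) => /le_trans; apply.
have -> : 2 * cap #|T| * #|G|%:R = 2 * L * (tau * tot) * tau ^+ (#|T| - 1).
  rewrite -[in LHS](@prednK #|T|) ?card_gt0 // subn1 /cap exprS; field.
  by rewrite gt_eqF.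
rewrite ler_pM2r ?exprn_gt0 //.
have -> : 2 ^+ (s + 3) * L * (\sum_F X F) = 2 * L * (2 ^+ (s + 2) * \sum_F X F).
  by rewrite !exprD; ring.
by rewrite ler_pM2l // mulr_gt0.
Qed.


Lemma independent_add X v (I : {set V}) : v \in I ->
  independent H I -> independent X I -> independent (add X v) I.
Proof.
move=> vI HI XI F; rewrite /add; have [->|/XI//] := eqVneq (X F) 0.
rewrite add0r /inc; case: ifP => [_ /HI|]; last by rewrite eqxx.
by rewrite subUset sub1set vI.
Qed.

Lemma container_link (P : {set V} -> Prop) (Y : nat) : (0 < Y)%N ->
  (forall C : {set V}, C \subset G ->
     (#|C|%:R : R) <= (1 - (2 * L)^-1) * #|G|%:R -> P C) ->
  (forall X, (forall F, 0 <= X F) -> (forall F, X F != 0 -> #|F| = s /\ F \subset G) ->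
     0 < \sum_F X F ->
     (forall T, T != set0 ->
    wdeg X T * #|G|%:R <= (2 ^+ (s + 3) * L) * (\sum_F X F) * tau ^+ (#|T| - 1)) ->
    exists CC : {set {set V}}, [/\ (#|CC| <= Y)%N, forall C, C \in CC -> P C &
      forall I : {set V}, I \subset G -> independent X I -> exists2 C, C \in CC & I \subset C]) ->
  forall b X, link_inv X ->
    2 * L * tot * tau - \sum_F X F <= b%:R * (tot / (4 * #|G|%:R)) ->
    exists CC : {set {set V}}, [/\ (#|CC| <= Y * (#|G|.+1) ^ b)%N, forall C, C \in CC -> P C &
      forall I : {set V}, I \subset G -> independent H I -> independent X I ->
        exists2 C, C \in CC & I \subset C].
Proof.
move=> Y0 Psmall Plarge.
have term X : link_inv X -> exists CC : {set {set V}},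
   [/\ (#|CC| <= Y)%N, forall C, C \in CC -> P C &
      forall I : {set V}, I \subset rest X -> independent X I ->
        exists2 C, C \in CC & I \subset C].
  move=> iX; have restG : rest X \subset G by apply/subsetP => v; rewrite inE => /andP[].
  case: (rest_or_large iX) => [small|[large pos]].
    exists [set rest X]; split; first by rewrite cards1.
      by move=> C; rewrite inE => /eqP ->; apply: Psmall.
    by move=> I IX _; exists (rest X); rewrite ?inE.
  case: iX => X0 Xs Xd; have [CC [c1 c2 c3]] := Plarge _ X0 Xs pos large.
  exists CC; split=> // I IX; apply: c3; exact: subset_trans restG.
have theta0 : 0 < tot / (4 * #|G|%:R) by rewrite divr_gt0 // mulr_gt0 // link_G0.
have big_add X v : v \in G -> v \notin rest X -> tot / (4 * #|G|%:R) <= addmass X v.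
  by move=> vG; rewrite inE vG /= -leNgt.
elim=> [|b IHb] X iX hb.
  have [CC [c1 c2 c3]] := term X iX.
  exists CC; split; [by rewrite expn0 muln1|by []|] => I IG HI XI.
  apply: c3 => //; apply/subsetP => v vI; apply/negPn/negP => vr.
  have := link_total (link_inv_add v iX); rewrite sum_add.
  have := big_add _ _ (subsetP IG _ vI) vr; move: hb theta0; rewrite mul0r; lra.
have [CC [c1 c2 c3]] := term X iX.
have step v : exists CC : {set {set V}}, v \in G :\: rest X ->
   [/\ (#|CC| <= Y * #|G|.+1 ^ b)%N, forall C, C \in CC -> P C &
      forall I : {set V}, I \subset G -> independent H I -> independent (add X v) I ->
        exists2 C, C \in CC & I \subset C].
  have [|_] := boolP (v \in G :\: rest X); last by exists set0.
  rewrite in_setD => /andP[vr vG].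
  have [|CC' [? ? ?]] := IHb (add X v) (link_inv_add v iX); last by exists CC'.
  rewrite sum_add; have := big_add _ _ vG vr; move: hb; rewrite -natr1 mulrDl mul1r; lra.
have [f fP] := fin_all_exists step.
exists (CC :|: \bigcup_(v in G :\: rest X) f v); split.
- rewrite (leq_trans (leq_card_setU _ _)) //.
  have : (#|\bigcup_(v in G :\: rest X) f v| <= #|G| * (Y * #|G|.+1 ^ b))%N.
    apply: (@leq_trans (\sum_(v in G :\: rest X) #|f v|)).
      elim/big_rec2: _ => [|v m A _ le]; first by rewrite cards0.
      by rewrite (leq_trans (leq_card_setU _ _)) // leq_add2l.
    apply: (@leq_trans (\sum_(v in G :\: rest X) (Y * #|G|.+1 ^ b))).
      by apply: leq_sum => v /fP[].
    by rewrite sum_nat_const leq_mul2r subset_leq_card ?orbT // subsetDl.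
  have : (Y <= Y * #|G|.+1 ^ b)%N by rewrite leq_pmulr // expn_gt0.
  rewrite expnS; nia.
- move=> C; rewrite inE => /orP[/c2//|/bigcupP[v vG]].
  by have [_ h _] := fP _ vG; apply: h.
- move=> I IG HI XI; have [Ir|] := boolP (I \subset rest X).
    by have [C CC0 IC] := c3 _ Ir XI; exists C; rewrite ?inE ?CC0.
  case/subsetPn => v vI vr.
  have vG : v \in G :\: rest X by rewrite in_setD vr (subsetP IG).
  have [_ _ h] := fP _ vG; have [C Cf IC] := h _ IG HI (independent_add vI HI XI).
  by exists C => //; rewrite inE; apply/orP; right; apply/bigcupP; exists v.
Qed.

End Link.

Theorem hypergraph_containers (s0 s : nat) : (0 < s <= s0)%N ->
  forall H (G : {set V}) (L tau : R) (b : nat),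
  (forall F, 0 <= H F) -> (forall F, H F != 0 -> #|F| = s /\ F \subset G) ->
  0 < \sum_F H F -> 1 <= L -> 0 < tau ->
  (forall T, T != set0 ->
     wdeg H T * #|G|%:R <= L * (\sum_F H F) * tau ^+ (#|T| - 1)) ->
  s%:R * (8 * (2 ^+ (s0 + 2)) ^+ s * L * tau * #|G|%:R + 1) <= b%:R ->
  exists CC : {set {set V}}, [/\ (#|CC| <= #|G|.+1 ^ b)%N,
    forall C, C \in CC -> C \subset G /\
      (#|C|%:R : R) <= (1 - (2 * (2 ^+ (s0 + 2)) ^+ s * L)^-1) * #|G|%:R &
    forall I : {set V}, I \subset G -> independent H I ->
      exists2 C, C \in CC & I \subset C].
Proof.
set gam : R := 2 ^+ (s0 + 2).
have gam1 : 1 <= gam by rewrite exprn_ege1 // ler1n.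
elim: s => // s IHs /andP[_ ss0] H G L tau b H0 Hs tot0 L1 tau0 Hdeg hb.
have L0 : 0 < L := lt_le_trans ltr01 L1.
have gams1 k : 1 <= gam ^+ k by rewrite exprn_ege1.
have shrink (x : R) (C : {set V}) : 1 <= x -> (#|C|%:R : R) <= (1 - (2 * L)^-1) * #|G|%:R ->
   (#|C|%:R : R) <= (1 - (2 * x * L)^-1) * #|G|%:R.
  move=> x1 /le_trans; apply; rewrite ler_wpM2r // lerD2l lerN2.
  have x0 : 0 < x := lt_le_trans ltr01 x1.
  rewrite lef_pV2 ?posrE ?mulr_gt0 // ler_pM2r // ler_pMr //.
case: s IHs ss0 Hs hb => [|s] IHs ss0 Hs hb.
  have [|C [CG Cs CI]] := @container_base H G L H0 Hs tot0 L0.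
    move=> T T0; have := Hdeg T T0.
    have [HT|HT] := eqVneq (wdeg H T) 0.
      by move=> _; rewrite HT mul0r mulr_ge0 // ltW.
    have /existsP[F /andP[TF HF]] : [exists F : {set V}, (T \subset F) && (H F != 0)].
      apply: contraR HT => /existsPn h; rewrite /wdeg big1 // => F TF.
      by have := h F; rewrite TF negbK => /eqP.
    have cT : (#|T| - 1 = 0)%N.
      by apply/eqP; rewrite subn_eq0 -(Hs _ HF).1 subset_leq_card.
    by rewrite cT expr0 !mulr1.
  exists [set C]; split.
  - by rewrite cards1 expn_gt0.
  - move=> D; rewrite inE => /eqP ->; split=> //; apply: shrink => //.
    apply: le_trans Cs _; rewrite ler_wpM2r // lerD2l lerN2.
    rewrite lef_pV2 ?posrE ?mulr_gt0 ?exprn_gt0 ?(lt_le_trans ltr01 gam1) //.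
    by apply: ler_peMl; rewrite ?mulr_ege1 ?ler1n ?gams1 ?ltW.
  - by move=> I IG HI; exists C; rewrite ?inE // CI.
pose b1 := (Num.truncn (8 * L * tau * #|G|%:R)).+1.
have Gp : 0 <= (#|G|%:R : R) by [].
have b1le : (b1%:R : R) <= 8 * gam ^+ s.+2 * L * tau * #|G|%:R + 1.
  rewrite /b1 -natr1 lerD2r.
  apply: le_trans (_ : _ <= 8 * L * tau * #|G|%:R) _.
    by rewrite truncn_le // !mulr_ge0 // ltW.
  by apply: ler_wpM2r => //; do 2!(apply: ler_wpM2r; first exact: ltW); rewrite ler_pMr.
have b1ge : 8 * L * tau * #|G|%:R <= b1%:R by rewrite ltW // truncnS_gt.
have b1b : (b1 <= b)%N.
  rewrite -(ler_nat R) (le_trans b1le) // (le_trans _ hb) // ler_peMl ?ler1n //.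
  apply: addr_ge0 => //; apply: mulr_ge0 => //; apply: mulr_ge0; last exact: ltW.
  apply: mulr_ge0; last exact: ltW.
  by apply: mulr_ge0 => //; exact: le_trans ler01 (gams1 _).
have G0 := @link_G0 H G s.+1 Hs tot0.
have hb2 : (s.+1)%:R * (8 * gam ^+ s.+1 * (gam * L) * tau * #|G|%:R + 1) <= ((b - b1)%:R : R).
  have -> : 8 * gam ^+ s.+1 * (gam * L) * tau * #|G|%:R = 8 * gam ^+ s.+2 * L * tau * #|G|%:R.
    by rewrite [gam ^+ s.+2]exprSr; ring.
  by move: hb b1le; rewrite natrB // -[s.+2%:R]natr1 mulrDl; lra.
have [] := @container_link H G L tau s.+1 H0 Hs isT tot0 L1 tau0 Hdeg
   (fun C => C \subset G /\ (#|C|%:R : R) <= (1 - (2 * gam ^+ s.+2 * L)^-1) * #|G|%:R)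
   (#|G|.+1 ^ (b - b1)) _ _ _ b1 (fun _ => 0).
- by rewrite expn_gt0.
- by move=> C CG Cs; split=> //; apply: shrink.
- move=> X X0 Xs Xpos Xdeg.
  have [|||CC [c1 c2 c3]] := IHs _ X G (gam * L) tau (b - b1)%N X0 Xs Xpos _ tau0 _ hb2.
  + by rewrite /= ltnW.
  + by rewrite -[1]mulr1 ler_pM.
  + move=> T T0; apply: le_trans (Xdeg T T0) _.
    apply: ler_wpM2r; first by rewrite exprn_ge0 // ltW.
    apply: ler_wpM2r; first exact: ltW.
    apply: ler_wpM2r; first exact: ltW.
    by rewrite ler_eXn2l ?ltr1n //; lia.
  + exists CC; split=> // C /c2[CG Cs]; split=> //.
    move: Cs; have -> : 2 * gam ^+ s.+1 * (gam * L) = 2 * gam ^+ s.+2 * L by rewrite [gam ^+ s.+2]exprSr; ring.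
    by [].
- exact: link_inv0.
- have -> : \sum_(F : {set V}) (0 : R) = 0 by rewrite big1.
  rewrite subr0 mulrA ler_pdivlMr ?mulr_gt0 //.
  have -> : 2 * L * (\sum_F H F) * tau * (4 * #|G|%:R) = (8 * L * tau * #|G|%:R) * \sum_F H F.
    by ring.
  by rewrite ler_pM2r.
- move=> CC [c1 c2 c3]; exists CC; split=> //.
    by rewrite -expnD subnK // in c1.
  move=> I IG HI; apply: c3 => // F; by rewrite eqxx.
Qed.

End Containers.

(** * Choosing the ends of the edges *)

Section Regularization.
Variables (X T W : finType) (pi : T -> X -> W).
Implicit Types (G E : {set X}).

Definition fib G t w := [set x in G | pi t x == w].
Definition proj G t := [set pi t x | x in G].

Lemma card_proj_fib G t : (\sum_(w in proj G t) #|fib G t w|)%N = #|G|.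
Proof.
rewrite -sum1_card (partition_big (pi t) (mem (proj G t))) /=; last first.
  by move=> x xG; exact: imset_f.
by apply: eq_bigr => w _; rewrite -sum1_card; apply: eq_bigl => x; rewrite !inE.
Qed.

(* One application of the pigeonhole principle to the vector of all dyadic
   levels of the fibre sizes in G. *)
Lemma regular_subfamily G (m : nat) : (#|G| < 2 ^ m)%N ->
  exists (E : {set X}) (D : T -> nat), [/\ E \subset G, (#|G| <= m ^ #|T| * #|E|)%N,
    forall t w, (#|fib E t w| <= D t)%N & forall t, (D t * #|proj E t| <= 2 * #|G|)%N].
Proof.
move=> Gm; have [->|G0] := eqVneq G set0.
  exists set0, (fun=> 0%N); split=> // [|t w]; first by rewrite cards0.
  by rewrite leqn0 cards_eq0; apply/eqP/setP => x; rewrite !inE.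
have m0 : (0 < m)%N by case: m Gm => //; rewrite expn0 ltnS leqn0 cards_eq0 (negPf G0).
pose lev t x := trunc_log 2 #|fib G t (pi t x)|.
have levm t x : (lev t x < m)%N.
  rewrite -(ltn_exp2l _ _ (isT : 1 < 2)%N); apply: leq_ltn_trans Gm.
  have [f0|f0] := posnP #|fib G t (pi t x)|.
    by rewrite /lev f0 trunc_log0 expn0 card_gt0.
  apply: leq_trans (trunc_logP _ _) _ => //.
  by apply/subset_leq_card/subsetP => y; rewrite inE => /andP[].
pose vec x := [ffun t => Ordinal (levm t x)] : {ffun T -> 'I_m}.
have [v vmax] : exists v, (#|G| <= m ^ #|T| * #|[set x in G | vec x == v]|)%N.
  pose c v := #|[set x in G | vec x == v]|.
  have [v0 _] : exists v0 : {ffun T -> 'I_m}, true.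
    by exists [ffun=> Ordinal m0].
  exists [arg max_(v > v0) c v]; case: arg_maxnP => // v _ vm.
  have -> : #|G| = (\sum_v c v)%N.
    rewrite -sum1_card (partition_big vec predT) //=; apply: eq_bigr => u _.
    by rewrite /c -sum1_card; apply: eq_bigl => x; rewrite !inE.
  have -> : (m ^ #|T| = #|{: {ffun T -> 'I_m}}|)%N by rewrite card_ffun card_ord.
  by rewrite -sum_nat_const; apply: leq_sum => u _; exact: vm.
set E := [set x in G | vec x == v] in vmax.
have EG : E \subset G by apply/subsetP => x; rewrite inE => /andP[].
have levE t x : x \in E -> lev t x = v t.
  by rewrite inE => /andP[_ /eqP <-]; rewrite ffunE.
exists E, (fun t => 2 ^ (v t).+1)%N; split=> // [t w|t].
  have [->|] := eqVneq (fib E t w) set0; first by rewrite cards0.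
  case/set0Pn => x; rewrite inE => /andP[xE /eqP xw].
  rewrite -(levE t x xE); apply: ltnW; apply: leq_ltn_trans (trunc_log_ltn _ _) => //.
  by rewrite xw; apply/subset_leq_card/subsetP => y; rewrite !inE => /andP[/andP[-> _] ->].
rewrite expnS -mulnA leq_mul2l /= mulnC -(card_proj_fib G t).
apply: leq_trans (_ : (\sum_(w in proj E t) #|fib G t w| <= _)%N); last first.
  rewrite [X in (_ <= X)%N](bigID (mem (proj E t))) /=.
  apply: leq_trans (leq_addr _ _); rewrite leq_eqVlt; apply/orP; left; apply/eqP.
  apply: eq_bigl => w; have [/imsetP[x xE ->]|] := boolP (w \in proj E t); last by rewrite andbF.
  by rewrite andbT imset_f // (subsetP EG).
rewrite -sum_nat_const; apply: leq_sum => w /imsetP[x xE ->].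
rewrite -(levE t x xE); apply: trunc_logP => //; rewrite card_gt0; apply/set0Pn; exists x.
by rewrite inE (subsetP EG) //=.
Qed.

Lemma clean_fibers (R : realFieldType) E (theta : T -> R) : (forall t, 0 <= theta t) ->
  exists F : {set X}, [/\ F \subset E,
    #|E|%:R <= #|F|%:R + \sum_t theta t * #|proj E t|%:R &
    forall t x, x \in F -> theta t <= #|fib F t (pi t x)|%:R].
Proof.
move=> th0; pose val (F : {set X}) : R := #|F|%:R - \sum_t theta t * #|proj F t|%:R.
have projS (F F' : {set X}) t : F \subset F' -> proj F t \subset proj F' t by exact: imsetS.
case: (@Order.TotalTheory.arg_maxP _ _ _ E [pred F : {set X} | F \subset E] val (subxx E)) => F /= FE Fmax.
exists F; split=> //.
  have /= := Fmax E (subxx E); rewrite /val.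
  have : 0 <= \sum_t theta t * (#|proj F t|%:R : R) by apply: sumr_ge0 => t _; rewrite mulr_ge0.
  lra.
move=> t x xF; set w := pi t x; pose F' := F :\: fib F t w.
have F'F : F' \subset F by exact: subsetDl.
have /= := Fmax F' (subset_trans F'F FE); rewrite /val.
have cF' : (#|F'|%:R : R) = #|F|%:R - #|fib F t w|%:R.
  have fF : fib F t w \subset F by apply/subsetP => y; rewrite inE => /andP[].
  by have := cardsID (fib F t w) F; rewrite (setIidPr fF) => <-; rewrite natrD addrC addKr.
have sums : \sum_t' theta t' * (#|proj F' t'|%:R : R) + theta t <= \sum_t' theta t' * #|proj F t'|%:R.
  rewrite (bigD1 t) //= [leRHS](bigD1 t) //= addrAC; apply: lerD.
    rewrite -[X in _ + X]mulr1 -mulrDr ler_wpM2l // natr1 ler_nat; apply: proper_card.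
    apply/properP; split; first exact: projS.
    exists w; first exact: imset_f.
    by apply/imsetP => -[y]; rewrite !inE => /andP[+ yF] wy; rewrite yF wy eqxx.
  apply: ler_sum => t' _; rewrite ler_wpM2l // ler_nat subset_leq_card // projS //.
rewrite cF'; lra.
Qed.

End Regularization.

Section Roles.
Variables (n : nat) (x0 : 'I_n) (r : nat).
Notation X := {set 'I_n}.

(* The position of a vertex in the enumeration of its edge plays the part of its
   class in an r-partition. *)
Definition vx (i : 'I_r) (e : X) : 'I_n := nth x0 (enum e) i.

Lemma vx_mem i (e : X) : #|e| = r -> vx i e \in e.
Proof. by move=> er; rewrite -mem_enum mem_nth // -cardE er. Qed.

Lemma vx_inj (e : X) i j : #|e| = r -> vx i e = vx j e -> i = j.
Proof.
move=> er /eqP; rewrite nth_uniq ?enum_uniq -?cardE ?er // => /eqP; exact: val_inj.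
Qed.

Lemma vx_ext (e f : X) : #|e| = r -> #|f| = r -> (forall i, vx i e = vx i f) -> e = f.
Proof.
move=> er fr ef; apply/setP => y; rewrite -[y \in e]mem_enum -[y \in f]mem_enum.
suff -> : enum e = enum f by [].
apply: (@eq_from_nth _ x0) => [|k]; first by rewrite -!cardE er fr.
by rewrite -cardE er => kr; exact: (ef (Ordinal kr)).
Qed.

Definition vx2 (q : 'I_r * 'I_r) (e : X) := (vx q.1 e, vx q.2 e).

(* Loomis-Whitney for the link of u, in its trivial one-dimensional form. *)
Lemma link_bound (F : {set X}) i u : (forall e, e \in F -> #|e| = r) ->
  (#|[set e in F | vx i e == u]| <= \prod_(j | j != i) #|[set vx j e | e in [set e in F | vx i e == u]]|)%N.
Proof.
move=> Fr; set Lk := [set e in F | vx i e == u].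
pose A j : {set 'I_n} := if j == i then [set u] else [set vx j e | e in Lk].
have -> : (\prod_(j | j != i) #|[set vx j e | e in Lk]| = \prod_j #|A j|)%N.
  rewrite [RHS](bigD1 i) //= /A eqxx cards1 mul1n; apply: eq_bigr => j ji.
  by rewrite (negPf ji).
pose f (e : X) : {ffun 'I_r -> 'I_n} := [ffun j => vx j e].
have finj : {in Lk &, injective f}.
  move=> e e'; rewrite !inE => /andP[eF _] /andP[e'F _] ee.
  by apply: vx_ext; rewrite ?Fr // => j; have := congr1 (fun h : {ffun 'I_r -> 'I_n} => h j) ee; rewrite !ffunE.
rewrite -(card_in_imset finj).
have -> : (\prod_j #|A j| = #|family A|)%N.
  by rewrite card_family foldrE big_map big_enum.
apply/subset_leq_card/subsetP => g /imsetP[e eL ->]; apply/familyP => j.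
rewrite ffunE /A; case: eqP => [->|_]; last exact: imset_f.
by move: eL; rewrite !inE => /andP[].
Qed.

Lemma big_factor (d : 'I_r -> nat) i : (4 <= r)%N -> (0 < n)%N ->
  (n ^ (r - 2) <= \prod_(j | j != i) d j)%N -> exists2 j, j != i & (n ^ 2 <= d j ^ 3)%N.
Proof.
move=> r4 n0 hp; apply/exists_inP; apply: contraT; rewrite negb_exists_in => /forall_inP h.
have h' j : j != i -> (d j ^ 3 <= (n ^ 2).-1)%N.
  by move=> /h; rewrite -ltnNge; case: (n ^ 2)%N (expn_gt0 n 2) => //; rewrite n0.
have le1 : ((\prod_(j | j != i) d j) ^ 3 <= (n ^ 2).-1 ^ (r - 1))%N.
  rewrite (big_morph (fun m => m ^ 3)%N (fun x y => expnMn x y 3) (exp1n 3)).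
  apply: leq_trans (leq_prod h') _; rewrite (eq_bigl (mem (predC1 i))) //.
  by rewrite prod_nat_const cardC1 card_ord subn1.
have lt1 : ((n ^ 2).-1 ^ (r - 1) < (n ^ 2) ^ (r - 1))%N.
  rewrite ltn_exp2r ?prednK ?expn_gt0 ?n0 // subn_gt0; exact: leq_trans r4.
have le2 : ((n ^ 2) ^ (r - 1) <= (n ^ (r - 2)) ^ 3)%N.
  by rewrite -!expnM leq_pexp2l //; lia.
have : ((n ^ (r - 2)) ^ 3 <= (\prod_(j | j != i) d j) ^ 3)%N by rewrite leq_exp2r.
by move=> h3; have := leq_trans (leq_trans lt1 le2) (leq_trans h3 le1); rewrite ltnn.
Qed.

End Roles.

Section RolesExist.
Variables (n : nat) (x0 : 'I_n) (r : nat).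
Notation X := {set 'I_n}.
Notation vx := (vx x0 (r := r)).
Hypothesis r4 : (4 <= r)%N.

Lemma roles_exist (G : {set X}) (m : nat) (M := (m ^ (r * r))%N) :
  (forall e, e \in G -> #|e| = r) -> G != set0 -> (#|G| < 2 ^ m)%N ->
  (M * (2 * (r * r)) * n ^ (r - 1) <= #|G|)%N ->
  exists (E0 : {set X}) (i j : 'I_r) (DA DB D d : nat),
  [/\ E0 \subset G, i != j, (#|G| <= M * #|E0|)%N & E0 != set0] /\
  [/\ forall u, (#|[set e in E0 | vx i e == u]| <= DA)%N,
      forall u, (#|[set e in E0 | vx j e == u]| <= DB)%N,
      forall u v, (#|[set e in E0 | (vx i e == u) && (vx j e == v)]| <= D)%N &
      (#|[set vx j e | e in E0]| <= #|[set vx i e | e in E0]|)%N] /\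
  [/\ (DA * #|[set vx i e | e in E0]| <= 2 * M * #|E0|)%N,
      (DB * #|[set vx j e | e in E0]| <= 2 * M * #|E0|)%N, (n ^ 2 <= d ^ 3)%N &
      (d * D * #|[set vx i e | e in E0]| <= 8 * (r * r) * M ^ 2 * #|E0|)%N].
Proof.
move=> Gr G0 Gm Gbig; have n0 : (0 < n)%N by apply: leq_ltn_trans (ltn_ord x0).
have r0 : (0 < r)%N by apply: leq_trans r4.
have [E0 [D [E0G GM hD hDN]]] := regular_subfamily (@vx2 n x0 r) Gm.
rewrite card_prod card_ord -/M in GM.
have E00 : E0 != set0.
  by apply/eqP => e; move: GM; rewrite e cards0 muln0 leqn0 cards_eq0; exact/negP.
have M0 : (0 < M)%N.
  rewrite /M expn_gt0; case: (m) Gm => //.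
  by rewrite expn0 ltnS leqn0 cards_eq0 (negPf G0).
pose N (q : 'I_r * 'I_r) := #|proj (@vx2 n x0 r) E0 q|.
have N0 q : (0 < N q)%N.
  by rewrite card_gt0; case/set0Pn: E00 => e eE; apply/set0Pn; exists (vx2 x0 q e); exact: imset_f.
pose NN i := #|[set vx i e | e in E0]|.
have NE i : N (i, i) = NN i.
  rewrite /N /proj /NN -(card_imset _ (_ : injective (fun u : 'I_n => (u, u)))); last by move=> ? ? [].
  by rewrite -imset_comp.
have NNn i : (NN i <= n)%N by rewrite -[X in (_ <= X)%N](card_ord n) max_card.
pose rr := (r * r)%N; have rr0 : (0 < rr)%N by rewrite muln_gt0 r0.
pose e0 : rat := #|E0|%:R.
have e0p : 0 < e0 by rewrite ltr0n card_gt0.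
pose theta q : rat := e0 / ((2 * rr)%:R * (N q)%:R).
have den0 q : 0 < ((2 * rr)%:R : rat) * (N q)%:R by rewrite mulr_gt0 // ltr0n ?N0 // muln_gt0 rr0.
have th0 q : 0 <= theta q by rewrite divr_ge0 ?(ltW e0p) ?(ltW (den0 q)).
have [F [FE0 Fbig Ffib]] := clean_fibers (@vx2 n x0 r) E0 th0.
have F0 : F != set0.
  apply/eqP => F0; move: Fbig; rewrite F0 cards0 add0r.
  have -> : \sum_t theta t * (#|proj (@vx2 n x0 r) E0 t|%:R : rat) = e0 / 2.
    rewrite (eq_bigr (fun _ => e0 / (2 * rr)%:R)) => [|q _].
      rewrite sumr_const card_prod card_ord -[LHS]mulr_natl -/rr natrM; field.
      by rewrite ?pnatr_eq0 -?lt0n ?muln_gt0 ?rr0 ?r0.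
    by rewrite /theta /N; field; rewrite !pnatr_eq0 -?lt0n ?N0 ?muln_gt0 ?rr0 ?r0.
  rewrite -/e0; lra.
have Fr e : e \in F -> #|e| = r by move=> eF; apply: Gr; apply: (subsetP E0G); exact: (subsetP FE0).
have [i _ imax] : exists2 i : 'I_r, true & forall i', (NN i' <= NN i)%N.
  by case: (@arg_maxnP _ (Ordinal r0) predT NN isT) => i _ h; exists i => // i'; exact: h.
case/set0Pn: F0 => es esF; pose u := vx i es.
pose Lk := [set e in F | vx i e == u].
have LkE : fib (@vx2 n x0 r) F (i, i) (u, u) = Lk.
  by apply/setP => e; rewrite !inE /vx2 /= xpair_eqE andbb.
have Lk_low : theta (i, i) <= #|Lk|%:R.
  by rewrite -LkE; have := Ffib (i, i) es esF.
have Lk_big : (n ^ (r - 2) <= #|Lk|)%N.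
  rewrite -(ler_nat rat); apply: le_trans Lk_low; rewrite /theta ler_pdivlMr // NE.
  have h1 : (2 * rr * n ^ (r - 1) <= #|E0|)%N.
    by rewrite -(leq_pmul2l M0) mulnA; apply: leq_trans GM.
  rewrite /e0 -!natrM ler_nat; apply: leq_trans h1; rewrite mulnCA leq_mul2l; apply/orP; right.
  have -> : (r - 1 = (r - 2).+1)%N by lia.
  by rewrite expnSr leq_mul2l NNn orbT.
pose dg j := #|[set vx j e | e in Lk]|.
have prodb := leq_trans Lk_big (link_bound x0 i u Fr).
have [j ji dj] := big_factor r4 n0 prodb.
have Lk_sum : (dg j)%:R * theta (i, j) <= #|Lk|%:R.
  have -> : #|Lk| = (\sum_(w in [set vx j e | e in Lk]) #|[set e in Lk | vx j e == w]|)%N.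
    rewrite -sum1_card (partition_big (vx j) (mem [set vx j e | e in Lk])) /=; last first.
      by move=> e eL; exact: imset_f.
    by apply: eq_bigr => w _; rewrite -sum1_card; apply: eq_bigl => e; rewrite !inE.
  rewrite natr_sum mulr_natl -sumr_const; apply: ler_sum => w /imsetP[e eL ->].
  have /andP[eF /eqP eu] : (e \in F) && (vx i e == u) by move: eL; rewrite inE.
  apply: le_trans (Ffib (i, j) e eF) _; rewrite ler_nat subset_leq_card //.
  by apply/subsetP => f; rewrite !inE /vx2 /= xpair_eqE eu => /and3P[-> -> ->].
exists E0, i, j, (D (i, i)), (D (j, j)), (D (i, j)), (dg j); split; [|split].
- by split=> //; rewrite eq_sym.
- split; last exact: imax.
  + move=> v; apply: leq_trans (hD (i, i) (v, v)); apply/subset_leq_card/subsetP => e.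
    by rewrite !inE /vx2 /= xpair_eqE => /andP[-> ->].
  + move=> v; apply: leq_trans (hD (j, j) (v, v)); apply/subset_leq_card/subsetP => e.
    by rewrite !inE /vx2 /= xpair_eqE => /andP[-> ->].
  + move=> v w; apply: leq_trans (hD (i, j) (v, w)); apply/subset_leq_card/subsetP => e.
    by rewrite !inE /vx2 /= ?xpair_eqE => /andP[-> /andP[-> ->]].
- have hDN' q : (D q * N q <= 2 * M * #|E0|)%N.
    by apply: leq_trans (hDN q) _; rewrite -mulnA leq_mul2l GM orbT.
  split; [by rewrite -/(NN i) -NE | by rewrite -/(NN j) -NE| by []|].
  have LkD : (#|Lk| <= D (i, i))%N.
    apply: leq_trans (hD (i, i) (u, u)); apply/subset_leq_card/subsetP => e.
    by rewrite !inE /vx2 /= xpair_eqE => /andP[/(subsetP FE0) -> ->].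
  have Dth : ((D (i, j))%:R : rat) <= (4 * rr * M)%:R * theta (i, j).
    have -> : (4 * rr * M)%:R * theta (i, j) = (2 * M)%:R * e0 / (N (i, j))%:R.
      rewrite /theta !natrM; field; rewrite !pnatr_eq0 -!lt0n N0 ?rr0 ?r0 //.
    rewrite ler_pdivlMr ?ltr0n // /e0 -!natrM ler_nat; exact: hDN'.
  rewrite -/(NN i) -(ler_nat rat).
  apply: (@le_trans _ _ ((4 * rr * M)%:R * (#|Lk|%:R * (NN i)%:R))).
    have -> : ((dg j * D (i, j) * NN i)%:R : rat) = (dg j)%:R * (D (i, j))%:R * (NN i)%:R.
      by rewrite 2!natrM.
    rewrite mulrA ler_wpM2r //.
    apply: (@le_trans _ _ ((dg j)%:R * ((4 * rr * M)%:R * theta (i, j)))); first by rewrite ler_wpM2l.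
    by rewrite mulrCA ler_wpM2l.
  rewrite -!natrM ler_nat; apply: (@leq_trans (4 * rr * M * (2 * M * #|E0|))).
    rewrite leq_mul2l; apply/orP; right; apply: leq_trans (hDN' (i, i)).
    by rewrite NE leq_mul2r LkD orbT.
  rewrite leq_eqVlt; apply/orP; left; apply/eqP; rewrite expnS expn1 -/rr; ring.
Qed.

End RolesExist.

Lemma card_separating (T : finType) (u v : T) : u != v ->
  (4 * #|[set Y : {set T} | (u \in Y) && (v \notin Y)]| = 2 ^ #|T|)%N.
Proof.
move=> uv; pose C := ~: [set u; v].
have -> : [set Y : {set T} | (u \in Y) && (v \notin Y)] = [set u |: Y | Y : {set T} in powerset C].
  apply/setP => Y; rewrite inE; apply/andP/imsetP => [[uY vY]|[Z]].
    exists (Y :\ u); last by rewrite setD1K.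
    rewrite powersetE; apply/subsetP => y; rewrite !inE negb_or => /andP[-> yY] /=.
    by apply: contraNneq vY => <-.
  rewrite powersetE => /subsetP ZC ->; rewrite !inE eqxx /= negb_or eq_sym uv /=; split=> //.
  by apply/negP => /ZC; rewrite !inE eqxx orbT.
rewrite card_in_imset; last first.
  move=> Y Z; rewrite !powersetE => /subsetP YC /subsetP ZC e.
  have nu (A : {set T}) : {subset A <= C} -> u \notin A.
    by move=> AC; apply/negP => /AC; rewrite !inE eqxx.
  by rewrite -(setU1K (nu Y YC)) -(setU1K (nu Z ZC)) e.
rewrite card_powerset; have := cardsC [set u; v]; rewrite cards2 uv -/C => <-.
by rewrite expnD.
Qed.

Lemma bipartite_subfamily (T X : finType) (a b : X -> T) (E : {set X}) :
  (forall x, x \in E -> a x != b x) ->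
  exists Y : {set T}, (#|E| <= 4 * #|[set x in E | (a x \in Y) && (b x \notin Y)]|)%N.
Proof.
move=> ab; pose c (Y : {set T}) := #|[set x in E | (a x \in Y) && (b x \notin Y)]|.
exists [arg max_(Y > set0) c Y]; case: arg_maxnP => // Y _ Ymax.
have : (#|E| * 2 ^ #|T| <= 2 ^ #|T| * (4 * c Y))%N.
  have -> : (#|E| * 2 ^ #|T| = 4 * \sum_(Z : {set T}) c Z)%N.
    have -> : (\sum_(Z : {set T}) c Z = \sum_(x in E) #|[set Z : {set T} | (a x \in Z) && (b x \notin Z)]|)%N.
      have cE (Z : {set T}) : c Z = (\sum_(x in E) ((a x \in Z) && (b x \notin Z)))%N.
        by rewrite /c -sum1dep_card big_mkcondr; apply: eq_bigr => x _; case: (_ && _).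
      rewrite (eq_bigr _ (fun Z _ => cE Z)) exchange_big /=; apply: eq_bigr => x _.
      by rewrite -sum1dep_card [RHS]big_mkcond; apply: eq_bigr => Z _; case: (_ && _).
    by rewrite big_distrr /= -sum_nat_const; apply: eq_bigr => x xE; rewrite card_separating // ab.
  rewrite mulnCA leq_mul2l /=.
  have -> : (2 ^ #|T| = #|{: {set T}}|)%N by rewrite -[#|T|]cardsT -card_powerset; apply: eq_card => Z; rewrite inE subsetT.
  by rewrite -sum_nat_const; apply: leq_sum => Z _; exact: Ymax.
by rewrite mulnC leq_pmul2l // expn_gt0.
Qed.

Section Config.
Variables (R : realType) (n : nat) (a b : {set 'I_n} -> 'I_n) (l : nat).
Notation X := {set 'I_n}.
Notation adj := (adj R a b).
Notation clw := (clw R a b).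
Variables (E1 : {set X}) (Y : {set 'I_n}) (NA NB : nat) (L z : R) (E3 : nat).
Implicit Types (F : {set X}).
Hypothesis hY : forall x, x \in E1 -> (a x \in Y) && (b x \notin Y).
Hypothesis l0 : (0 < l)%N.
Hypothesis E10 : E1 != set0.
Hypothesis NB0 : (0 < NB)%N.
Hypothesis NBA : (NB <= NA)%N.
Hypothesis NAn : (NA <= n)%N.
Hypothesis cA : (#|[set a x | x in E1]| <= NA)%N.
Hypothesis cB : (#|[set b x | x in E1]| <= NB)%N.
Hypothesis L1 : 1 <= L.
Hypothesis z1 : 1 <= z.
Hypothesis nz : n%:R = z ^+ (3 * E3).
Hypothesis degA : forall u, #|[set x in E1 | a x == u]|%:R * NA%:R <= L * #|E1|%:R.
Hypothesis degB : forall u, #|[set x in E1 | b x == u]|%:R * NB%:R <= L * #|E1|%:R.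
Hypothesis cod : forall u v, #|[set x in E1 | (a x == u) && (b x == v)]|%:R * NA%:R
   <= z ^- (2 * E3) * L * #|E1|%:R.

Let e1 : R := #|E1|%:R.
Let sA : R := Num.sqrt NA%:R.
Let sB : R := Num.sqrt NB%:R.
Let z0 : 0 < z := lt_le_trans ltr01 z1.
Let L0 : 0 < L := lt_le_trans ltr01 L1.
Let e0 : 0 < e1. Proof. by rewrite ltr0n card_gt0. Qed.
Let NA0 : (0 < NA)%N. Proof. exact: leq_trans NBA. Qed.
Let sA0 : 0 < sA. Proof. by rewrite sqrtr_gt0 ltr0n. Qed.
Let sB0 : 0 < sB. Proof. by rewrite sqrtr_gt0 ltr0n. Qed.
Let sA2 : sA ^+ 2 = NA%:R. Proof. by rewrite sqr_sqrtr. Qed.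
Let sB2 : sB ^+ 2 = NB%:R. Proof. by rewrite sqr_sqrtr. Qed.
Let sBA : sB <= sA. Proof. by rewrite ler_wsqrtr // ler_nat. Qed.

(* phi witnesses that L * scale bounds the spectral radius of adj E1, while the
   quadratic form of phi shows that this is sharp up to a factor of order L. *)
Definition scale : R := e1 / (sA * sB).
Let g0 : 0 < scale. Proof. by rewrite divr_gt0 // mulr_gt0. Qed.

Let phi (u : 'I_n) : R := if u \in Y then sA^-1 else sB^-1.
Let phi0 u : 0 < phi u. Proof. by rewrite /phi; case: ifP; rewrite invr_gt0. Qed.

Lemma adj_bip F u v : F \subset E1 -> adj F u v =
  if u \in Y then #|[set x in F | (a x == u) && (b x == v)]|%:R
  else #|[set x in F | (a x == v) && (b x == u)]|%:R.
Proof.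
move=> FE; pose f (c : bool) (x : X) : bool * X := (c, x).
have finj c : injective (f c) by move=> ? ? [].
rewrite mxE; case: ifP => uY; congr (_%:R).
  rewrite -(card_imset _ (finj false)); apply: eq_card => -[c x]; rewrite !inE /src /tgt /=.
  apply/idP/imsetP => [/andP[xF /andP[/eqP su /eqP tv]]|[y]].
    have /andP[aY bY] := hY (subsetP FE _ xF).
    case: c su tv => su tv; first by rewrite su uY in bY.
    by exists x; rewrite ?inE ?xF ?su ?tv ?eqxx.
  by rewrite inE => /and3P[yF ay byv] [-> ->]; rewrite yF ay byv.
rewrite -(card_imset _ (finj true)); apply: eq_card => -[c x]; rewrite !inE /src /tgt /=.
apply/idP/imsetP => [/andP[xF /andP[/eqP su /eqP tv]]|[y]].
  have /andP[aY bY] := hY (subsetP FE _ xF).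
  case: c su tv => su tv; last by rewrite su uY in aY.
  by exists x; rewrite ?inE ?xF ?su ?tv ?eqxx.
by rewrite inE => /and3P[yF ay byv] [-> ->]; rewrite yF ay byv.
Qed.

Lemma adj_entry u v : adj E1 u v <= z ^- (2 * E3) * L * e1 / NA%:R.
Proof. by rewrite adj_bip // ler_pdivlMr ?ltr0n //; case: ifP => _; exact: cod. Qed.

Lemma adj_row u : \sum_v adj E1 u v =
  if u \in Y then #|[set x in E1 | a x == u]|%:R else #|[set x in E1 | b x == u]|%:R.
Proof.
have part (c d : X -> 'I_n) : (\sum_v #|[set x in E1 | (c x == u) && (d x == v)]| = #|[set x in E1 | c x == u]|)%N.
  rewrite -[RHS]sum1_card (partition_big d predT) //=; apply: eq_bigr => v _.
  by rewrite -sum1_card; apply: eq_bigl => x; rewrite !inE andbA.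
under eq_bigr do rewrite adj_bip //.
case: ifP => _; first by rewrite -natr_sum part.
rewrite -(part b a) natr_sum; apply: eq_bigr => v _; congr (_%:R).
by apply: eq_card => x; rewrite !inE [(_ == v) && _]andbC.
Qed.

Lemma adj_supersol u : \sum_v adj E1 u v * phi v <= L * scale * phi u.
Proof.
have -> : \sum_v adj E1 u v * phi v = (\sum_v adj E1 u v) * (if u \in Y then sB^-1 else sA^-1).
  rewrite mulr_suml; apply: eq_bigr => v _.
  have [a0|] := eqVneq (adj E1 u v) 0; first by rewrite a0 !mul0r.
  rewrite adj_bip // => a0; congr (_ * _); move: a0; rewrite /phi.
  case uY: (u \in Y); rewrite pnatr_eq0 cards_eq0 => /set0Pn[x]; rewrite inE => /and3P[xE /eqP ax /eqP bx];
    have /andP[aY bY] := hY xE; rewrite ax bx in aY bY.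
    by rewrite (negPf bY).
  by rewrite aY.
rewrite adj_row /phi /scale; case: ifP => _.
  have := degA u; rewrite -/e1 -sA2 => h.
  have -> : L * (e1 / (sA * sB)) / sA = (L * e1 / sA ^+ 2) / sB.
    by field; rewrite !gt_eqF.
  by rewrite ler_wpM2r ?invr_ge0 ?(ltW sB0) // ler_pdivlMr ?exprn_gt0.
have := degB u; rewrite -/e1 -sB2 => h.
have -> : L * (e1 / (sA * sB)) / sB = (L * e1 / sB ^+ 2) / sA.
  by field; rewrite !gt_eqF.
by rewrite ler_wpM2r ?invr_ge0 ?(ltW sA0) // ler_pdivlMr ?exprn_gt0.
Qed.

Lemma config_walk k u v : mxpow (adj E1) k.+1 u v <= z ^- (2 * E3) * (L * scale) ^+ k.+1.
Proof.
have G0 : 0 < L * scale by rewrite mulr_gt0.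
have ent u' v' : 0 <= adj E1 u' v' <= z ^- (2 * E3) * L * e1 / NA%:R.
  by rewrite arcmx_ge0 adj_entry.
have rho u' w : phi u' <= (sA / sB) * phi w.
  have r1 : 1 <= sA / sB by rewrite ler_pdivlMr // mul1r.
  have iAB : sA^-1 <= sB^-1 by rewrite lef_pV2 ?posrE.
  have iBA : sB^-1 = sA / sB * sA^-1 by field; rewrite !gt_eqF.
  have up : phi u' <= sB^-1 by rewrite /phi; case: ifP.
  apply: (@le_trans _ _ (sA / sB * sA^-1)); first by rewrite -iBA.
  by rewrite ler_wpM2l ?divr_ge0 ?(ltW sA0) ?(ltW sB0) // /phi; case: ifP.
have := mxpow_supersol ent G0 phi0 adj_supersol rho k u v.
move/le_trans; apply; apply: le_of_eq.
rewrite exprSr /scale -sA2; field.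
by rewrite !gt_eqF ?exprn_gt0.
Qed.

Lemma config_lower F : F \subset E1 ->
  (#|F|%:R * scale) ^+ (2 * l) <= e1 ^+ (2 * l) * clw F l.
Proof.
move=> FE; have [->|F0] := eqVneq F set0.
  rewrite cards0 mul0r expr0n muln_eq0 /= eqn0Ngt l0 /=.
  rewrite mulr_ge0 ?exprn_ge0 ?(ltW e0) //; apply: sumr_ge0 => x _; exact: adjpow_ge0.
pose T := [set a x | x in E1] :|: [set b x | x in E1].
pose y : 'cV[R]_n := \col_u (if u \in T then phi u else 0).
have ya x : x \in E1 -> y (a x) 0 = sA^-1.
  by move=> xE; rewrite mxE /T inE imset_f //= /phi; case/andP: (hY xE) => ->.
have yb x : x \in E1 -> y (b x) 0 = sB^-1.
  by move=> xE; rewrite mxE /T inE imset_f ?orbT //= /phi; case/andP: (hY xE) => _ /negPf ->.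
have y2 : \sum_u y u 0 ^+ 2 <= 2.
  have le u : y u 0 ^+ 2 <= (u \in [set a x | x in E1])%:R / NA%:R + (u \in [set b x | x in E1])%:R / NB%:R.
    have [ua|ua] := boolP (u \in [set a x | x in E1]).
      case/imsetP: (ua) => x xE ->; rewrite ya // -sA2 exprVn mul1r lerDl.
      by rewrite mulr_ge0 ?invr_ge0.
    have [ub|ub] := boolP (u \in [set b x | x in E1]).
      case/imsetP: (ub) => x xE ->; rewrite yb // -sB2 exprVn mul1r mul0r add0r; exact: lexx.
    by rewrite mxE /T inE (negPf ua) (negPf ub) expr0n !mul0r addr0.
  apply: le_trans (ler_sum _ (fun u _ => le u)) _; rewrite big_split /= -!mulr_suml -!natr_sum.
  have sumc (A : {set 'I_n}) : (\sum_u (u \in A) = #|A|)%N by rewrite -sum1_card [RHS]big_mkcond; apply: eq_bigr => w _; case: (_ \in _).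
  rewrite !sumc -[2]/(1 + 1); apply: lerD; rewrite ler_pdivrMr ?ltr0n // mul1r ler_nat //.
pose c := 2 * #|F|%:R / (sA * sB).
have cE : c = \sum_u y u 0 * (adj F *m y) u 0.
  have -> : \sum_u y u 0 * (adj F *m y) u 0
     = \sum_(d in darts F) y (src a b d) 0 * y (tgt a b d) 0.
    rewrite (partition_big (src a b) predT) //=; apply: eq_bigr => u _.
    rewrite [(_ *m _) _ _]mxE mulr_sumr.
    under [LHS]eq_bigr do rewrite [adj _ _ _]arcmxE mulr_suml mulr_sumr.
    rewrite exchange_big /= [LHS](bigID (fun d => src a b d == u)) /= [X in _ + X]big1 ?addr0; last first.
      by move=> d /andP[_ /negPf du]; rewrite big1 // => v _; rewrite du mul0r mulr0.
    apply: eq_bigr => d /andP[_ /eqP du]; rewrite (bigD1 (tgt a b d)) //= big1 ?addr0.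
      by rewrite du !eqxx mul1r.
    by move=> v vd; rewrite [_ == v]eq_sym (negPf vd) andbF mul0r mulr0.
  have -> : \sum_(d in darts F) y (src a b d) 0 * y (tgt a b d) 0
     = \sum_(d in darts F) (sA * sB)^-1.
    apply: eq_bigr => -[c' x]; rewrite inE => /(subsetP FE) xE; rewrite /src /tgt /=.
    by case: (c'); rewrite ya // yb // invfM // mulrC.
  rewrite sumr_const /c; have -> : #|darts F| = (2 * #|F|)%N.
    have -> : darts F = setX [set: bool] F by apply/setP => -[c' x]; rewrite !inE.
    by rewrite cardsX cardsT card_bool.
  by rewrite -[RHS]mulr_natl natrM.
have c0 : 0 < c by rewrite divr_gt0 ?mulr_gt0 // ltr0n card_gt0.
have two0 : 0 < (2 : R) by rewrite ltr0n.
have := mxtrace_lower (adj_sym R a b F) l two0 y2 cE c0.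
have -> : c = 2 * (#|F|%:R / (sA * sB)) by rewrite /c mulrA.
rewrite exprMn ler_pM2l ?exprn_gt0 // => h.
have -> : #|F|%:R * scale = e1 * (#|F|%:R / (sA * sB)) by rewrite /scale; ring.
by rewrite exprMn ler_wpM2l ?exprn_ge0 ?(ltW e0).
Qed.

Lemma config_walk1 : clw E1 1 <= 2 * L * z ^+ E3 * scale ^+ 2.
Proof.
rewrite /clw -[(1 + 1)%N]/(1 + 1)%N /mxtrace.
have -> : \sum_x mxpow (adj E1) (1 + 1) x x = \sum_x \sum_w adj E1 x w ^+ 2.
  by apply: eq_bigr => x _; rewrite (mxpow_diag (adj_sym R a b E1)) mxpow1.
set D := z ^- (2 * E3) * L * e1 / NA%:R.
apply: (@le_trans _ _ (\sum_x \sum_w D * adj E1 x w)).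
  by apply: ler_sum => x _; apply: ler_sum => w _; rewrite expr2 ler_wpM2r ?arcmx_ge0 ?adj_entry.
under eq_bigr do rewrite -mulr_sumr.
rewrite -mulr_sumr.
have sum2 : \sum_x \sum_w adj E1 x w <= 2 * e1.
  apply: (@le_trans _ _ (\sum_u (#|[set x in E1 | a x == u]|%:R + #|[set x in E1 | b x == u]|%:R))).
    by apply: ler_sum => u _; rewrite adj_row; case: ifP; rewrite ?lerDl ?lerDr.
  have part (c : X -> 'I_n) : (\sum_u #|[set x in E1 | c x == u]| = #|E1|)%N.
    rewrite -[RHS]sum1_card (partition_big c predT) //=; apply: eq_bigr => v _.
    by rewrite -sum1_card; apply: eq_bigl => x; rewrite !inE.
  by rewrite big_split /= -!natr_sum !part -/e1 mulr_natl mulr2n.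
have NBn : (NB%:R : R) <= z ^+ (3 * E3) by rewrite -nz ler_nat (leq_trans NBA).
have D0 : 0 <= D by rewrite /D !mulr_ge0 ?invr_ge0 ?exprn_ge0 ?(ltW z0) ?(ltW L0) ?(ltW e0).
apply: le_trans (ler_wpM2l D0 sum2) _.
rewrite /D /scale expr_div_n exprMn sA2 sB2.
have NB0' : 0 < (NB%:R : R) by rewrite ltr0n.
have NA0' : 0 < (NA%:R : R) by rewrite ltr0n.
have -> : z ^- (2 * E3) * L * e1 / NA%:R * (2 * e1) = 2 * L * e1 ^+ 2 / NA%:R * z ^- (2 * E3).
  by field; rewrite !gt_eqF ?exprn_gt0.
have -> : 2 * L * z ^+ E3 * (e1 ^+ 2 / (NA%:R * NB%:R)) = 2 * L * e1 ^+ 2 / NA%:R * (z ^+ E3 / NB%:R).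
  by field; rewrite !gt_eqF.
rewrite ler_wpM2l ?divr_ge0 ?mulr_ge0 ?exprn_ge0 ?(ltW L0) ?(ltW e0) //.
rewrite ler_pdivlMr // ler_pdivrMl ?exprn_gt0 // -exprD.
by rewrite -[X in (_ + X)%N]mul1n -mulnDl.
Qed.

Lemma config_degree u : #|[set x in E1 | (a x == u) || (b x == u)]|%:R <= L * e1 / NB%:R.
Proof.
have NB0' : 0 < (NB%:R : R) by rewrite ltr0n.
have dA : #|[set x in E1 | a x == u]|%:R * NB%:R <= L * e1.
  by apply: le_trans (degA u); rewrite ler_wpM2l // ler_nat.
rewrite ler_pdivlMr //; case uY: (u \in Y).
  apply: le_trans dA; rewrite ler_wpM2r // ler_nat subset_leq_card //.
  apply/subsetP => x; rewrite !inE => /andP[xE /orP[->|/eqP bx]]; rewrite xE //=.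
  by have /andP[_] := hY xE; rewrite bx uY.
apply: le_trans (degB u); rewrite ler_wpM2r // ler_nat subset_leq_card //.
apply/subsetP => x; rewrite !inE => /andP[xE /orP[/eqP ax|->]]; rewrite xE //=.
by have /andP[] := hY xE; rewrite ax uY.
Qed.

Lemma config_degree_scale : L * e1 / NB%:R * e1 <= L * n%:R * scale ^+ 2.
Proof.
have NB0' : 0 < (NB%:R : R) by rewrite ltr0n.
have NA0' : 0 < (NA%:R : R) by rewrite ltr0n.
have NAn' : (NA%:R : R) <= n%:R by rewrite ler_nat.
rewrite /scale expr_div_n exprMn sA2 sB2.
have -> : L * n%:R * (e1 ^+ 2 / (NA%:R * NB%:R)) = (L * e1 / NB%:R * e1) * (n%:R / NA%:R).
  by field; rewrite !gt_eqF.
rewrite ler_peMr ?mulr_ge0 ?divr_ge0 ?mulr_ge0 ?invr_ge0 ?(ltW L0) ?(ltW e0) //.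
by rewrite ler_pdivlMr // mul1r.
Qed.

Lemma config_scale : e1 <= n%:R * scale.
Proof.
have sAB : sA * sB <= n%:R.
  apply: (@le_trans _ _ (sA * sA)); first by rewrite ler_wpM2l ?(ltW sA0).
  by rewrite -expr2 sA2 ler_nat.
rewrite /scale mulrCA ler_peMr ?(ltW e0) // ler_pdivlMr ?mulr_gt0 // mul1r //.
Qed.

Lemma scale_gt0 : 0 < scale. Proof. exact: g0. Qed.

Lemma scale_le : scale <= e1.
Proof.
have s1 (k : nat) : (0 < k)%N -> 1 <= Num.sqrt (k%:R : R).
  by move=> k0; rewrite -[X in X <= _]sqrtr1 ler_wsqrtr // ler1n.
by rewrite /scale ler_pdivrMr ?mulr_gt0 // ler_peMr ?(ltW e0) // mulr_ege1 ?s1.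
Qed.

End Config.

(** * From good closed walks to linear cycles *)

Section LinearCycle.
Variables (n : nat) (a b : {set 'I_n} -> 'I_n).
Notation X := {set 'I_n}.
Notation dart := (bool * X)%type.

Lemma conn_next x0 u (s : seq dart) v j : conn a b u s v -> (j < size s)%N ->
  tgt a b (nth x0 s j) = if (j.+1 < size s)%N then src a b (nth x0 s j.+1) else v.
Proof.
elim: s u j => [|d s IH] u [|j] //=; rewrite ?ltnS => /andP[_ cs] js.
  by case: s cs {IH js} => [/eqP|d' s /= /andP[/eqP ->]].
exact: IH cs js.
Qed.

Lemma closedw_next k (t : k.-tuple dart) i : closedw a b t ->
  tgt a b (tnth t i) = src a b (tnth t (ordS i)).
Proof.
have d := tnth t i; rewrite !(tnth_nth d) => cl; have sk := size_tuple t.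
case: (tval t) sk cl => [|d' s] sk cl; first by have := ltn_ord i; rewrite -[X in (_ < X)%N]sk.
have ik : (i < size (d' :: s))%N by rewrite sk.
rewrite (conn_next d (s := d' :: s) cl ik) sk /=.
case: ltnP => h; first by rewrite modn_small.
have -> : i.+1 = k by apply/eqP; rewrite eqn_leq h ltn_ord.
by rewrite modnn.
Qed.

Variables (r k : nat) (E : {set X}) (t : k.-tuple dart).
Hypothesis r3 : (2 < r)%N.
Hypothesis hE : forall x, x \in E -> [/\ #|x| = r, a x \in x, b x \in x & a x != b x].
Hypothesis tE : t \in cwalks a b E k.
Hypothesis tg : good a b t.

Let e i := (tnth t i).2.
Let v i := src a b (tnth t i).
Let free i := e i :\: [set v i; v (ordS i)].

Let eE i : e i \in E.
Proof. by move: tE; rewrite inE => /andP[_ /all_tnthP /(_ i)]. Qed.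

Let next i : tgt a b (tnth t i) = v (ordS i).
Proof. by apply: closedw_next; move: tE; rewrite inE => /andP[]. Qed.

Let ends i : [set v i; v (ordS i)] = [set a (e i); b (e i)].
Proof. by rewrite -next /v /e /src /tgt; case: (tnth t i).1; rewrite //= setUC. Qed.

Let v_mem i : v i \in e i.
Proof. by have [_ ai bi _] := hE (eE i); rewrite /v /src; case: (tnth t i).1. Qed.

Let v'_mem i : v (ordS i) \in e i.
Proof. by have [_ ai bi _] := hE (eE i); rewrite -next /tgt; case: (tnth t i).1. Qed.

Let free_card i : #|free i| = (r - 2)%N.
Proof.
have [er ai bi ab] := hE (eE i).
rewrite /free ends cardsD (setIidPr _); first by rewrite er cards2 ab.
by apply/subsetP => w; rewrite !inE => /orP[] /eqP ->.
Qed.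

Let v_inj : injective v.
Proof.
have h (i i' : 'I_k) : (i < i')%N -> v i != v i'.
  by move=> ii; move: tg => /forallP/(_ i)/forallP/(_ i')/andP[/implyP/(_ ii)].
move=> i i' vv; apply/val_inj/eqP; case: ltngtP => // ii.
  by have := h _ _ ii; rewrite vv eqxx.
by have := h _ _ ii; rewrite vv eqxx.
Qed.

Let free_disjoint i i' w : w \in free i -> w \in e i' -> i = i'.
Proof.
rewrite /free ends !inE negb_or => /andP[/andP[wa wb] wi] wi'.
apply/eqP; apply: contraT => ii.
move: tg => /forallP/(_ i')/forallP/(_ i)/andP[_]; rewrite eq_sym ii /= => /negP[].
by apply/existsP; exists w; rewrite -!/(e _) wi wi' wa wb.
Qed.

Lemma card_good_edges : #|edges t| = k.
Proof.
have einj : injective e.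
  move=> i i' ee; have : (0 < #|free i|)%N by rewrite free_card subn_gt0.
  rewrite card_gt0 => /set0Pn[w wf]; apply: (free_disjoint wf).
  by move: wf; rewrite -ee inE => /andP[].
have -> : edges t = [set e i | i : 'I_k].
  apply/setP => x; apply/imsetP/imsetP => [[d /tnthP[i ->] ->]|[i _ ->]]; first by exists i.
  by exists (tnth t i) => //; exact: mem_tnth.
by rewrite card_imset // card_ord.
Qed.

Lemma good_lin_cycle (H : {set X}) : edges t \subset H -> contains_copy (lin_cycle k r) H.
Proof.
move=> tH; pose c i (j : 'I_(r - 2)) := nth (v i) (enum (free i)) j.
have js i (j : 'I_(r - 2)) : (j < size (enum (free i)))%N by rewrite -cardE free_card.
have c_free i j : c i j \in free i by rewrite -mem_enum mem_nth.
pose f (u : 'I_k + 'I_k * 'I_(r - 2)) := match u with inl i => v i | inr ij => c ij.1 ij.2 end.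
have vc i i' j : v i != c i' j.
  apply/eqP => vv; have cf := c_free i' j.
  have ii : i' = i by apply: (free_disjoint cf); rewrite -vv.
  by move: cf; rewrite -vv -ii !inE eqxx.
exists f; split.
  case=> [i|[i j]] [i'|[i' j']] /= h.
  - by rewrite (v_inj h).
  - by have := vc i i' j'; rewrite h eqxx.
  - by have := vc i' i j; rewrite h eqxx.
  have ii : i = i'.
    by apply: (free_disjoint (c_free i j)); rewrite h; have := c_free i' j'; rewrite inE => /andP[].
  case: _ / ii in h *; move/eqP: h; rewrite /c nth_uniq ?enum_uniq //.
  by move/eqP/val_inj => ->.
move=> _ /imsetP[i _ ->]; apply: (subsetP tH).
have -> : f @: lin_cycle_edge r i = e i; last first.
  by apply/imsetP; exists (tnth t i) => //; exact: mem_tnth.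
apply/setP => w; apply/imsetP/idP => [[u + ->]|we].
  rewrite !inE => /orP[/orP[/eqP ->|/eqP ->]|/imsetP[j _ ->]] //=.
  by have := c_free i j; rewrite inE => /andP[].
have [wf|wf] := boolP (w \in free i).
  have wi : (index w (enum (free i)) < r - 2)%N by rewrite -(free_card i) cardE index_mem mem_enum.
  exists (inr (i, Ordinal wi)); last by rewrite /f /c /= nth_index ?mem_enum.
  by rewrite !inE; apply/orP; right; apply/imsetP; exists (Ordinal wi).
move: wf; rewrite !inE we andbT negbK => /orP[] /eqP ->.
  by exists (inl i); rewrite ?inE ?eqxx.
by exists (inl (ordS i)); rewrite ?inE ?eqxx ?orbT.
Qed.

End LinearCycle.

(** * Iterating containers *)

Lemma card_fibers (A B : finType) (f : A -> B) (S : {set A}) (P : pred B) :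
  (\sum_(F | P F) #|[set t in S | f t == F]| = #|[set t in S | P (f t)]|)%N.
Proof.
rewrite -[RHS]sum1_card (partition_big f P) /=; last by move=> t; rewrite inE => /andP[].
apply: eq_bigr => F PF; rewrite -sum1_card; apply: eq_bigl => t; rewrite !inE.
by have [->|] := eqVneq (f t) F; rewrite ?andbF ?andbT // PF andbT.
Qed.

Section Weight.
Variables (R : realType) (n r l p m : nat) (z Mb : R) (G : {set {set 'I_n}}).
Notation X := {set 'I_n}.
Notation E3 := (2 * (2 * l - 1) * (l - 1))%N.

Definition kexp := ((3 * E3 * r + 1) * (2 * l * l))%N.
Notation kappa := (2 ^+ (2 * kexp) : R).
Definition roleloss : R := 32 * (r * r)%:R * Mb ^+ 2.
Definition polyloss : R := roleloss + 4 * kappa + (128 * l ^ 2 * r)%:R.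
Definition wexp := (cexp l + 2 * l + 2)%N.

Hypothesis r4 : (4 <= r)%N.
Hypothesis l2 : (2 <= l)%N.
Hypothesis n0 : (0 < n)%N.
Hypothesis z1 : 1 <= z.
Hypothesis nz : n%:R = z ^+ (3 * E3).
Hypothesis p0 : (0 < p)%N.
Hypothesis pz : 2 ^+ p <= z.
Hypothesis zp : z <= 2 ^+ p.+1.
Hypothesis zT : polyloss ^+ ((2 * l + 2) * l + 5) <= z.
Hypothesis Gr : forall e, e \in G -> #|e| = r.
Hypothesis Gm : (#|G| < 2 ^ m)%N.
Hypothesis Mb1 : 1 <= Mb.
Hypothesis mM : (m ^ (r * r))%:R <= Mb.
Hypothesis Gbig : 4 * Mb * kappa * (128 * l ^ 2 * r)%:R * n%:R ^+ (r - 1) <= #|G|%:R.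

Lemma alpha_product (a b : X -> 'I_n) (E : {set X}) (L g : R) :
  0 <= L -> L <= z -> 0 < g -> g <= n%:R ^+ r ->
  (forall k u v, mxpow (adj R a b E) k.+1 u v <= z ^- (2 * E3) * (L * g) ^+ k.+1) ->
  \prod_(h < l.-1) alpha R a b E h.+1 <= kappa ^+ p.
Proof.
move=> L0 Lz g0 gn hW; have z0 : 0 < z := lt_le_trans ltr01 z1.
pose B := z ^+ ((3 * E3 * r + 1) * (2 * l)).
have B1 : 1 <= B by rewrite exprn_ege1.
have aB h : (h < l.-1)%N -> alpha R a b E h.+1 <= B.
  move=> hl; apply: alpha_le => [|x]; first exact: le_trans B1.
  rewrite addnS; apply: le_trans (hW _ _ _) _.
  apply: (@le_trans _ _ ((L * g) ^+ (h.+1 + h).+1)).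
    rewrite ler_piMl ?exprn_ge0 ?mulr_ge0 ?(ltW g0) // invf_le1 ?exprn_gt0 //.
    by rewrite exprn_ege1.
  apply: (@le_trans _ _ ((z * z ^+ (3 * E3 * r)) ^+ (h.+1 + h).+1)).
    rewrite lerXn2r ?nnegrE ?mulr_ge0 ?exprn_ge0 ?(ltW z0) ?(ltW g0) //.
    by rewrite ler_pM ?(ltW g0) // exprM -nz.
  rewrite -exprS -exprM /B; apply: ler_weXn2l => //; rewrite -[X in (X * _)%N]addn1 leq_mul2l.
  apply/orP; right; move: hl l2; clear; lia.
apply: (@le_trans _ _ (\prod_(h < l.-1) B)).
  apply: ler_prod => h _; rewrite aB ?ltn_ord // andbT.
  by apply: le_trans (alpha_ge R a b E h.+1 (Ordinal n0)); exact: adjpow_ge0.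
rewrite prodr_const card_ord /B -exprM.
apply: (@le_trans _ _ (z ^+ kexp)).
  apply: ler_weXn2l => //; rewrite /kexp -mulnA leq_mul2l leq_mul2l.
  by rewrite leq_pred !orbT.
apply: (@le_trans _ _ ((2 ^+ (2 * p)) ^+ kexp)).
  rewrite lerXn2r ?nnegrE ?exprn_ge0 ?(ltW z0) //.
  apply: le_trans zp _; apply: ler_weXn2l; first by rewrite ler1n.
  by rewrite mul2n -addnn -addn1 leq_add2l.
by rewrite -!exprM [(2 * p * _)%N]mulnAC.
Qed.

Lemma supersaturated_weight : exists H : {set X} -> R,
  [/\ forall F, 0 <= H F,
      forall F, H F != 0 -> #|F| = (2 * l)%N /\ F \subset G,
      0 < \sum_F H F,
      forall T : {set X}, T != set0 -> wdeg H T * #|G|%:R <=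
        4 * Mb * polyloss ^+ wexp * (\sum_F H F) *
          (4 * Mb * growth l z n%:R / #|G|%:R) ^+ (#|T| - 1) &
      forall I : {set X}, I \subset G -> hfree (lin_cycle (2 * l) r) I -> independent H I].
Proof.
have z0 : 0 < z := lt_le_trans ltr01 z1.
have n0R : 0 < (n%:R : R) by rewrite ltr0n.
have k1 : 1 <= kappa by rewrite exprn_ege1 // ler1n.
pose x0 := Ordinal n0.
have C1 : 1 <= ((128 * l ^ 2 * r)%:R : R).
  by rewrite ler1n !muln_gt0 /= (ltnW l2) (leq_trans _ r4).
have Mb0 : 0 < Mb := lt_le_trans ltr01 Mb1.
have k0 : 0 < kappa := lt_le_trans ltr01 k1.
have C0 := lt_le_trans ltr01 C1.
have G0 : G != set0.
  rewrite -card_gt0 -(ltr0n R); apply: lt_le_trans Gbig.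
  by rewrite !mulr_gt0 ?exprn_gt0.
have rk : (r%:R : R) <= kappa.
  rewrite -natrX ler_nat; apply: leq_trans (ltnW (ltn_expl _ (isT : (1 < 2)%N))) _ => //.
  rewrite leq_exp2l // /kexp; have E30 : (0 < E3)%N.
    by rewrite !muln_gt0 /= !subn_gt0 l2 (leq_trans l2) // leq_pmull.
  apply: leq_trans (leq_pmull _ _) => //; apply: leq_trans (leq_pmulr _ _); last first.
    by rewrite !muln_gt0 /= (ltnW l2).
  by apply: leq_trans (leq_addr _ _); rewrite leq_pmull // muln_gt0.
have rC : (r%:R : R) <= (128 * l ^ 2 * r)%:R.
  by rewrite ler_nat leq_pmull // muln_gt0 expn_gt0 (ltnW l2).
have Gpre : (m ^ (r * r) * (2 * (r * r)) * n ^ (r - 1) <= #|G|)%N.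
  rewrite -(ler_nat R); apply: le_trans Gbig; rewrite natrM natrX ler_wpM2r ?exprn_ge0 // natrM.
  rewrite -!mulrA mulrCA; apply: ler_pM => //; rewrite ?mulr_ge0 //.
  rewrite natrM; apply: ler_pM => //; first by rewrite ler_nat.
  by rewrite natrM; apply: ler_pM.
have [E0 [i [j [DA [DB [D [d [[E0G ij GE0 E00] [[dA dB dAB NBA] [hA hB nd hD]]]]]]]]]] :=
  roles_exist x0 r4 Gr G0 Gm Gpre.
pose a := vx x0 i; pose b := vx x0 j.
pose NA := #|[set a e | e in E0]|; pose NB := #|[set b e | e in E0]|.
have abE0 x : x \in E0 -> a x != b x.
  move=> xE; apply: contra_neq ij; apply: vx_inj; exact: Gr (subsetP E0G _ xE).
have [Y hY4] := bipartite_subfamily abE0.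
pose E1 := [set x in E0 | (a x \in Y) && (b x \notin Y)].
rewrite -/E1 in hY4.
have E1E0 : E1 \subset E0 by apply/subsetP => x; rewrite inE => /andP[].
have E10 : E1 != set0.
  by rewrite -card_gt0; move: hY4 E00; rewrite -card_gt0; clear; lia.
have hY x : x \in E1 -> (a x \in Y) && (b x \notin Y) by rewrite inE => /andP[].
have NB0 : (0 < NB)%N.
  by have /set0Pn[x xE] := E00; rewrite card_gt0; apply/set0Pn; exists (b x); exact: imset_f.
have NAn : (NA <= n)%N by rewrite -[X in (_ <= X)%N]card_ord max_card.
have cA : (#|[set a x | x in E1]| <= NA)%N by rewrite subset_leq_card // imsetS.
have cB : (#|[set b x | x in E1]| <= NB)%N by rewrite subset_leq_card // imsetS.
pose L := roleloss.
have rr1 : 1 <= ((r * r)%:R : R) by rewrite ler1n muln_gt0 (leq_trans _ r4).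
have Mb2 : Mb <= Mb ^+ 2 by rewrite expr2 ler_peMl // ltW.
have ML : 8 * (m ^ (r * r))%:R <= L.
  rewrite /L /roleloss -mulrA; apply: ler_pM => //; first by rewrite ler_nat.
  by apply: le_trans mM _; apply: le_trans Mb2 _; rewrite ler_peMl // exprn_ge0 // ltW.
have M2L : 32 * (r * r)%:R * (m ^ (r * r))%:R ^+ 2 <= L.
  by rewrite /L /roleloss ler_wpM2l ?mulr_ge0 // lerXn2r ?nnegrE ?(ltW Mb0).
have L1 : 1 <= L.
  by rewrite /L /roleloss mulr_ege1 ?exprn_ege1 // mulr_ege1 // ler1n.
have L0 : 0 <= L := le_trans ler01 L1.
have LT : L <= polyloss.
  by rewrite /polyloss -addrA lerDl addr_ge0 // mulr_ge0 // ltW.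
have kT : 4 * kappa <= polyloss.
  by rewrite /polyloss addrAC lerDr addr_ge0.
have lrT : (128 * l ^ 2 * r)%:R <= polyloss.
  by rewrite /polyloss lerDr addr_ge0 // mulr_ge0 // ltW.
have T1 : 1 <= polyloss := le_trans L1 LT.
have Tz : polyloss <= z.
  by apply: le_trans zT; rewrite -[leLHS]expr1; apply: ler_weXn2l => //; rewrite addn_gt0 orbT.
have sub4 (P : pred X) (K : nat) : (#|[set x in E0 | P x]| <= K)%N -> (#|[set x in E1 | P x]| <= K)%N.
  apply: leq_trans; apply/subset_leq_card/subsetP => x; rewrite !inE.
  by move=> /andP[/andP[-> _] ->].
have e14 : (#|E0|%:R : R) <= 4 * #|E1|%:R by rewrite -natrM ler_nat.
have deg (c : X -> 'I_n) (N K : nat) : (forall u, #|[set x in E0 | c x == u]| <= K)%N ->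
    (K * N <= 2 * m ^ (r * r) * #|E0|)%N ->
    forall u, #|[set x in E1 | c x == u]|%:R * N%:R <= L * #|E1|%:R.
  move=> hK hKN u; apply: (@le_trans _ _ (2 * (m ^ (r * r))%:R * #|E0|%:R)).
    rewrite -!natrM ler_nat; apply: leq_trans hKN; rewrite leq_mul2r; apply/orP; right.
    exact: sub4 (hK u).
  apply: (@le_trans _ _ (2 * (m ^ (r * r))%:R * (4 * #|E1|%:R))).
    by rewrite ler_wpM2l // mulr_ge0.
  have -> : 2 * (m ^ (r * r))%:R * (4 * #|E1|%:R) = 8 * (m ^ (r * r))%:R * #|E1|%:R :> R by ring.
  by rewrite ler_wpM2r.
have degA := deg _ _ _ dA hA; have degB := deg _ _ _ dB hB.
have zd : z ^+ (2 * E3) <= d%:R.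
  rewrite -(@ler_pXn2r _ 3) ?nnegrE ?exprn_ge0 ?(ltW z0) //.
  have -> : (z ^+ (2 * E3)) ^+ 3 = n%:R ^+ 2 by rewrite nz -!exprM; congr (_ ^+ _); clear; lia.
  by rewrite -!natrX ler_nat.
have cod u v : #|[set x in E1 | (a x == u) && (b x == v)]|%:R * NA%:R
    <= z ^- (2 * E3) * L * #|E1|%:R.
  rewrite -mulrA ler_pdivlMl ?exprn_gt0 //.
  apply: (@le_trans _ _ ((d * D * NA)%:R)).
    rewrite !natrM -mulrA; apply: ler_pM; rewrite ?mulr_ge0 ?exprn_ge0 ?(ltW z0) //.
    by rewrite ler_wpM2r // ler_nat; exact: sub4 (dAB u v).
  apply: (@le_trans _ _ (8 * (r * r)%:R * (m ^ (r * r))%:R ^+ 2 * #|E0|%:R)).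
    by rewrite -natrX -!natrM ler_nat.
  apply: (@le_trans _ _ (8 * (r * r)%:R * (m ^ (r * r))%:R ^+ 2 * (4 * #|E1|%:R))).
    by rewrite ler_wpM2l // !mulr_ge0 // exprn_ge0.
  have -> : 8 * (r * r)%:R * (m ^ (r * r))%:R ^+ 2 * (4 * #|E1|%:R)
     = 32 * (r * r)%:R * (m ^ (r * r))%:R ^+ 2 * #|E1|%:R :> R by ring.
  by rewrite ler_wpM2r.
pose g := scale R E1 NA NB.
have g0 : 0 < g by exact: scale_gt0.
have walkW := config_walk hY E10 NB0 NBA L1 z1 degA degB cod.
have hE1 x : x \in E1 -> [/\ #|x| = r, a x \in x, b x \in x & a x != b x].
  move=> xE1; have xE0 := subsetP E1E0 _ xE1; have xr := Gr (subsetP E0G _ xE0).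
  by split=> //; [exact: vx_mem | exact: vx_mem | exact: abE0].
have gn : g <= n%:R ^+ r.
  apply: le_trans (scale_le R E10 NB0 NBA) _; rewrite -natrX ler_nat.
  apply: leq_trans (_ : 'C(n, r) <= _)%N; last exact: bin_le_expn.
  rewrite -[X in 'C(X, _)]card_ord -card_draws; apply: subset_leq_card.
  by apply/subsetP => x /hE1[xr _ _ _]; rewrite inE xr.
have kappap := alpha_product L0 (le_trans LT Tz) g0 gn walkW.
have GE1 : #|G|%:R <= 4 * Mb * #|E1|%:R.
  apply: (@le_trans _ _ ((m ^ (r * r))%:R * #|E0|%:R)); first by rewrite -natrM ler_nat.
  apply: (@le_trans _ _ (Mb * (4 * #|E1|%:R))); first by rewrite ler_pM.
  by rewrite mulrCA mulrA.
have E1big : kappa * (128 * l ^ 2 * r)%:R * n%:R ^+ (r - 1) <= #|E1|%:R.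
  rewrite -(ler_pM2l (_ : 0 < 4 * Mb)) ?mulr_gt0 //; apply: le_trans GE1.
  by apply: le_trans Gbig; rewrite !mulrA.
have [S [SO S0 Sdeg]] := supersaturation l2 hE1 E10 g0 z1 nz L1 walkW
  (config_lower R hY (ltnW l2) E10 NB0 NBA cA cB)
  (config_walk1 hY E10 NB0 NBA NAn L1 z1 nz cod)
  (config_degree hY NB0 NBA degA degB)
  (config_degree_scale E10 NB0 NBA NAn L1) (config_scale R E10 NB0 NBA NAn)
  p0 pz k1 kappap LT kT lrT r4 zT E1big.
have SE t : t \in S -> (t \in cwalks a b E1 (2 * l)) /\ good a b t.
  by move/(subsetP SO); rewrite inE => /andP[].
have [H HE] : exists H : {set X} -> R, forall F, H F = #|[set t in S | edges t == F]|%:R.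
  by eexists => F.
have HP (P : pred {set X}) : \sum_(F | P F) H F = #|[set t in S | P (edges t)]|%:R.
  by rewrite -card_fibers natr_sum; apply: eq_bigr => F _.
have Hsum : \sum_F H F = #|S|%:R.
  by rewrite HP; congr (_%:R); apply: eq_card => t; rewrite inE andbT.
have Hsupp F : H F != 0 -> exists2 t, t \in S & edges t = F.
  rewrite HE pnatr_eq0 cards_eq0 => /set0Pn[t]; rewrite inE => /andP[tS /eqP tF]; by exists t.
have G0R : 0 < (#|G|%:R : R) by rewrite ltr0n card_gt0.
have e0 : 0 < (#|E1|%:R : R) by rewrite ltr0n card_gt0.
have gr0 : 0 < growth l z n%:R by rewrite /growth mulr_gt0 // exprn_gt0.
have Hpos : 0 < \sum_F H F by rewrite [X in 0 < X]Hsum ltr0n card_gt0.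
have Hdeg (T : {set X}) : T != set0 -> wdeg H T * #|G|%:R <=
    4 * Mb * polyloss ^+ wexp * (\sum_F H F) * (4 * Mb * growth l z n%:R / #|G|%:R) ^+ (#|T| - 1).
  move=> T0; rewrite [X in _ * X * _]Hsum /wdeg HP.
  apply: (@le_trans _ _ (#|[set t in S | T \subset edges t]|%:R * (4 * Mb * #|E1|%:R))).
    by rewrite ler_wpM2l.
  set q := 4 * Mb * growth l z n%:R / #|G|%:R; set P := polyloss ^+ wexp.
  have -> : 4 * Mb * P * #|S|%:R * q ^+ (#|T| - 1) = 4 * Mb * (P * #|S|%:R * q ^+ (#|T| - 1)).
    by rewrite !mulrA.
  rewrite mulrCA; apply: ler_wpM2l; first by rewrite mulr_ge0 // ltW.
  apply: le_trans (Sdeg T T0) _; apply: ler_wpM2l.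
    by rewrite mulr_ge0 // exprn_ge0 // (le_trans ler01).
  rewrite /q lerXn2r ?nnegrE ?divr_ge0 ?mulr_ge0 ?exprn_ge0 ?(ltW z0) ?(ltW Mb0) //.
  rewrite ler_pdivrMr // mulrAC ler_pdivlMr // [leLHS]mulrC [leRHS]mulrAC.
  by rewrite ler_wpM2r // ltW.
exists H; split.
- by move=> F; rewrite HE.
- move=> F /Hsupp[t tS <-]; have [tw tg] := SE _ tS; split.
    exact: card_good_edges (leq_trans _ r4) hE1 tw tg.
  apply: subset_trans (edges_sub tw) _; exact: subset_trans E1E0 E0G.
- exact: Hpos.
- exact: Hdeg.
- move=> I IG Ifree F /Hsupp[t tS <-]; apply/negP => tI.
  have [tw tg] := SE _ tS; apply: Ifree; exact: good_lin_cycle hE1 tw tg _ tI.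
Qed.
End Weight.

Definition gain (l : nat) : nat := ((2 ^ (2 * l + 2)) ^ (2 * l))%N.

Lemma step_containers (R : realType) (n r l p m b : nat) (z Mb : R) (G : {set {set 'I_n}})
    (Lc := 4 * Mb * polyloss r l Mb ^+ wexp l) :
  (4 <= r)%N -> (2 <= l)%N -> (0 < n)%N -> 1 <= z ->
  n%:R = z ^+ (3 * (2 * (2 * l - 1) * (l - 1))) ->
  (0 < p)%N -> 2 ^+ p <= z -> z <= 2 ^+ p.+1 ->
  polyloss r l Mb ^+ ((2 * l + 2) * l + 5) <= z ->
  (forall e : {set 'I_n}, e \in G -> #|e| = r) -> (#|G| < 2 ^ m)%N -> 1 <= Mb ->
  (m ^ (r * r))%:R <= Mb ->
  4 * Mb * 2 ^+ (2 * kexp r l) * (128 * l ^ 2 * r)%:R * n%:R ^+ (r - 1) <= #|G|%:R ->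
  (2 * l)%:R * (8 * (gain l)%:R * Lc * (4 * Mb * growth l z n%:R) + 1) <= b%:R ->
  exists CC : {set {set {set 'I_n}}},
    [/\ (#|CC| <= #|G|.+1 ^ b)%N,
        forall C, C \in CC -> C \subset G /\ #|C|%:R <= (1 - (2 * (gain l)%:R * Lc)^-1) * #|G|%:R
      & forall I : {set {set 'I_n}}, I \subset G -> hfree (lin_cycle (2 * l) r) I ->
          exists2 C, C \in CC & I \subset C].
Proof.
move=> r4 l2 n0 z1 nz p0 pz zp zT Gr Gm Mb1 mM Gbig hb.
have [H [H0 Hs Hpos Hdeg Hind]] := supersaturated_weight r4 l2 n0 z1 nz p0 pz zp zT Gr Gm Mb1 mM Gbig.
have Mb0 : 0 < Mb := lt_le_trans ltr01 Mb1.
have n0R : 0 < (n%:R : R) by rewrite ltr0n.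
have z0 : 0 < z := lt_le_trans ltr01 z1.
have G0 : 0 < (#|G|%:R : R).
  apply: lt_le_trans Gbig; rewrite !mulr_gt0 ?exprn_gt0 // ltr0n !muln_gt0 /= (ltnW l2).
  exact: leq_trans r4.
have P1 : 1 <= polyloss r l Mb.
  rewrite /polyloss -[X in X <= _]addr0 -[X in X + _ <= _]add0r; apply: lerD => //.
  apply: lerD; first by rewrite /roleloss !mulr_ge0 ?exprn_ge0 // ltW.
  by rewrite mulr_ege1 ?exprn_ege1 // ler1n.
have Lc1 : 1 <= Lc by rewrite /Lc mulr_ege1 ?exprn_ege1 // mulr_ege1 // ler1n.
have gr0 : 0 < growth l z n%:R by rewrite /growth mulr_gt0 // exprn_gt0.
have tau0 : 0 < 4 * Mb * growth l z n%:R / #|G|%:R by rewrite divr_gt0 // !mulr_gt0 ?exprn_gt0.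
have gE : (gain l)%:R = 2 ^+ (2 * l + 2) ^+ (2 * l) :> R by rewrite /gain !natrX.
have l20 : (0 < 2 * l <= 2 * l)%N by rewrite leqnn muln_gt0 (ltnW l2).
have hb' : (2 * l)%:R * (8 * 2 ^+ (2 * l + 2) ^+ (2 * l) * Lc *
    (4 * Mb * growth l z n%:R / #|G|%:R) * #|G|%:R + 1) <= b%:R.
  apply: le_trans hb; rewrite -gE -[X in _ * (X + 1)]mulrA divfK // gt_eqF //.
have [CC [cc1 cc2 cc3]] := hypergraph_containers l20 H0 Hs Hpos Lc1 tau0 Hdeg hb'.
exists CC; split=> // [C /cc2|I IG Ifree].
  by rewrite gE.
by apply: cc3 => //; exact: Hind.
Qed.

Lemma iterate_containers (R : realType) (V : finType) (free : {set V} -> Prop)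
    (A : {set V}) (T q : R) (B : nat) : 0 <= q -> (0 < B)%N ->
  (forall G : {set V}, G \subset A -> T < #|G|%:R ->
    exists CC : {set {set V}},
    [/\ (#|CC| <= B)%N,
        forall C, C \in CC -> C \subset G /\ #|C|%:R <= q * #|G|%:R
      & forall I : {set V}, I \subset G -> free I -> exists2 C, C \in CC & I \subset C]) ->
  forall k, exists CC : {set {set V}},
    [/\ (#|CC| <= B ^ k)%N,
        forall C, C \in CC -> C \subset A /\ (#|C|%:R <= T \/ #|C|%:R <= q ^+ k * #|A|%:R)
      & forall I : {set V}, I \subset A -> free I -> exists2 C, C \in CC & I \subset C].
Proof.
move=> q0 B0 step.
have /choice[f fP] : forall G : {set V}, exists CC : {set {set V}}, G \subset A ->
    [/\ (#|CC| <= B)%N,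
        forall C, C \in CC -> C \subset G /\ (#|C|%:R <= T \/ #|C|%:R <= q * #|G|%:R)
      & forall I : {set V}, I \subset G -> free I -> exists2 C, C \in CC & I \subset C].
  move=> G; have [GA|nGA] := boolP (G \subset A); last by exists set0.
  have [GT|GT] := leP (#|G|%:R) T.
    exists [set G] => _; split; first by rewrite cards1.
    - by move=> C; rewrite inE => /eqP ->; split; [|left].
    by move=> I IG _; exists G; rewrite ?inE.
  have [CC [c1 c2 c3]] := step G GA GT; exists CC => _; split=> //.
  by move=> C /c2[CG cq]; split=> //; right.
elim=> [|k [CC [c1 c2 c3]]].
  exists [set A]; split; first by rewrite cards1 expn0.
  - by move=> C; rewrite inE => /eqP ->; split=> //; right; rewrite expr0 mul1r.
  by move=> I IA _; exists A; rewrite ?inE.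
exists (\bigcup_(G in CC) f G); split.
- apply: leq_trans (leq_card_bigcup _ _) _.
  apply: (@leq_trans (\sum_(G in CC) B)).
    by apply: leq_sum => G /c2[GA _]; have [] := fP G GA.
  by rewrite sum_nat_const expnSr leq_mul2r c1 orbT.
- move=> C /bigcupP[G /c2[GA Gq] Cf]; have [_ /(_ C Cf)[CG Cq] _] := fP G GA.
  split; first exact: subset_trans CG GA.
  have CGle : (#|C|%:R : R) <= #|G|%:R by rewrite ler_nat subset_leq_card.
  case: Gq => [GT|Gq]; first by left; exact: le_trans GT.
  case: Cq => [CT|Cq]; first by left.
  by right; apply: le_trans Cq _; rewrite exprS -mulrA ler_wpM2l.
move=> I IA Ifree; have [G GC IG] := c3 I IA Ifree.
have [GA _] := c2 G GC; have [_ _ /(_ I IG Ifree)[C Cf IC]] := fP G GA.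
by exists C => //; apply/bigcupP; exists G.
Qed.

Lemma poly_le_expR (R : realType) (a q N : nat) : (0 < N)%N ->
  exists Y : R, forall y, Y <= y -> a%:R * y ^+ q <= expR (y / N%:R).
Proof.
move=> N0; pose D : R := (N * q.+1)%:R.
have D0 : 0 < D by rewrite ltr0n muln_gt0 N0.
exists (a%:R * D ^+ q.+1) => y Yy.
have y0 : 0 <= y by apply: le_trans Yy; rewrite mulr_ge0 // exprn_ge0 // ltW.
have -> : y / N%:R = q.+1%:R * (y / D).
  have n1 : N%:R != 0 :> R by rewrite pnatr_eq0 -lt0n.
  have n2 : q.+1%:R != 0 :> R by rewrite pnatr_eq0.
  rewrite /D natrM; move: (N%:R) (q.+1%:R) n1 n2 => u v n1 n2; field; exact/andP.
apply: (@le_trans _ _ ((y / D) ^+ q.+1)); last first.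
  rewrite expRM_natl; rewrite lerXn2r ?nnegrE ?expR_ge0 ?divr_ge0 ?(ltW D0) //.
  by apply: le_trans (expR_ge1Dx _); rewrite lerDr.
rewrite expr_div_n ler_pdivlMr ?exprn_gt0 // mulrAC [leRHS]exprS.
by rewrite ler_wpM2r ?exprn_ge0.
Qed.

Lemma dyadic_bracket (R : realType) (z : R) : 2 <= z ->
  exists p, [/\ (0 < p)%N, 2 ^+ p <= z & z <= 2 ^+ p.+1].
Proof.
move=> z2; have z0 : 0 <= z by apply: le_trans z2.
have /andP[t1 t2] := Num.Theory.truncn_itv z0; set N := Num.truncn z in t1 t2.
have N2 : (2 <= N)%N.
  by rewrite -ltnS -(ltr_nat R); apply: le_lt_trans t2.
have N0 : (0 < N)%N := ltnW N2.
have /andP[p1 p2] := trunc_log_bounds (isT : (1 < 2)%N) N0.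
exists (trunc_log 2 N); split.
- by rewrite trunc_log_gt0 // N2.
- by apply: le_trans t1; rewrite -natrX ler_nat.
by apply: le_trans (ltW t2) _; rewrite -natrX ler_nat.
Qed.

Lemma expR_half_le2 (R : realType) : expR (2^-1 : R) <= 2.
Proof.
rewrite -[2^-1]opprK expRN -[leRHS]invrK lef_pV2 ?posrE ?invr_gt0 ?expR_gt0 //.
apply: le_trans (expR_ge1Dx _); lra.
Qed.

Lemma log_bracket (R : realType) (N : nat) (x : R) : (0 < N)%N -> N%:R <= expR x ->
  exists m, (N < 2 ^ m)%N /\ (m%:R : R) <= 2 * x + 1.
Proof.
move=> N0 Nx; have /andP[p1 p2] := trunc_log_bounds (isT : (1 < 2)%N) N0.
exists (trunc_log 2 N).+1; split=> //; rewrite -natr1 lerD2r.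
set t := trunc_log 2 N in p1 *.
have : expR (t%:R * (2^-1 : R)) <= expR x.
  rewrite expRM_natl; apply: le_trans Nx; apply: (@le_trans _ _ (2 ^+ t)).
    by rewrite lerXn2r ?nnegrE ?expR_ge0 // expR_half_le2.
  by rewrite -natrX ler_nat.
by rewrite ler_expR; lra.
Qed.

Section Exponents.
Variables (R : realType) (r l : nat) (y : R).
Hypothesis y1 : 1 <= y.
Hypothesis l2 : (2 <= l)%N.

Definition rolebase : nat := ((4 * r) ^ (r * r))%N.
Definition roles_y : R := rolebase%:R * y ^+ (r * r).
Definition poly_coef : nat := (32 * (r * r) * rolebase ^ 2 + 4 * 2 ^ (2 * kexp r l) + 128 * l ^ 2 * r)%N.
Definition codeg_y : R := 4 * roles_y * polyloss r l roles_y ^+ wexp l.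
Definition codeg_coef : nat := (4 * rolebase * poly_coef ^ wexp l)%N.
Definition codeg_exp : nat := (r * r + 2 * (r * r) * wexp l)%N.
Definition budget_y (gr : R) : R := (2 * l)%:R * (8 * (gain l)%:R * codeg_y * (4 * roles_y * gr) + 1).
Definition budget_coef : nat := (2 * l * (32 * gain l * codeg_coef * rolebase + 1) + 1)%N.
Definition budget_exp : nat := (codeg_exp + r * r)%N.
Definition steps_coef : nat := (2 * r * gain l * codeg_coef + 1)%N.

Let y0 : 0 <= y := le_trans ler01 y1.
Let yX k : 1 <= y ^+ k. Proof. exact: exprn_ege1. Qed.
Let yX0 k : 0 <= y ^+ k. Proof. exact: exprn_ge0. Qed.

Lemma roles_y_ge0 : 0 <= roles_y. Proof. by rewrite mulr_ge0. Qed.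

Lemma polyloss_ge0 : 0 <= polyloss r l roles_y.
Proof. by rewrite !addr_ge0 // mulr_ge0 ?exprn_ge0 ?roles_y_ge0. Qed.

Lemma polyloss_le : polyloss r l roles_y <= poly_coef%:R * y ^+ (2 * (r * r)).
Proof.
rewrite /polyloss /roleloss /poly_coef /roles_y (natrD _ (_ + _)) [in leRHS]mulrDl.
apply: lerD; last by rewrite ler_peMr.
rewrite (natrD _ (32 * (r * r) * _)) [in leRHS]mulrDl; apply: lerD.
- by rewrite exprMn -exprM [(r * r * 2)%N]mulnC (natrM _ (32 * (r * r))) (natrM _ 32) natrX !mulrA lexx.
by rewrite natrM natrX ler_peMr // mulr_ge0.
Qed.

Lemma codeg_le : codeg_y <= codeg_coef%:R * y ^+ codeg_exp.
Proof.
have -> : codeg_coef%:R * y ^+ codeg_exp = 4 * roles_y * (poly_coef%:R * y ^+ (2 * (r * r))) ^+ wexp l.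
  rewrite /codeg_coef /codeg_exp /roles_y exprMn -exprM exprD !natrM natrX; ring.
rewrite ler_wpM2l ?mulr_ge0 ?roles_y_ge0 // lerXn2r ?nnegrE ?polyloss_ge0 ?polyloss_le //.
by rewrite mulr_ge0.
Qed.

Lemma budget_le gr : 1 <= gr -> budget_y gr + 1 <= budget_coef%:R * y ^+ budget_exp * gr.
Proof.
move=> gr1; have gr0 : 0 <= gr := le_trans ler01 gr1.
rewrite /budget_coef natrD 2![in leRHS]mulrDl; apply: lerD; last by rewrite mul1r mulr_ege1.
rewrite /budget_y [(2 * l * _)%:R]natrM -[leRHS]mulrA -[leRHS]mulrA; apply: ler_wpM2l => //.
rewrite natrD [leRHS]mulrDl; apply: lerD; last by rewrite mul1r mulr_ege1.
have -> : (32 * gain l * codeg_coef * rolebase)%:R * (y ^+ budget_exp * gr)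
   = 8 * (gain l)%:R * (codeg_coef%:R * y ^+ codeg_exp) * (4 * roles_y * gr).
  rewrite /budget_exp /roles_y exprD !natrM; ring.
apply: ler_wpM2r; first by rewrite !mulr_ge0 ?roles_y_ge0.
by apply: ler_wpM2l; [rewrite mulr_ge0 | exact: codeg_le].
Qed.

Lemma steps_le : r%:R * y * (2 * (gain l)%:R * codeg_y) + 1 <= steps_coef%:R * y ^+ codeg_exp.+1.
Proof.
rewrite /steps_coef natrD [leRHS]mulrDl; apply: lerD; last by rewrite mul1r.
have -> : (2 * r * gain l * codeg_coef)%:R * y ^+ codeg_exp.+1
   = r%:R * y * (2 * (gain l)%:R * (codeg_coef%:R * y ^+ codeg_exp)).
  rewrite exprS !natrM; ring.
apply: ler_wpM2l; first by rewrite mulr_ge0.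
by apply: ler_wpM2l; [rewrite mulr_ge0 | exact: codeg_le].
Qed.

Lemma total_exponent (gr B k : R) : 1 <= gr -> 0 <= B -> 0 <= k ->
  (budget_coef * steps_coef * r.+1)%:R <= y ->
  B <= budget_y gr + 1 -> k <= r%:R * y * (2 * (gain l)%:R * codeg_y) + 1 ->
  B * k * (r%:R * y + 1) <= gr * y ^+ (budget_exp + codeg_exp + 3).
Proof.
move=> gr1 B0 k0 ybig Bb kb; have gr0 : 0 <= gr := le_trans ler01 gr1.
have Bb' := le_trans Bb (budget_le gr1); have kb' := le_trans kb steps_le.
have ry : r%:R * y + 1 <= r.+1%:R * y by rewrite -natr1 mulrDl mul1r lerD2l.
apply: (@le_trans _ _ (budget_coef%:R * y ^+ budget_exp * gr * (steps_coef%:R * y ^+ codeg_exp.+1)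
    * (r.+1%:R * y))).
  by apply: ler_pM => //; rewrite ?mulr_ge0 ?addr_ge0 ?mulr_ge0 //; exact: ler_pM.
have -> : budget_coef%:R * y ^+ budget_exp * gr * (steps_coef%:R * y ^+ codeg_exp.+1) * (r.+1%:R * y)
   = gr * (y ^+ (budget_exp + codeg_exp + 2) * (budget_coef * steps_coef * r.+1)%:R).
  rewrite exprS !exprD !natrM expr2; ring.
rewrite ler_wpM2l // [(_ + 3)%N]addnS exprSr ler_wpM2l //.
Qed.

End Exponents.

Lemma containers_large_log (R : realType) (r l n : nat) (K y : R) :
  (4 <= r)%N -> (2 <= l)%N -> (0 < n)%N -> n%:R = expR y -> 1 <= y ->
  (budget_coef r l * steps_coef r l * r.+1)%:R <= y ->
  (poly_coef r l ^ ((2 * l + 2) * l + 5))%:R * y ^+ (2 * (r * r) * ((2 * l + 2) * l + 5))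
    <= expR (y / (3 * (2 * (2 * l - 1) * (l - 1)))%:R) ->
  (4 * rolebase r * 2 ^ (2 * kexp r l) * (128 * l ^ 2 * r))%:R * y ^+ (2 * r ^ 2) <= K ->
  exists C : {set {set {set 'I_n}}},
    [/\ #|C|%:R <= expR (n%:R * expR (y / (2 * l%:R - 1)) * y ^+ (budget_exp r l + codeg_exp r l + 3)),
        (forall G : {set {set 'I_n}}, G \in C ->
           uniform r G /\ #|G|%:R <= K * n%:R ^+ (r - 1))
      & (forall H : {set {set 'I_n}}, uniform r H -> hfree (lin_cycle (2 * l) r) H ->
           exists2 G, G \in C & H \subset G)].
Proof.
move=> r4 l2 n0 ny y1 ybig zbig Kbig.
set E3 := (2 * (2 * l - 1) * (l - 1))%N in zbig.
have y0 : 0 <= y := le_trans ler01 y1.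
have r0 : (0 < r)%N by exact: leq_trans r4.
have E30 : (0 < E3)%N by rewrite !muln_gt0 /= !subn_gt0 l2 (leq_trans l2) // leq_pmull.
pose z := expR (y / (3 * E3)%:R).
have nz : n%:R = z ^+ (3 * E3).
  by rewrite ny -expRM_natl; congr expR; rewrite mulrC divfK // pnatr_eq0 -lt0n muln_gt0 E30.
have z1 : 1 <= z by rewrite -expR0 ler_expR divr_ge0.
have zT : polyloss r l (roles_y r y) ^+ ((2 * l + 2) * l + 5) <= z.
  apply: le_trans zbig; rewrite natrX exprM -exprMn.
  by rewrite lerXn2r ?nnegrE ?polyloss_le ?polyloss_ge0 ?mulr_ge0 ?exprn_ge0.
have z2 : 2 <= z.
  apply: le_trans zbig; rewrite -[leLHS]mulr1 ler_pM ?exprn_ege1 // ler_nat.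
  have c2 : (2 <= poly_coef r l)%N.
    rewrite /poly_coef; apply: leq_trans (leq_addr _ _); apply: leq_trans (leq_addl _ _).
    by rewrite (@leq_mul 2 1 4 _) // expn_gt0.
  apply: (leq_trans c2); rewrite -[leqLHS]expn1; apply: leq_pexp2l; first exact: ltnW.
  exact: (@leq_trans 5%N) (leq_addl _ _).
have [p [p0 pz zp]] := dyadic_bracket z2.
have b0 : (0 < rolebase r)%N by rewrite expn_gt0 muln_gt0 r0.
pose Mb := roles_y r y.
have Mb1 : 1 <= Mb by rewrite /Mb /roles_y mulr_ege1 ?exprn_ege1 // ler1n.
pose gr := growth l z n%:R.
have n1 : 1 <= (n%:R : R) by rewrite ler1n.
have gr1 : 1 <= gr by rewrite /gr /growth mulr_ege1 // exprn_ege1.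
pose Lc := codeg_y r l y.
have Lc1 : 1 <= Lc.
  rewrite /Lc /codeg_y mulr_ege1 //; first by rewrite mulr_ege1 // ler1n.
  rewrite exprn_ege1 // /polyloss -[X in X <= _]addr0 -[X in X + _ <= _]add0r; apply: lerD => //.
  apply: lerD; first by rewrite /roleloss !mulr_ge0 ?exprn_ge0 ?roles_y_ge0.
  by rewrite mulr_ege1 ?exprn_ege1 // ler1n.
pose D := 2 * (gain l)%:R * Lc.
have g0 : (0 < gain l)%N by rewrite !expn_gt0.
have D1 : 1 <= D by rewrite /D mulr_ege1 // mulr_ege1 // ler1n.
have D0 : 0 < D := lt_le_trans ltr01 D1.
have X0 : 0 <= budget_y r l y gr.
  rewrite /budget_y mulr_ge0 // addr_ge0 // !mulr_ge0 ?exprn_ge0 ?polyloss_ge0 ?roles_y_ge0 ?expR_ge0 //.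
pose b := (Num.truncn (budget_y r l y gr)).+1.
have bX : budget_y r l y gr <= b%:R by have /andP[_ /ltW] := Num.Theory.truncn_itv X0.
have Xb : b%:R <= budget_y r l y gr + 1.
  by rewrite -natr1 lerD2r; have /andP[] := Num.Theory.truncn_itv X0.
have k00 : 0 <= r%:R * y * D by rewrite mulr_ge0 ?(ltW D0) // mulr_ge0.
pose k := (Num.truncn (r%:R * y * D)).+1.
have kX : r%:R * y * D <= k%:R by have /andP[_ /ltW] := Num.Theory.truncn_itv k00.
have Xk : k%:R <= r%:R * y * D + 1.
  by rewrite -natr1 lerD2r; have /andP[] := Num.Theory.truncn_itv k00.
pose A : {set {set 'I_n}} := [set e : {set 'I_n} | #|e| == r].
have cardA (G : {set {set 'I_n}}) : G \subset A -> (#|G| <= n ^ r)%N.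
  move=> /subset_leq_card GA; apply: leq_trans GA _; rewrite card_draws card_ord; exact: bin_le_expn.
have nr : (n ^ r)%:R = expR (r%:R * y) :> R by rewrite natrX ny expRM_natl.
pose T := K * n%:R ^+ (r - 1).
have K1 : 1 <= K.
  apply: le_trans Kbig; rewrite mulr_ege1 ?exprn_ege1 // ler1n !muln_gt0 b0 /= r0 (ltnW l2) andbT.
  by rewrite expn_gt0.
have T1 : 1 <= T by rewrite mulr_ege1 // exprn_ege1.
pose q := 1 - D^-1.
have q0 : 0 <= q by rewrite subr_ge0 invf_le1.
have B0 : (0 < (n ^ r).+1 ^ b)%N by rewrite expn_gt0.
have step (G : {set {set 'I_n}}) : G \subset A -> T < #|G|%:R ->
    exists CC : {set {set {set 'I_n}}},
    [/\ (#|CC| <= (n ^ r).+1 ^ b)%N,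
        forall C, C \in CC -> C \subset G /\ #|C|%:R <= q * #|G|%:R
      & forall I : {set {set 'I_n}}, I \subset G -> hfree (lin_cycle (2 * l) r) I ->
          exists2 C, C \in CC & I \subset C].
  move=> GA GT; have Gr e : e \in G -> #|e| = r by move/(subsetP GA); rewrite inE => /eqP.
  have G0 : (0 < #|G|)%N by rewrite -(ltr0n R); apply: lt_trans GT; exact: lt_le_trans T1.
  have Gy : #|G|%:R <= expR (r%:R * y) by rewrite -nr ler_nat cardA.
  have [m [Gm my]] := log_bracket G0 Gy.
  have m4 : m%:R <= 4 * r%:R * y.
    apply: le_trans my _; have : 1 <= r%:R * y by rewrite mulr_ege1 // ler1n.
    rewrite -mulrA; move: (r%:R * y) => w; clear; lra.
  have mM : (m ^ (r * r))%:R <= Mb.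
    rewrite /Mb /roles_y /rolebase !natrX -exprMn lerXn2r ?nnegrE ?mulr_ge0 //.
    by rewrite natrM.
  have Gbig : 4 * Mb * 2 ^+ (2 * kexp r l) * (128 * l ^ 2 * r)%:R * n%:R ^+ (r - 1) <= #|G|%:R.
    apply: le_trans (ltW GT); rewrite /T ler_wpM2r ?exprn_ge0 //; apply: le_trans Kbig.
    have -> : 4 * Mb * 2 ^+ (2 * kexp r l) * (128 * l ^ 2 * r)%:R
        = (4 * rolebase r * 2 ^ (2 * kexp r l) * (128 * l ^ 2 * r))%:R * y ^+ (r * r).
      rewrite /Mb /roles_y !(natrM _ (4 * rolebase r * 2 ^ (2 * kexp r l))).
      rewrite (natrM _ (4 * rolebase r)) (natrM _ 4 (rolebase r)) natrX; ring.
    rewrite ler_wpM2l //; apply: ler_weXn2l => //.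
    by rewrite -mulnn leq_pmull.
  have [CC [c1 c2 c3]] := step_containers r4 l2 n0 z1 nz p0 pz zp zT Gr Gm Mb1 mM Gbig bX.
  exists CC; split=> //; apply: leq_trans c1 _.
  by rewrite leq_exp2r // ltnS cardA.
have [CC [c1 c2 c3]] := iterate_containers q0 B0 step k.
exists CC; split.
- apply: le_trans (_ : ((n ^ r).+1 ^ (b * k))%:R <= _); first by rewrite ler_nat expnM.
  have nr1 : ((n ^ r).+1)%:R <= expR (r%:R * y + 1).
    rewrite -natr1 nr expRD; have e2 : 2 <= expR 1 :> R by apply: le_trans (expR_ge1Dx _); clear; lra.
    have e1 : 1 <= expR (r%:R * y) by rewrite -expR0 ler_expR mulr_ge0.
    move: (expR 1) (expR (r%:R * y)) e1 e2 => u v v1 u2; clear -v1 u2; nra.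
  rewrite natrX; apply: (@le_trans _ _ (expR (r%:R * y + 1) ^+ (b * k))).
    by rewrite lerXn2r ?nnegrE ?expR_ge0.
  rewrite -expRM_natl ler_expR natrM.
  apply: le_trans (total_exponent y1 gr1 _ _ ybig Xb Xk) _ => //.
  have -> : expR (y / (2 * l%:R - 1)) = z ^+ (6 * (l - 1)).
    have l60 : (6 * (l - 1))%:R != 0 :> R by rewrite pnatr_eq0 -lt0n muln_gt0 subn_gt0.
    have l21 : (2 * l - 1)%:R != 0 :> R.
      by rewrite pnatr_eq0 -lt0n subn_gt0 (leq_trans l2) // leq_pmull.
    have <- : (2 * l - 1)%:R = 2 * l%:R - 1 :> R.
      by rewrite natrB ?natrM // muln_gt0 (ltnW l2).
    have E3E : (3 * E3 = (2 * l - 1) * (6 * (l - 1)))%N.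
      rewrite /E3; clear; move: (2 * l - 1)%N (l - 1)%N => u v; lia.
    rewrite /z E3E -expRM_natl (natrM _ (2 * l - 1)); congr expR.
    move: l60 l21; move: ((6 * (l - 1))%:R : R) ((2 * l - 1)%:R : R) => u v u0 v0; field; exact/andP.
  by rewrite /gr /growth.
- move=> G /c2[GA Gs]; split.
    apply/forall_inP => e /(subsetP GA); by rewrite inE.
  case: Gs => // Gs; apply: le_trans Gs _; apply: le_trans T1.
  have q1 : q <= expR (- D^-1) by apply: expR_ge1Dx.
  apply: (@le_trans _ _ (expR (- D^-1) ^+ k * (n ^ r)%:R)).
    by rewrite ler_pM ?exprn_ge0 // ?ler_nat ?cardA // lerXn2r ?nnegrE ?expR_ge0.
  rewrite nr -expRM_natl -expRD -[leRHS]expR0 ler_expR.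
  rewrite mulrN addrC subr_le0 ler_pdivlMr //.
move=> H Hu Hfree; apply: c3 => //; apply/subsetP => e eH; rewrite inE.
by move/forall_inP: Hu => /(_ e eH).
Qed.

Unset Implicit Arguments.
Theorem theorem5p3 (R : realType) (r l : nat) (hr : (4 <= r)%N)
    (hl : (2 <= l)%N) :
  exists (K0 : nat) (c : R), 0 < c /\
    exists n0 : nat, forall n : nat, (n0 <= n)%N ->
    forall K : R, K0%:R * ln (n%:R : R) ^+ (2 * r ^ 2) <= K ->
    exists C : {set {set {set 'I_n}}},
      [/\ (#|C|%:R : R) <=
            expR (n%:R `^ (1 + (2 * l%:R - 1)^-1) * ln n%:R `^ c),
          (forall G : {set {set 'I_n}}, G \in C ->
             uniform r G /\ (#|G|%:R : R) <= K * n%:R ^+ (r - 1))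
        & (forall H : {set {set 'I_n}}, uniform r H ->
             hfree (lin_cycle (2 * l) r) H ->
             exists2 G, G \in C & H \subset G)].
Proof.
have E30 : (0 < 3 * (2 * (2 * l - 1) * (l - 1)))%N.
  by rewrite !muln_gt0 /= !subn_gt0 hl (leq_trans hl) // leq_pmull.
have [Y1 hY1] := poly_le_expR R (poly_coef r l ^ ((2 * l + 2) * l + 5))
  (2 * (r * r) * ((2 * l + 2) * l + 5)) E30.
pose c := (budget_exp r l + codeg_exp r l + 3)%N.
pose Y := `|Y1| + 1 + (budget_coef r l * steps_coef r l * r.+1)%:R.
exists (4 * rolebase r * 2 ^ (2 * kexp r l) * (128 * l ^ 2 * r))%N, c%:R; split.
  by rewrite ltr0n /c addnS.
exists (Num.truncn (expR Y)).+1 => n nn K hK.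
have n0 : (0 < n)%N by apply: leq_trans nn.
have n0R : 0 < (n%:R : R) by rewrite ltr0n.
have ny : n%:R = expR (ln n%:R) :> R by rewrite lnK // posrE.
have Yy : Y <= ln n%:R.
  rewrite -ler_expR -ny; have /andP[_ /ltW h] := Num.Theory.truncn_itv (expR_ge0 Y).
  by apply: le_trans h _; rewrite ler_nat.
have Y1y : Y1 <= ln n%:R.
  by apply: le_trans Yy; apply: le_trans (ler_norm _) _; rewrite /Y -addrA lerDl addr_ge0.
have y1 : 1 <= ln n%:R :> R.
  by apply: le_trans Yy; rewrite /Y addrAC lerDr addr_ge0.
have yb : (budget_coef r l * steps_coef r l * r.+1)%:R <= ln n%:R :> R.
  by apply: le_trans Yy; rewrite /Y lerDr addr_ge0.
have [C [c1 c2 c3]] := containers_large_log hr hl n0 ny y1 yb (hY1 _ Y1y) hK.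
exists C; split=> //; apply: le_trans c1 _.
rewrite powR_mulrn ?(le_trans ler01) // powRD; last by rewrite (gt_eqF n0R) implybT.
by rewrite powRr1 ?(ltW n0R) // /powR gt_eqF // [_ / (_ - 1)]mulrC.

Qed.
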